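(* Let $\{S_n\}_{n=0}^\infty$ be the dynamic elephant random walk (DERW) with parameters $p,q\in[0,1]$ and sequences $\alpha=\{\alpha_n\}_{n\ge1}$, $\beta=\{\beta_n\}_{n\ge1}$ in $[0,1]$. Suppose one of the following two conditions holds: (I) $3/4<p<1$ and $\ell_{\inf}(\alpha)>\frac{1}{4p-2}$. (II) $p=1$, $\frac{1}{4p-2}<\ell_{\inf}(\alpha)\le\ell_{\sup}(\alpha)<1$, and $0<\ell_{\inf}(\beta)\le\ell_{\sup}(\beta)<\frac{1-\ell_{\sup}(\alpha)}{1-\ell_{\inf}(\alpha)}$. Let $M$ denote the almost sure (and $L^2$) limit of $(S_n-E[S_n])/a_n$ as $n\to\infty$. Then the following assertions hold: (i) (Central Limit Theorem) As $n\to\infty$, $$\frac{S_n-E[S_n]-a_nM}{a_n\sqrt{A_\infty^2-A_n^2}}\overset{d}{\to}N(0,1),$$ where $\overset{d}{\to}$ denotes convergence in distribution and $N(0,1)$ is the standard normal distribution. (ii) (Law of the Iterated Logarithm) For each of the two choices of sign $\pm$, $$\limsup_{n\to\infty}\pm\frac{S_n-E[S_n]-a_nM}{a_n\sqrt{2(A_\infty^2-A_n^2)\log|\log(A_\infty^2-A_n^2)|}}=1\quad\text{almost surely}.$$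
   Context: Definition of the DERW. Let $p,q\in[0,1]$ be constants and let $\alpha=\{\alpha_n\}_{n=1}^\infty$, $\beta=\{\beta_n\}_{n=1}^\infty$ be (deterministic) sequences in $[0,1]$. The DERW is a $\mathbb{Z}$-valued stochastic process $\{S_n\}_{n=0}^\infty$ on a probability space $(\Omega,\mathcal{F},P)$ such that $S_0=0$, the increments $X_n:=S_n-S_{n-1}$ ($n\ge1$) take values in $\{-1,+1\}$, and $$E[X_1]=\alpha_1(2q-1)+(1-\alpha_1)(2\beta_1-1),$$ $$E[X_{n+1}\mid\mathcal{F}_n^X]=\frac{\alpha_{n+1}(2p-1)}{n}\,S_n+(1-\alpha_{n+1})(2\beta_{n+1}-1)\quad(n\ge1),$$ where $\mathcal{F}_n^X:=\sigma(X_1,\ldots,X_n)$. These equations determine the joint law of the process. Notation. $\ell_{\inf}(\alpha):=\liminf_{n\to\infty}\alpha_n$, $\ell_{\sup}(\alpha):=\limsup_{n\to\infty}\alpha_n$, $\ell_{\inf}(\beta):=\liminf_{n\to\infty}\beta_n$, $\ell_{\sup}(\beta):=\limsup_{n\to\infty}\beta_n$. $a_1:=1$ and $a_n:=\prod_{k=1}^{n-1}\left(1+\frac{(2p-1)\alpha_{k+1}}{k}\right)$ for $n\ge2$. $A_n^2:=\sum_{k=1}^n\frac{1}{a_k^2}\left(1-E[X_k]^2\right)$ for $n\in\mathbb{N}\cup\{\infty\}$. Known facts (Coletti, de Lima, Gava, Luiz): if $p>3/4$ and $\ell_{\inf}(\alpha)>\frac{1}{4p-2}$, then $\sum_{k=1}^\infty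 1/a_k^2<\infty$ (so $A_\infty^2<\infty$), and $(S_n-E[S_n])/a_n$ converges almost surely and in $L^2$ to a non-degenerate zero-mean random variable; this limit is $M$. *)

(* Defs.v *)
From HB Require Import structures.
From mathcomp Require Import all_boot all_order all_algebra.
From mathcomp Require Import all_classical all_reals all_analysis.

Set Implicit Arguments.
Unset Strict Implicit.
Unset Printing Implicit Defensive.
Import Order.TTheory GRing.Theory Num.Theory.
Import numFieldNormedType.Exports.

Local Open Scope classical_set_scope.
Local Open Scope ring_scope.

(** [Y] is a version of E[X | G]; [G] is meant to be a sub-sigma-algebra of the
    measurable sets and [X] to be integrable. *)
Definition is_cond_exp (d : measure_display) (T : measurableType d)
    (R : realType) (P : probability T R) (G : set (set T)) (X Y : T -> R) :=
  [/\ forall B : set R, measurable B -> G (Y @^-1` B),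
      P.-integrable setT (EFin \o Y) &
      forall A, G A -> (\int[P]_(w in A) (X w)%:E = \int[P]_(w in A) (Y w)%:E)%E].

(** Convergence of the distribution functions of the [Z n] to that of [nu], at
    every continuity point of the latter. *)
Definition cvg_in_distribution (d : measure_display) (T : measurableType d)
    (R : realType) (P : probability T R) (Z : nat -> T -> R)
    (nu : set R -> \bar R) :=
  forall x : R, {for x, continuous (fun y : R => nu `]-oo, y]%classic)} ->
    P [set w | Z n w <= x] @[n --> \oo] --> nu `]-oo, x]%classic.

(** X_n = S_n - S_{n-1}; only meaningful for n >= 1. *)
Definition incr (T : Type) (R : realType) (S : nat -> T -> R) (n : nat) : T -> R :=
  fun w => S n w - S n.-1 w.

(** sigma(X_1, ..., X_n). *)
Definition incr_filtration (T : Type) (R : realType) (S : nat -> T -> R)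
    (n : nat) : set (set T) :=
  g_sigma_preimage (fun i : 'I_n => incr S i.+1).

(** [S] is real-valued for convenience: [derw0] and [derw_step] force its values
    to be integers. [alpha 0] and [beta 0] are never used. *)
Record is_derw (d : measure_display) (T : measurableType d) (R : realType)
    (P : probability T R) (p q : R) (alpha beta : nat -> R)
    (S : nat -> {RV P >-> R}) : Prop := IsDerw {
  derw0 : forall w, S 0%N w = 0;
  derw_step : forall n w, (0 < n)%N -> incr S n w = -1 \/ incr S n w = 1;
  derw_mean1 : ('E_P[incr S 1])%E =
    (alpha 1%N * (2 * q - 1) + (1 - alpha 1%N) * (2 * beta 1%N - 1))%:E;
  derw_cond_mean : forall n, (0 < n)%N ->
    is_cond_exp P (incr_filtration S n) (incr S n.+1)
      (fun w => alpha n.+1 * (2 * p - 1) / n%:R * S n w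
                + (1 - alpha n.+1) * (2 * beta n.+1 - 1)) }.
Arguments is_derw {d T R} P p q alpha beta S.

Definition derw_a (R : realType) (p : R) (alpha : nat -> R) (n : nat) : R :=
  \prod_(1 <= k < n) (1 + (2 * p - 1) * alpha k.+1 / k%:R).

(** A_n^2, for finite n. *)
Definition derw_A2 (d : measure_display) (T : measurableType d) (R : realType)
    (P : probability T R) (p : R) (alpha : nat -> R) (S : nat -> T -> R)
    (n : nat) : R :=
  \sum_(1 <= k < n.+1)
    (1 - fine ('E_P[incr S k])%E ^+ 2) / derw_a p alpha k ^+ 2.

(** A_oo^2. As a limit in [R], this is junk if the series diverges. *)
Definition derw_A2oo (d : measure_display) (T : measurableType d) (R : realType)
    (P : probability T R) (p : R) (alpha : nat -> R) (S : nat -> T -> R) : R :=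
  limn (derw_A2 P p alpha S).

(* Main.v *)
Require Import Defs.
From HB Require Import structures.
From mathcomp Require Import all_boot all_order all_algebra.
From mathcomp Require Import all_classical all_reals all_analysis.
From mathcomp Require Import ring lra.

(** The rescaled walk M_n = (S_n - E S_n) / a_n is a martingale: its
    increments are (X_(n+1) - m_n) / a_(n+1), where m_n is the conditional
    mean of X_(n+1). Because X_(n+1) is a sign, the conditional variance of
    the increment is (1 - m_n^2) / a_(n+1)^2. It is random, but m_n - E
    X_(n+1) is M_n times a quantity of order a_n / n, which decays like a
    power of n and hence like a power of V_n = A_oo^2 - A_n^2. So, up to a
    relative error V_n^delta, the tail M - M_n behaves like a sum of
    independent variables of total variance V_n, and both assertions are
    those which hold for such a sum.

    All distributional estimates are carried out on the binary tree of
    histories: a history is the list of the past signs, newest first, and a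
    conditional expectation given a history is a finite iteration of the
    one-step average. The defining equations of the walk identify the
    probability of every event about the first n steps with such a finite
    expectation (history_law_from). The limit M enters only through
    convergence in probability (limit_tail) and almost surely.

    Central limit theorem (walk_clt). The Gaussian function gcdf ((x - y) /
    sqrt (e + t)) solves the heat equation; it is a smoothed indicator of x
    > y at t = 0, and its value at t = 1, x = 0 is the Gaussian probability
    gcdf (- y / sqrt (e + 1)). Evaluated at remaining time V_k / V_n and
    position (M_k - M_n) / sqrt V_n it is almost a martingale: its one-step
    error is absorbed by the decrease of the supermartingale B (1 + M_k^2 +
    C V_k) V_k. The outcome is a bound with an explicit error K (1 + M_n^2)
    V_n^delta, valid conditionally on any sufficiently long history and
    uniformly in the horizon. Both features are essential for the iterated
    logarithm.

    Upper half of the iterated logarithm (lil_upper_ae). Let n_r be the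
    first index with V_(n_r) <= rho^r. At the times n_r the conditional
    bound and the Gaussian tail give exceedance probabilities of order
    r^-(1+e) + rho^(delta r), which are summable. Between n_r and n_(r+1)
    the martingale moves little when rho is close to 1, by an exponential
    supermartingale and the maximal inequality (walk_maximal).

    Lower half (lil_lower_ae). For small rho almost all of V_(n_r) is spent
    between n_r and n_(r+1). Given a history along which M is bounded, the
    increment over the block exceeds (1 - eta) sqrt (2 rho^r log r) with
    probability at least const / r. The probability that this never happens
    from some block on is a product of factors 1 - const / r, which is 0.
    The rest of the tail after n_(r+1) is negligible by the upper half.

    Finally, a_(n+1) / a_n = 1 + kappa_n / n with 1/2 + eps <= kappa_n <= 1
    - d for large n under either of the two conditions on the parameters.
    The lower bound makes n / a_n^2 decrease fast enough for the summability
    of 1 / a_n^2 (Raabe), the upper bound gives the decay of a_n / n, and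
    the conditions also keep the squared means of the steps away from 1, so
    that V_n is at least of order n / a_n^2 (norming_rates). *)

Set Implicit Arguments.
Unset Strict Implicit.
Unset Printing Implicit Defensive.
Import Order.TTheory GRing.Theory Num.Theory.
Import numFieldNormedType.Exports.

Local Open Scope classical_set_scope.
Local Open Scope ring_scope.

(** * The standard normal distribution function *)

Section gaussian.
Context {R : realType}.
Implicit Types x y z : R.

Definition gpdf x : R := normal_peak 1 * expR (- x ^+ 2 / 2).
Definition gcdf x : R := fine (normal_prob 0 1 `]-oo, x]%classic).

Lemma gcdfE x : (gcdf x)%:E = normal_prob 0 1 `]-oo, x]%classic.
Proof. by rewrite fineK// fin_num_measure. Qed.

Lemma gcdf_ge0 x : 0 <= gcdf x.
Proof. by rewrite -lee_fin gcdfE measure_ge0. Qed.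

Lemma gcdf_le1 x : gcdf x <= 1.
Proof. by rewrite -lee_fin gcdfE probability_le1. Qed.

Lemma gcdf_le x y : x <= y -> gcdf x <= gcdf y.
Proof.
move=> xy; rewrite -lee_fin !gcdfE le_measure ?inE//.
by apply: subset_itvl; rewrite bnd_simp.
Qed.

Lemma normal_pdf01 : normal_pdf (0 : R) 1 = gpdf.
Proof.
apply/funext => x; rewrite normal_pdfE ?oner_neq0// /normal_fun /gpdf.
by rewrite subr0 expr1n.
Qed.

Lemma is_derive_gcdf x : is_derive x 1 gcdf (gpdf x).
Proof.
have intu u : (@lebesgue_measure R).-integrable `]-oo, u]%classic (EFin \o gpdf).
  apply: (@integrableS _ _ _ _ setT) => //.
  by rewrite -normal_pdf01; exact: integrable_normal_pdf.
have cg : {for x, continuous gpdf}.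
  by rewrite -normal_pdf01; apply: continuous_normal_pdf; exact: oner_neq0.
have xu : x < x + 1 by rewrite ltrDl.
pose F y := Rintegral lebesgue_measure `]-oo, y]%classic gpdf.
have FE : F = gcdf.
  by apply/funext => y; rewrite /F /gcdf /normal_prob normal_pdf01.
have [] : derivable F x 1 /\ (F^`() x)%classic = gpdf x.
  exact: (continuous_FTC1 xu (intu _) (ltNyr _) cg).
rewrite FE => df dE; apply: DeriveDef; first exact: df.
by move: dE; rewrite derive1E.
Qed.

Lemma gpdf_gt0 x : 0 < gpdf x.
Proof. by rewrite mulr_gt0 ?expR_gt0// normal_peak_gt0 ?oner_neq0. Qed.

Lemma gpdf_le_exp x : gpdf x <= expR (- x ^+ 2 / 2).
Proof.
rewrite ler_piMl ?expR_ge0// /normal_peak invf_le1.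
  rewrite -[X in X <= _]sqrtr1 ler_sqrt; have := @pi_ge2 R; rewrite expr1n mul1r; lra.
by rewrite sqrtr_gt0 expr1n mul1r; have := @pi_ge2 R; lra.
Qed.

Lemma is_derive_gpdf x : is_derive x 1 gpdf (- x * gpdf x).
Proof.
apply: is_derive_eq.
by rewrite /= /GRing.scale/= /gpdf; field.
Qed.

Lemma mean_value (f df : R -> R) a b : a <= b ->
  (forall x, a <= x <= b -> is_derive x 1 f (df x)) ->
  exists2 c, a <= c <= b & f b - f a = df c * (b - a).
Proof.
move=> ab dfE.
have [||x] := @MVT_segment R f df a b ab.
- by move=> x /itvP xab; apply: dfE; rewrite !xab.
- apply: derivable_within_continuous => y; rewrite in_itv/= => yab.
  exact: (@ex_derive _ _ _ _ _ _ _ (dfE _ yab)).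
- by rewrite in_itv/= => xab ->; exists x.
Qed.

(** The hull of the two end points is used because Taylor expansions need
    increments of either sign. *)
Lemma mean_value_norm (f df : R -> R) a b C :
  (forall x, Num.min a b <= x <= Num.max a b -> is_derive x 1 f (df x)) ->
  (forall x, Num.min a b <= x <= Num.max a b -> `|df x| <= C) ->
  `|f b - f a| <= C * `|b - a|.
Proof.
wlog ab : a b / a <= b.
  move=> H dfE dfC; have [ab|/ltW ba] := leP a b; first exact: H.
  rewrite distrC [in X in _ <= X]distrC; apply: H => //.
  + by move=> x; rewrite minC maxC; exact: dfE.
  + by move=> x; rewrite minC maxC; exact: dfC.
rewrite min_l// max_r// => dfE dfC.
have [c cab ->] := mean_value ab dfE.
by rewrite normrM ler_wpM2r// dfC.
Qed.

Lemma nondecreasing_derive (f df : R -> R) a b : a <= b ->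
  (forall x, a <= x <= b -> is_derive x 1 f (df x)) ->
  (forall x, a <= x <= b -> 0 <= df x) -> f a <= f b.
Proof.
move=> ab dfE df0; rewrite -subr_ge0; have [c cab ->] := mean_value ab dfE.
by rewrite mulr_ge0 ?df0// subr_ge0.
Qed.

Lemma gpdfN x : gpdf (- x) = gpdf x.
Proof. by rewrite /gpdf sqrrN. Qed.

Let idR : measurableTypeR R -> R := idfun.
#[local] HB.instance Definition _ :=
  @isMeasurableFun.Build _ _ _ _ idR (@measurable_id _ _ setT).

Lemma gcdf_cvgNy : gcdf x @[x --> -oo] --> (0 : R).
Proof.
have /fine_cvg := @cvg_cdfNy0 _ _ _ (normal_prob (0 : R) 1) idR.
exact.
Qed.

Lemma gcdf_cvgy : gcdf x @[x --> +oo] --> (1 : R).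
Proof.
have /fine_cvg := @cvg_cdfy1 _ _ _ (normal_prob (0 : R) 1) idR.
exact.
Qed.

Lemma gcdfN x : gcdf (- x) = 1 - gcdf x.
Proof.
pose f y := gcdf y + gcdf (- y).
have fc y : f y = f 0.
  apply: (is_derive_0_is_cst (f := f)) => z.
  have dN : is_derive (- z) 1 gcdf (gpdf (- z)) by exact: is_derive_gcdf.
  have dP : is_derive z 1 gcdf (gpdf z) by exact: is_derive_gcdf.
  by apply: is_derive_eq; rewrite /= gpdfN mulrN1 subrr.
suff f1 : f 0 = 1 by rewrite -f1 -(fc x) /f [_ + gcdf (- x)]addrC addrK.
have : f y @[y --> +oo] --> (1 : R) + 0.
  apply: cvgD; first exact: gcdf_cvgy.
  apply: (cvg_comp (fun y : R => - y) gcdf _ gcdf_cvgNy).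
  by apply/cvgNrNy; exact: cvg_id.
rewrite (_ : f = cst (f 0)); last by apply/funext => y; rewrite fc.
rewrite addr0 => /cvg_lim <-//; rewrite lim_cst//.
Qed.

(** The function gcdf (- z) - gpdf z has derivative (z - 1) gpdf z, so it is
    nondecreasing beyond 1; as its limit is 0 it cannot be positive there. *)
Lemma gcdf_upper_tail y : 1 <= y -> gcdf (- y) <= gpdf y.
Proof.
move=> y1; rewrite leNgt; apply/negP => lt_gpdf.
pose f z := gcdf (- z) - gpdf z.
have df z : is_derive z 1 f (gpdf z * (z - 1)).
  have dN : is_derive (- z) 1 gcdf (gpdf (- z)) by exact: is_derive_gcdf.
  have dP : is_derive z 1 gpdf (- z * gpdf z) by exact: is_derive_gpdf.
  by apply: is_derive_eq; rewrite /= gpdfN; ring.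
have fy : 0 < f y by rewrite subr_gt0.
have fge z : y <= z -> f y <= gcdf (- z).
  move=> yz; apply: (@le_trans _ _ (f z)); last by rewrite gerBl ltW ?gpdf_gt0.
  apply: (nondecreasing_derive yz (fun x _ => df x)) => x /andP[yx _].
  by rewrite mulr_ge0 ?(ltW (gpdf_gt0 _))// subr_ge0 (le_trans y1).
have /cvgrPdist_lt/(_ _ fy) [A [Ar AP]] := gcdf_cvgNy.
have := AP (Num.min (A - 1) (- y)).
rewrite sub0r normrN ger0_norm ?gcdf_ge0// gt_min ltrBlDr ltrDl ltr01.
move=> /(_ isT); rewrite ltNge => /negP; apply.
by rewrite -[Num.min _ _]opprK; apply: fge; rewrite lerNr ge_min lexx orbT.
Qed.

(** The mass of an interval of length one next to the point, on which the
    density is smallest at the far end, already suffices. *)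
Lemma gcdf_lower_tail y : 0 <= y -> gpdf (y + 1) <= gcdf (- y).
Proof.
move=> y0.
have [||c cy] := @mean_value gcdf gpdf (- y - 1) (- y).
- by rewrite gerBl.
- by move=> x _; exact: is_derive_gcdf.
rewrite opprB addrCA subrr addr0 mulr1 => E.
apply: (@le_trans _ _ (gpdf c)); last by rewrite -E gerBl gcdf_ge0.
rewrite /gpdf ler_wpM2l ?normal_peak_ge0// ler_expR ler_pM2r// lerN2.
by nra.
Qed.

Lemma gcdf_gt0 x : 0 < gcdf x.
Proof.
have y0 : 0 <= `|x| by [].
apply: (lt_le_trans (gpdf_gt0 (`|x| + 1))); apply: (le_trans (gcdf_lower_tail y0)).
by apply: gcdf_le; rewrite lerNl -normrN ler_norm.
Qed.

Lemma gcdf_lipschitz (x y : R) : x <= y -> gcdf y <= gcdf x + (y - x).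
Proof.
move=> xy; rewrite addrC -lerBlDr.
have [z zxy ->] := @mean_value gcdf gpdf x y xy (fun z _ => is_derive_gcdf z).
rewrite ler_piMl ?subr_ge0// (le_trans (gpdf_le_exp z))// -expR0 ler_expR.
by rewrite mulNr oppr_le0 divr_ge0// sqr_ge0.
Qed.

Lemma gcdf_small (eta : R) : 0 < eta -> exists2 z0, 1 <= z0 &
  forall z, z0 <= z -> gcdf (- z) <= eta.
Proof.
move=> e0; exists (Num.max 1 (- ln eta *+ 2)); first by rewrite le_max lexx.
move=> z; rewrite ge_max => /andP[z1 hz].
apply: (le_trans (gcdf_upper_tail z1)); apply: (le_trans (gpdf_le_exp z)).
rewrite -[X in _ <= X]lnK ?posrE// ler_expR; move: hz; rewrite mulr2n; nra.
Qed.

Lemma gcdf_tail_sqr (Y B : R) : 1 <= Y -> 2 * B <= Y ^+ 2 ->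
  gcdf (- Y) <= expR (- B).
Proof.
move=> Y1 YB; apply: (le_trans (gcdf_upper_tail Y1)).
by apply: (le_trans (gpdf_le_exp Y)); rewrite ler_expR; lra.
Qed.

End gaussian.

(** * Gaussian solutions of the heat equation *)

Section heat.
Context {R : realType}.
Implicit Types (x y z t e : R).

Lemma between0_norm (s z : R) : Num.min 0 s <= z <= Num.max 0 s -> `|z| <= `|s|.
Proof.
have [s0|s0] := leP 0 s.
  by move=> /andP[z0 zs]; rewrite !ger0_norm.
by move=> /andP[sz z0]; rewrite !ler0_norm ?(ltW s0)// lerN2.
Qed.

Lemma is_derive_addl (c t : R) : is_derive t 1 (fun u => c + u) 1.
Proof.
have := is_deriveD (is_derive_cst c t 1) (is_derive_id t (1 : R)).
by rewrite add0r.
Qed.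

(** Second order Taylor formula, obtained by applying the mean value
    inequality twice instead of introducing the remainder in integral form;
    this costs only the factor 1/6. *)
Lemma taylor2 (g g1 g2 g3 : R -> R) (C : R) :
  (forall x, is_derive x 1 g (g1 x)) -> (forall x, is_derive x 1 g1 (g2 x)) ->
  (forall x, is_derive x 1 g2 (g3 x)) -> (forall x, `|g3 x| <= C) ->
  forall x d, `|g (x + d) - g x - g1 x * d - g2 x * (d ^+ 2 / 2)| <= C * `|d| ^+ 3.
Proof.
move=> dg dg1 dg2 g3C x d.
pose F (s : R) := g (x + s) - g x - g1 x * s - g2 x * (s ^+ 2 / 2).
pose F1 (s : R) := g1 (x + s) - g1 x - g2 x * s.
have dF (s : R) : is_derive s 1 F (F1 s).
  have dgs : is_derive (x + s) 1 g (g1 (x + s)) by [].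
  by apply: is_derive_eq; rewrite /F1 /GRing.scale/=; field.
have dF1 (s : R) : is_derive s 1 F1 (g2 (x + s) - g2 x).
  have dgs : is_derive (x + s) 1 g1 (g2 (x + s)) by [].
  by apply: is_derive_eq; rewrite /GRing.scale/=; ring.
have F2C (s : R) : `|g2 (x + s) - g2 x| <= C * `|s|.
  have := @mean_value_norm _ g2 g3 x (x + s) C (fun z _ => dg2 z) (fun z _ => g3C z).
  by rewrite addrAC subrr add0r.
have F1C (s : R) : `|s| <= `|d| -> `|F1 s| <= C * `|d| ^+ 2.
  have C0 : 0 <= C by exact: le_trans (g3C 0).
  move=> sd; have := @mean_value_norm _ F1 _ 0 s (C * `|d|) (fun z _ => dF1 z).
  rewrite {2}/F1 addr0 mulr0 !subr0 subrr subr0 => H; apply: (le_trans (H _)).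
    move=> z /between0_norm zs; apply: (le_trans (F2C z)).
    by rewrite ler_wpM2l// (le_trans zs).
  by rewrite expr2 mulrA ler_wpM2l// mulr_ge0.
have := @mean_value_norm _ F _ 0 d (C * `|d| ^+ 2) (fun z _ => dF z).
rewrite {2}/F addr0 expr0n/= mul0r !mulr0 !subr0 subrr subr0 => H.
rewrite [`|d| ^+ 3]exprSr [X in _ <= X]mulrA; exact: (H (fun z zd => F1C z (between0_norm zd))).
Qed.

(** A single bound that controls the density times any polynomial of degree
    at most four, hence all derivatives of gcdf needed below. *)
Lemma gpdf_poly z : gpdf z * (1 + z ^+ 2 / 4) ^+ 2 <= 1.
Proof.
have h : (1 + z ^+ 2 / 4) ^+ 2 <= expR (z ^+ 2 / 2).
  have -> : z ^+ 2 / 2 = z ^+ 2 / 4 *+ 2 by field.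
  rewrite mulr2n expRD -expr2 ler_pXn2r// ?nnegrE ?expR_ge0 ?expR_ge1Dx//.
  by rewrite addr_ge0// divr_ge0// sqr_ge0.
apply: (le_trans (ler_wpM2r (sqr_ge0 _) (gpdf_le_exp z))).
apply: (le_trans (ler_wpM2l (expR_ge0 _) h)).
by rewrite -expRD mulNr addNr expR0.
Qed.

Lemma gpdf_poly1 z : `|z * gpdf z| <= 1.
Proof.
have p0 := gpdf_gt0 z; have := gpdf_poly z.
have h : `|z| <= 1 * (1 + z ^+ 2 / 4) ^+ 2.
  by rewrite ler_norml; apply/andP; split; nra.
rewrite normrM (gtr0_norm p0) => H.
by apply: (le_trans (ler_wpM2r (ltW p0) h)); lra.
Qed.

Lemma gpdf_poly2 z : `|(z ^+ 2 - 1) * gpdf z| <= 4.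
Proof.
have p0 := gpdf_gt0 z; have := gpdf_poly z.
have h : `|z ^+ 2 - 1| <= 4 * (1 + z ^+ 2 / 4) ^+ 2.
  by rewrite ler_norml; apply/andP; split; nra.
rewrite normrM (gtr0_norm p0) => H.
by apply: (le_trans (ler_wpM2r (ltW p0) h)); lra.
Qed.

Lemma gpdf_poly3 z : `|(3 * z - z ^+ 3) * gpdf z| <= 4.
Proof.
have p0 := gpdf_gt0 z; have := gpdf_poly z.
have h : `|3 * z - z ^+ 3| <= 4 * (1 + z ^+ 2 / 4) ^+ 2.
  have -> : 3 * z - z ^+ 3 = z * (3 - z ^+ 2) by ring.
  rewrite normrM [_ ^+ 2]expr2 mulrCA.
  have h1 := sqr_ge0 (1 - z / 2); have h2 := sqr_ge0 (1 + z / 2).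
  have h3 := sqr_ge0 z.
  by apply: ler_pM => //; rewrite ler_norml; apply/andP; split; lra.
rewrite normrM (gtr0_norm p0) => H.
by apply: (le_trans (ler_wpM2r (ltW p0) h)); lra.
Qed.

(** The probability that y is below x plus a centred Gaussian of variance e
    + t: the solution at time t of the heat equation started from a step at
    y smoothed at scale sqrt e. The smoothing keeps all derivatives bounded
    down to t = 0. The other two functions are its derivatives in x. *)
Definition heat e y t x : R := gcdf ((x - y) / Num.sqrt (e + t)).
Definition heat_x e y t x : R :=
  gpdf ((x - y) / Num.sqrt (e + t)) / Num.sqrt (e + t).
Definition heat_xx e y t x : R :=
  - ((x - y) / Num.sqrt (e + t)) * gpdf ((x - y) / Num.sqrt (e + t)) / (e + t).

Section fixed.
Variables e y : R.
Hypothesis e0 : 0 < e.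

Let s_gt0 t : 0 <= t -> 0 < Num.sqrt (e + t).
Proof. by move=> t0; rewrite sqrtr_gt0 ltr_wpDr. Qed.

Let sqr_s t : 0 <= t -> Num.sqrt (e + t) ^+ 2 = e + t.
Proof. by move=> t0; rewrite sqr_sqrtr// addr_ge0// ltW. Qed.

Let e_le_s t : 0 <= t -> Num.sqrt e <= Num.sqrt (e + t).
Proof. by move=> t0; rewrite ler_sqrt ?lerDl// addr_ge0// ltW. Qed.

Lemma heat_xx_bound t x : 0 <= t -> `|heat_xx e y t x| <= e^-1.
Proof.
move=> t0; rewrite /heat_xx normrM mulNr normrN.
have et : 0 < e + t by rewrite ltr_wpDr.
rewrite -[e^-1]mul1r ler_pM// ?gpdf_poly1// normfV gtr0_norm// lef_pV2 ?posrE//.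
by rewrite lerDl.
Qed.

Lemma heat_taylor_x t x d : 0 <= t ->
  `|heat e y t (x + d) - heat e y t x - heat_x e y t x * d
     - heat_xx e y t x * (d ^+ 2 / 2)| <= 4 / Num.sqrt e ^+ 3 * `|d| ^+ 3.
Proof.
move=> t0; set r := Num.sqrt (e + t).
have r0 : 0 < r by exact: s_gt0.
have rN0 : r != 0 by rewrite gt_eqF.
pose z x := (x - y) / r.
have dz (u : R) : is_derive u 1 z r^-1.
  by apply: is_derive_eq; rewrite /GRing.scale/=; field.
have dgpdf (u : R) : is_derive u 1 (fun x => gpdf (z x)) (- z u * gpdf (z u) * r^-1).
  exact: (@is_derive1_comp _ gpdf z u _ _ (is_derive_gpdf _) (dz u)).
have hxx u : heat_xx e y t u = - z u * gpdf (z u) / r ^+ 2.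
  by rewrite /heat_xx /z /r sqr_s.
rewrite hxx.
apply: (@taylor2 (fun x => gcdf (z x)) (fun x => gpdf (z x) / r)
  (fun x => - z x * gpdf (z x) / r ^+ 2)
  (fun x => (z x ^+ 2 - 1) * gpdf (z x) / r ^+ 3)) => {}x.
- exact: (@is_derive1_comp _ gcdf z x _ _ (is_derive_gcdf _) (dz x)).
- by apply: is_derive_eq; rewrite /GRing.scale/=; field.
- by apply: is_derive_eq; rewrite /GRing.scale/=; field.
- rewrite normrM ler_pM//; first exact: gpdf_poly2.
  have r30 : 0 < r ^+ 3 by rewrite exprn_gt0.
  have q30 : 0 < Num.sqrt e ^+ 3 by rewrite exprn_gt0// sqrtr_gt0.
  rewrite normfV (gtr0_norm r30) lef_pV2 ?posrE//.
  by rewrite ler_pXn2r ?nnegrE ?sqrtr_ge0 ?(ltW r0)//; exact: e_le_s.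
Qed.

Lemma is_derive_heat_t t x : 0 <= t ->
  is_derive t 1 (fun t => heat e y t x) (heat_xx e y t x / 2).
Proof.
move=> t0; have s0 := s_gt0 t0; have sN0 : Num.sqrt (e + t) != 0 by rewrite gt_eqF.
have ds : is_derive (e + t) 1 Num.sqrt (2 * Num.sqrt (e + t))^-1.
  by apply: is_derive1_sqrt; rewrite -sqrtr_gt0.
have dz : is_derive t 1 (fun t => (x - y) / Num.sqrt (e + t))
    (- ((x - y) / Num.sqrt (e + t)) / (2 * (e + t))).
  have dst : is_derive t 1 (fun t => Num.sqrt (e + t)) (2 * Num.sqrt (e + t))^-1.
    by apply: is_derive_eq; rewrite add0r mulr1.
  have dv := @is_deriveV _ (fun t => Num.sqrt (e + t)) t _ 1 sN0 dst.
  apply: is_derive_eq; have := sqr_s t0; rewrite /GRing.scale/=.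
  set r := Num.sqrt _ => <-; by field.
have := @is_derive1_comp _ gcdf _ t _ _ (is_derive_gcdf _) dz.
move=> H; apply: (@is_derive_eq _ _ _ _ _ _ _ _ H).
rewrite /heat_xx; have := sqr_s t0; set r := Num.sqrt _ => <-; by field.
Qed.

Lemma is_derive_heat_tt t x : 0 <= t ->
  is_derive t 1 (fun t => heat_xx e y t x / 2)
    ((3 * ((x - y) / Num.sqrt (e + t)) - ((x - y) / Num.sqrt (e + t)) ^+ 3)
       * gpdf ((x - y) / Num.sqrt (e + t)) / (4 * (e + t) ^+ 2)).
Proof.
move=> t0; have s0 := s_gt0 t0; have sN0 : Num.sqrt (e + t) != 0 by rewrite gt_eqF.
have et0 : e + t != 0 by rewrite gt_eqF// -sqrtr_gt0.
have ds : is_derive (e + t) 1 Num.sqrt (2 * Num.sqrt (e + t))^-1.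
  by apply: is_derive1_sqrt; rewrite -sqrtr_gt0.
pose z t := (x - y) / Num.sqrt (e + t).
have dz : is_derive t 1 z (- z t / (2 * (e + t))).
  have dst : is_derive t 1 (fun t => Num.sqrt (e + t)) (2 * Num.sqrt (e + t))^-1.
    by apply: is_derive_eq; rewrite add0r mulr1.
  have dv := @is_deriveV _ (fun t => Num.sqrt (e + t)) t _ 1 sN0 dst.
  apply: is_derive_eq; have := sqr_s t0; rewrite /z /GRing.scale/=.
  set r := Num.sqrt _ => <-; by field.
have dg : is_derive t 1 (fun t => gpdf (z t)) (- z t * gpdf (z t) * (- z t / (2 * (e + t)))).
  exact: (@is_derive1_comp _ gpdf z t _ _ (is_derive_gpdf _) dz).
have de : is_derive t 1 (fun t => e + t) 1.
  exact: is_derive_addl.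
have dv := @is_deriveV _ (fun t => e + t) t _ 1 et0 de.
rewrite (_ : (fun t0 => _) = fun t => - z t * gpdf (z t) * (e + t)^-1 / 2)//.
apply: is_derive_eq; rewrite -/(z t) /GRing.scale/=.
by field.
Qed.

Lemma heat_taylor_t t t' x : 0 <= t' <= t ->
  `|heat e y t x - heat e y t' x - heat_xx e y t' x / 2 * (t - t')|
     <= e ^- 2 * (t - t') ^+ 2.
Proof.
move=> /andP[t'0 t't]; set D := t - t'.
have D0 : 0 <= D by rewrite subr_ge0.
have E1 (u : R) : 0 <= u -> `|heat_xx e y (t' + u) x / 2 - heat_xx e y t' x / 2| <= e ^- 2 * u.
  move=> u0; rewrite [X in _ <= _ * X](_ : u = `|t' + u - t'|); last first.
    by rewrite addrAC subrr add0r ger0_norm.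
  apply: (@mean_value_norm _ (fun t => heat_xx e y t x / 2)
    (fun t => (3 * ((x - y) / Num.sqrt (e + t)) - ((x - y) / Num.sqrt (e + t)) ^+ 3)
       * gpdf ((x - y) / Num.sqrt (e + t)) / (4 * (e + t) ^+ 2))) => s.
    move=> /andP[t's _]; have s0 : 0 <= s.
      by apply: le_trans t's; rewrite le_min t'0 addr_ge0.
    exact: (is_derive_heat_tt x s0).
  rewrite ge_min => /andP[t's _].
  have t's' : t' <= s by case/orP: t's => //; apply: le_trans; rewrite lerDl.
  have s0 : 0 <= s by exact: le_trans t's'.
  have es : 0 < e + s by rewrite ltr_wpDr.
  rewrite normrM (_ : e ^- 2 = 4 * (4 * e ^+ 2)^-1); last by field; rewrite gt_eqF.
  rewrite ler_pM//; first exact: gpdf_poly3.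
  rewrite normfV gtr0_norm ?mulr_gt0 ?exprn_gt0// lef_pV2 ?posrE ?mulr_gt0 ?exprn_gt0//.
  by rewrite ler_pM2l// ler_pXn2r ?nnegrE ?(ltW e0) ?(ltW es)// lerDl.
pose F (u : R) := heat e y (t' + u) x - heat_xx e y t' x / 2 * u.
have dF (u : R) : 0 <= u -> is_derive u 1 F (heat_xx e y (t' + u) x / 2 - heat_xx e y t' x / 2).
  move=> u0; have dh := @is_derive_heat_t (t' + u) x (addr_ge0 t'0 u0).
  have du : is_derive u 1 (fun u => t' + u) 1.
    exact: is_derive_addl.
  have dc := @is_derive1_comp _ (fun t => heat e y t x) _ u _ _ dh du.
  by apply: is_derive_eq; rewrite /GRing.scale/= !mulr1.
have := @mean_value_norm _ F _ 0 D (e ^- 2 * D).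
rewrite min_l// max_r// => /(_ _ (fun u ub => dF u (proj1 (andP ub)))) H.
have := H _; rewrite /F addr0 mulr0 !subr0 (_ : t' + D = t); last by rewrite addrC subrK.
move=> {}H; rewrite expr2 mulrA addrAC -[X in _ <= _ * X](ger0_norm D0); apply: H.
move=> u /andP[u0 uD]; apply: (le_trans (E1 _ u0)).
by rewrite ler_wpM2l// invr_ge0 exprn_ge0// ltW.
Qed.

End fixed.

(** Expansion in x to second order and in t to first order; the heat
    equation turns the time derivative into half of the second space
    derivative, so that the two second order terms combine into d^2 - (t -
    t'). When d is centred with variance t - t' both correction terms vanish
    on average. *)
Lemma heat_step e : 0 < e -> exists2 C : R, 0 <= C &
  forall y t t' x d : R, 0 <= t' <= t ->
    `|heat_xx e y t' x| <= C /\
    `|heat e y t' (x + d) - heat e y t x - heat_x e y t' x * d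
      - heat_xx e y t' x / 2 * (d ^+ 2 - (t - t'))| <= C * (`|d| ^+ 3 + (t - t') ^+ 2).
Proof.
move=> e0; have se0 : 0 < Num.sqrt e by rewrite sqrtr_gt0.
have A0 : 0 <= 4 / Num.sqrt e ^+ 3 by rewrite divr_ge0// exprn_ge0// ltW.
have B0 : 0 <= e ^- 2 by rewrite invr_ge0 exprn_ge0// ltW.
have D0 : 0 <= e^-1 by rewrite invr_ge0 ltW.
(* errors of the expansions in x and in t, and the bound on the second
   derivative *)
exists (4 / Num.sqrt e ^+ 3 + e ^- 2 + e^-1); first by rewrite !addr_ge0.
move=> y t t' x d /andP[t'0 t't]; split.
  by apply: (le_trans (heat_xx_bound _ e0 _ t'0)); rewrite lerDr addr_ge0.
have h1 := heat_taylor_x y e0 x d t'0.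
have h2 : `|heat e y t x - heat e y t' x - heat_xx e y t' x / 2 * (t - t')|
     <= e ^- 2 * (t - t') ^+ 2 by apply: heat_taylor_t => //; rewrite t'0.
have n0 : 0 <= `|d| ^+ 3 by rewrite exprn_ge0.
have q0 : 0 <= (t - t') ^+ 2 by rewrite sqr_ge0.
set u1 := (X in `|X| <= _) in h1; set u2 := (X in `|X| <= _) in h2.
rewrite (_ : _ - _ - _ - _ = u1 - u2); last by rewrite /u1 /u2; field.
apply: (le_trans (ler_normB _ _)); apply: (le_trans (lerD h1 h2)).
nra.
Qed.

End heat.

(** * Elementary estimates with exp and log *)

Section sums.
Context {R : realType}.
Implicit Types (a b x y : R) (n r : nat).

Lemma expR_le_quad (x : R) : x <= 1 -> expR x <= 1 + x + 2 * x ^+ 2.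
Proof.
move=> x1; have h : 0 < 1 - x / 2 by lra.
have e0 : 1 - x / 2 <= expR (- (x / 2)) by rewrite expR_ge1Dx.
have e1 : expR x * (1 - x / 2) ^+ 2 <= 1.
  apply: (@le_trans _ _ (expR x * expR (- (x / 2)) ^+ 2)).
    rewrite ler_wpM2l ?expR_ge0// ler_pXn2r ?nnegrE ?expR_ge0//; exact: ltW.
  rewrite expr2 -!expRD (_ : x + _ = 0) ?expR0//; by field.
have e2 : 1 <= (1 + x + 2 * x ^+ 2) * (1 - x / 2) ^+ 2.
  have : 0 <= x ^+ 2 * ((1 - x) * (5 - 2 * x)).
    by rewrite mulr_ge0 ?sqr_ge0// mulr_ge0; lra.
  nra.
by rewrite -(@ler_pM2r _ ((1 - x / 2) ^+ 2)) ?exprn_gt0// (le_trans e1).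
Qed.

(** Since the first term on the right averages to zero for a centred
    increment, this is the sub-Gaussian bound on the exponential moment of a
    centred bounded variable. *)
Lemma expR_le_sub (x : R) : expR x <= x + expR (2 * x ^+ 2).
Proof.
have := @expR_ge1Dx R (2 * x ^+ 2).
have [x1|x1] := leP x 1; first by have := expR_le_quad x1; lra.
move=> _; have : expR x <= expR (2 * x ^+ 2) by rewrite ler_expR; nra.
lra.
Qed.

Lemma ln_le_sub1 x : 0 < x -> ln x <= x - 1.
Proof. by move=> x0; have := expR_ge1Dx (ln x); rewrite lnK ?posrE//; lra. Qed.

Lemma ln_nat_ge0 n : 0 <= ln (n%:R : R).
Proof. by case: n => [|n]; [rewrite ln0|rewrite ln_ge0// ler1n]. Qed.

(** Comparison of the harmonic increment with the increment of the
    logarithm. *)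
Lemma ln_succ x : 0 < x -> (x + 1)^-1 <= ln (x + 1) - ln x.
Proof.
move=> x0; have x10 : 0 < x + 1 by lra.
have := @ln_le_sub1 (x / (x + 1)); rewrite divr_gt0// => /(_ isT).
rewrite ln_div ?posrE// => h.
have : x / (x + 1) = 1 - (x + 1)^-1 by field; rewrite gt_eqF.
by lra.
Qed.

Lemma expRN_ln x : 0 < x -> expR (- ln x) = x^-1.
Proof. by move=> x0; rewrite expRN lnK// posrE. Qed.

(** The series of r^-(1+a); the term r = 0 is 1 because ln 0 = 0. The
    induction compares each term with the increment of r^-a. *)
Lemma sum_pow_le a n : 0 < a ->
  \sum_(0 <= r < n) expR (- ((1 + a) * ln (r%:R : R))) <= 2 + a^-1.
Proof.
move=> a0; have ai0 : 0 < a^-1 by rewrite invr_gt0.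
have key m : \sum_(0 <= r < m.+2) expR (- ((1 + a) * ln (r%:R : R))) <=
    2 + (1 - expR (- (a * ln (m.+1%:R)))) / a.
  elim: m => [|m IH].
    by rewrite !big_nat_recr//= big_geq//= ln0// ln1 !mulr0 oppr0 expR0; lra.
  rewrite big_nat_recr//=.
  set E1 := expR _ in IH; set E2 := expR (- (a * _)).
  have x0 : 0 < (m.+1%:R : R) by rewrite ltr0n.
  have := ln_succ x0; rewrite natr1 => hl.
  have y0 : 0 < (m.+2%:R : R) by rewrite ltr0n.
  have h : a * expR (- ((1 + a) * ln (m.+2%:R : R))) <= E1 - E2.
    have -> : E1 = E2 * expR (a * (ln m.+2%:R - ln m.+1%:R)).
      by rewrite /E1 /E2 -expRD; congr expR; ring.
    have -> : expR (- ((1 + a) * ln (m.+2%:R : R))) = E2 * (m.+2%:R)^-1.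
      by rewrite -expRN_ln// /E2 -expRD; congr expR; ring.
    have := expR_ge1Dx (a * (ln m.+2%:R - ln m.+1%:R : R)).
    move/(ler_wpM2l (ltW a0)): hl => hl hh.
    have E20 : 0 <= E2 by exact: expR_ge0.
    move: (ler_wpM2l E20 hl) (ler_wpM2l E20 hh); set z := (m.+2%:R)^-1; lra.
  have : expR (- ((1 + a) * ln (m.+2%:R : R))) <= (E1 - E2) / a.
    by rewrite ler_pdivlMr// mulrC.
  rewrite -/E2 in IH *; move: IH; rewrite !mulrBl; lra.
apply: (@le_trans _ _ (\sum_(0 <= r < n.+2) expR (- ((1 + a) * ln (r%:R : R))))).
  by rewrite !big_nat_recr//= -addrA lerDl addr_ge0 ?expR_ge0.
apply: (le_trans (key n)); rewrite lerD2l ler_piMl// ?ltW// gerBl expR_ge0//.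
Qed.

Lemma sum_geometric_le b n : 0 < b ->
  \sum_(0 <= r < n) expR (- (b * r%:R)) <= (1 - expR (- b))^-1.
Proof.
move=> b0; have q1 : expR (- b) < 1 by rewrite -expR0 ltr_expR oppr_lt0.
have q0 : 0 < 1 - expR (- b) by rewrite subr_gt0.
rewrite -[X in _ <= X]mul1r ler_pdivlMr//.
suff : (\sum_(0 <= r < n) expR (- (b * r%:R))) * (1 - expR (- b)) = 1 - expR (- (b * n%:R)).
  by move=> ->; rewrite gerBl expR_ge0.
elim: n => [|n IH]; first by rewrite big_geq// mul0r mulr0 oppr0 expR0 subrr.
rewrite big_nat_recr//= mulrDl IH.
have -> : expR (- (b * n.+1%:R)) = expR (- (b * n%:R)) * expR (- b).
  by rewrite -expRD -natr1; congr expR; ring.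
ring.
Qed.

(** Each factor is at most exp (- k / r) and the harmonic series diverges. *)
Lemma prod_harmonic (q : nat -> R) (k : R) r0 : 0 < k -> (0 < r0)%N ->
  (forall r, 0 <= q r) ->
  (forall r, (r0 <= r)%N -> q r <= 1 - k / r%:R) ->
  \prod_(r0 <= r < (r0 + n)%N) q r @[n --> \oo] --> (0 : R).
Proof.
move=> k0 r00 q0 qk.
have bound n : \prod_(r0 <= r < (r0 + n)%N) q r <=
    expR (- (k * (ln (r0 + n)%:R - ln r0%:R))).
  elim: n => [|n IH]; first by rewrite addn0 big_geq// subrr mulr0 oppr0 expR0.
  rewrite addnS big_nat_recr ?leq_addr//=.
  have x0 : 0 < ((r0 + n)%:R : R) by rewrite ltr0n addn_gt0 r00.
  apply: (le_trans (ler_pM _ (q0 _) IH (qk _ (leq_addr _ _)))).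
    by apply: prodr_ge0.
  have h : 1 - k / (r0 + n)%:R <= expR (- (k * (ln (r0 + n).+1%:R - ln (r0 + n)%:R))).
    apply: le_trans (expR_ge1Dx _); rewrite lerD2l lerN2 ler_pM2l//.
    have x1 : 0 < ((r0 + n).+1%:R : R) by rewrite ltr0n.
    have := ln_le_sub1 (divr_gt0 x1 x0); rewrite ln_div ?posrE//.
    rewrite -[in X in _ <= X -> _]natr1 mulrDl divff ?gt_eqF// mul1r; lra.
  apply: (le_trans (ler_wpM2l (expR_ge0 _) h)).
  by rewrite -expRD ler_expR; lra.
apply: (@squeeze_cvgr _ _ _ _ (fun=> 0) (fun n => expR (- (k * (ln (r0 + n)%:R - ln r0%:R))))).
- by apply: nearW => n; rewrite bound andbT prodr_ge0.
- exact: cvg_cst.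
- apply/cvgrPdist_lt => e e0; near=> n.
  rewrite sub0r normrN ger0_norm ?expR_ge0//.
  rewrite -[X in _ < X]lnK ?posrE// ltr_expR ltrNl -ltr_pdivrMl// ltrBrDr.
  set A := _ + _.
  apply: (@lt_le_trans _ _ (ln (expR A * expR 1))).
    rewrite lnM ?posrE ?expR_gt0// !expRK; lra.
  rewrite ler_ln ?posrE ?mulr_gt0 ?expR_gt0 ?ltr0n ?addn_gt0 ?r00// natrD.
  apply: (@le_trans _ _ n%:R); last by rewrite lerDr.
  near: n; exact: nbhs_infty_ger.
Unshelve. all: end_near.
Qed.

Lemma ln_nat_ge (B : R) : exists r0, forall r, (r0 <= r)%N -> B <= ln (r%:R : R).
Proof.
have [r0 _ h] := nbhs_infty_ger (expR B).
exists r0 => r rr; have := h r rr; rewrite /= => hr.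
rewrite -[B]expRK ler_ln ?posrE ?expR_gt0//.
exact: lt_le_trans (expR_gt0 B) hr.
Qed.

Lemma ln_nat_ge_half r : (2 <= r)%N -> 1 / 2 <= ln (r%:R : R).
Proof.
move=> r2; apply: (@le_trans _ _ (ln 2)).
  have h2 : (0 : R) < 2^-1 by rewrite invr_gt0.
  have := ln_le_sub1 h2; rewrite lnV ?posrE//; lra.
by rewrite ler_ln ?posrE ?ltr0n ?ler_nat// (leq_trans _ r2).
Qed.

Lemma expR_quad_lower (x : R) : 0 <= x -> (x / 2) ^+ 2 <= expR x.
Proof.
move=> x0; have -> : expR x = expR (x / 2) ^+ 2.
  by rewrite expr2 -expRD; congr expR; field.
rewrite ler_pXn2r ?nnegrE ?expR_ge0//; last by lra.
by apply: le_trans (expR_ge1Dx _); rewrite lerDr.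
Qed.

Lemma geometric_lt (rho eps : R) : 0 < rho < 1 -> 0 < eps ->
  exists r0, forall r, (r0 <= r)%N -> rho ^+ r < eps.
Proof.
move=> /andP[rho0 rho1] e0.
have : `|rho| < 1 by rewrite gtr0_norm.
move=> /cvg_expr /cvgrPdist_lt/(_ _ e0) [r0 _ h].
exists r0 => r rr; have := h r rr.
by rewrite /= sub0r normrN gtr0_norm// exprn_gt0.
Qed.

End sums.

(** * Expectations over binary histories *)

Section tree.
Context {R : realType}.
Implicit Types (m f g H : seq bool -> R) (s u : seq bool).

Definition sgb (b : bool) : R := if b then 1 else -1.

(** One-step average at the node s, whose successors receive the signs +1
    and -1; m s is the conditional mean of the next sign. *)
Definition step m g s : R :=
  (1 + m s) / 2 * g (true :: s) + (1 - m s) / 2 * g (false :: s).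

Definition Ev m j g : seq bool -> R := iter j (step m) g.

(** Histories list the newest sign first, so the first n signs are the last
    n entries. *)
Definition past n s := drop (size s - n) s.

(** Some ancestor of s of length at least n, or s itself, satisfies A. *)
Fixpoint hit n (A : pred (seq bool)) s : bool :=
  A s || (if s is b :: s' then (n <= size s')%N && hit n A s' else false).

Section fixed.
Variable m : seq bool -> R.
Hypothesis m1 : forall s, `|m s| <= 1.

Lemma step_le f g s : (forall b, f (b :: s) <= g (b :: s)) ->
  step m f s <= step m g s.
Proof.
move=> fg; have := m1 s; rewrite ler_norml => /andP[m_ge m_le].
by apply: lerD; apply: ler_wpM2l => //; lra.
Qed.

Lemma step_cst (k : R) s : step m (fun=> k) s = k.
Proof. by rewrite /step; field. Qed.

Lemma EvS j g s : Ev m j.+1 g s = step m (Ev m j g) s.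
Proof. by []. Qed.

Lemma Ev_add i j g s : Ev m (i + j)%N g s = Ev m i (Ev m j g) s.
Proof. by rewrite /Ev iterD. Qed.

Lemma Ev_le j f g s :
  (forall u, size u = j -> f (u ++ s) <= g (u ++ s)) -> Ev m j f s <= Ev m j g s.
Proof.
elim: j s => [|j IH] s fg; first exact: (fg [::]).
apply: step_le => b; apply: IH => u uj.
by rewrite -cat_rcons; apply: fg; rewrite size_rcons uj.
Qed.

Lemma Ev_ext j f g s :
  (forall u, size u = j -> f (u ++ s) = g (u ++ s)) -> Ev m j f s = Ev m j g s.
Proof.
by move=> fg; apply/eqP; rewrite eq_le !Ev_le// => u uj; rewrite fg.
Qed.

Lemma Ev_cst (k : R) j s : Ev m j (fun=> k) s = k.
Proof.
elim: j s => // j IH s; rewrite EvS -[RHS](step_cst k s).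
by rewrite /step !IH.
Qed.

Lemma EvZ (k : R) j f s : Ev m j (fun s => k * f s) s = k * Ev m j f s.
Proof.
elim: j s => // j IH s; rewrite !EvS /step !IH; ring.
Qed.

Lemma EvD j f g s : Ev m j (fun s => f s + g s) s = Ev m j f s + Ev m j g s.
Proof.
elim: j s => // j IH s; rewrite !EvS /step !IH; ring.
Qed.

Lemma Ev_ge0 j f s : (forall s, 0 <= f s) -> 0 <= Ev m j f s.
Proof. by move=> f0; rewrite -(Ev_cst 0 j s); exact: Ev_le. Qed.

Lemma Ev_super n H j s : (forall s, (n <= size s)%N -> step m H s <= H s) ->
  (n <= size s)%N -> Ev m j H s <= H s.
Proof.
move=> superH; elim: j s => // j IH s ns; rewrite EvS.
by apply: le_trans (superH _ ns); apply: step_le => b; apply: IH; rewrite leqW.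
Qed.

(** Both f + H and H - f are supermartingales on the nodes of length at
    least n. This is how the errors of the almost martingales below are
    summed along the tree. *)
Lemma Ev_compensated n f H j s :
  (forall s, (n <= size s)%N -> `|step m f s - f s| <= H s - step m H s) ->
  (forall s, (n <= size s)%N -> 0 <= H s) ->
  (n <= size s)%N -> `|Ev m j f s - f s| <= H s.
Proof.
move=> fH H0 ns; rewrite ler_norml; apply/andP; split.
  have h : Ev m j (fun s => H s + -1 * f s) s <= H s + -1 * f s.
    apply: (Ev_super (n := n)) => // u nu; have := fH _ nu.
    rewrite ler_norml => /andP[h _]; move: h; rewrite /step; nra.
  move: h; rewrite EvD EvZ; have : 0 <= Ev m j H s; last lra.
  rewrite -(Ev_cst 0 j s); apply: Ev_le => u uj.
  by apply: H0; rewrite size_cat (leq_trans ns)// leq_addl.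
have h : Ev m j (fun s => H s + f s) s <= H s + f s.
  apply: (Ev_super (n := n)) => // u nu; have := fH _ nu.
  rewrite ler_norml => /andP[_ h]; move: h; rewrite /step; nra.
move: h; rewrite EvD; have : 0 <= Ev m j H s; last lra.
rewrite -(Ev_cst 0 j s); apply: Ev_le => u uj.
by apply: H0; rewrite size_cat (leq_trans ns)// leq_addl.
Qed.

Lemma past_cat n u s : size s = n -> past n (u ++ s) = s.
Proof. by move=> <-; rewrite /past size_cat addnK drop_size_cat. Qed.

Lemma past_past i n u s : (i <= n)%N -> size s = n -> past i (u ++ s) = past i s.
Proof.
move=> ni sn; rewrite /past size_cat -addnBA ?sn//.
by rewrite drop_cat ltnNge leq_addr /= addKn.
Qed.

(** The process stopped at the value k on the first visit to H >= k is still
    a supermartingale. *)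
Lemma Ev_maximal n H j s (k : R) : 0 < k -> size s = n ->
  (forall s, (n <= size s)%N -> 0 <= H s) ->
  (forall s, (n <= size s)%N -> step m H s <= H s) ->
  Ev m j (fun s => (hit n (fun u => k <= H u) s)%:R) s <= H s / k.
Proof.
move=> k0 sn H0 superH.
pose Y s := if hit n (fun u => k <= H u) s then k else H s.
have superY u : (n <= size u)%N -> step m Y u <= Y u.
  move=> nu; rewrite /Y; case: ifPn => hu.
    rewrite /step /= nu hu !orbT; lra.
  apply: le_trans (superH _ nu); apply: step_le => b /=.
  rewrite nu (negbTE hu) orbF; case: ifPn => //.
have : Ev m j (fun s => k * (hit n (fun u => k <= H u) s)%:R) s <= H s.
  apply: (@le_trans _ _ (Ev m j Y s)).
    apply: Ev_le => u uj; rewrite /Y; case: ifP => _; first by rewrite mulr1.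
    by rewrite mulr0 H0// size_cat sn leq_addl.
  apply: (le_trans (Ev_super _ superY _)); first by rewrite sn.
  rewrite /Y; case: ifP => //; rewrite -sn; case: (s) => [|b s'] /=.
    by rewrite orbF.
  by rewrite ltnn orbF.
by rewrite EvZ ler_pdivlMr// mulrC.
Qed.

(** Iterated conditioning over consecutive blocks: if, given any history up
    to the start of block r, the event of that block has conditional
    probability at most q r, then the probability that all events occur is
    at most the product. *)
Lemma Ev_chain (nn : nat -> nat) (F : nat -> seq bool -> seq bool -> bool)
    (q : nat -> R) r0 k :
  {homo nn : i j / (i <= j)%N} -> (forall r, 0 <= q r) ->
  (forall r s, (r0 <= r)%N -> size s = nn r ->
    Ev m (nn r.+1 - nn r)%N (fun s' => (F r s s')%:R) s <= q r) ->
  Ev m (nn (r0 + k)%N) (fun s => (all (fun r =>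
    F r (past (nn r) s) (past (nn r.+1) s)) (iota r0 k))%:R) [::]
  <= \prod_(r0 <= r < (r0 + k)%N) q r.
Proof.
move=> nnh q0 Fq; elim: k => [|k IH].
  by rewrite addn0 big_geq// Ev_cst.
rewrite (addnS r0 k) big_nat_recr ?leq_addr//.
rewrite -(subnKC (nnh (r0 + k)%N (r0 + k).+1 (leqnSn _))) Ev_add.
apply: (@le_trans _ _ (Ev m (nn (r0 + k)%N) (fun s => q (r0 + k)%N * (all (fun r =>
    F r (past (nn r) s) (past (nn r.+1) s)) (iota r0 k))%:R) [::])).
  apply: Ev_le => s; rewrite cats0 => sn.
  set A := all _ (iota r0 k).
  apply: (@le_trans _ _ (Ev m (nn (r0 + k).+1 - nn (r0 + k))%N
      (fun s' => A%:R * (F (r0 + k)%N s s')%:R) s)).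
    apply: Ev_le => u un; rewrite -[k.+1]addn1 iotaD all_cat /= andbT.
    rewrite past_cat// (_ : past _ _ = u ++ s); last first.
      rewrite /past (_ : _ - _ = 0)%N ?drop0//.
      by rewrite size_cat sn un subnK ?subnn// nnh.
    rewrite -natrM mulnb ler_nat (_ : all _ _ = A)//; apply: eq_in_all => i.
    rewrite mem_iota => /andP[_ ik].
    by rewrite !(past_past _ _ sn)// nnh// ltnW.
  rewrite EvZ mulrC ler_wpM2r//.
  exact: Fq (leq_addr _ _) sn.
by rewrite EvZ mulrC ler_wpM2r.
Qed.

End fixed.
End tree.

(** * Martingales on the tree of histories with almost deterministic variance *)

Ltac nonneg := repeat match goal with
  | |- is_true (0 <= _) => first [ assumption | by apply: ltW; assumption
    | exact: ler0n | exact: ler01 | exact: sqr_ge0 | exact: expR_ge0 | exact: normr_ge0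
    | exact: sqrtr_ge0 | apply: exprn_ge0 | apply: mulr_ge0 | apply: addr_ge0
    | rewrite invr_ge0 ]
  end.

Section walk.
Context {R : realType}.
Implicit Types (s u : seq bool).

(** The power V_n ^ del. *)
Definition rate (V : nat -> R) (del : R) (n : nat) : R := expR (del * ln (V n)).

(** A martingale M on the tree driven by signs, with weights c, whose
    predictable variance (1 - m^2) c^2 is close to the deterministic (1 -
    mu^2) c^2. The sequence V is the remaining deterministic variance. The
    last three conditions bound a weight by the variance it contributes, say
    that no single later weight carries a substantial share of the remaining
    variance, and compare m with mu. *)
Record walk_model (m M : seq bool -> R) (mu c V : nat -> R) (C del : R)
    (N : nat) : Prop := WalkModel {
  wm_m1 : forall s, `|m s| <= 1;
  wm_mu1 : forall n, `|mu n| <= 1;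
  wm_M0 : M [::] = 0;
  wm_MS : forall b s, M (b :: s) = M s + (sgb b - m s) * c (size s);
  wm_V0 : forall n, 0 < V n;
  wm_VS : forall n, V n - V n.+1 = (1 - mu n ^+ 2) * c n ^+ 2;
  wm_Vcvg : V n @[n --> \oo] --> (0 : R);
  wm_C1 : 1 <= C;
  wm_del0 : 0 < del;
  wm_VN : V N <= 1;
  wm_c2 : forall n, (N <= n)%N -> c n ^+ 2 <= C * (V n - V n.+1);
  wm_cw : forall n k, (N <= n <= k)%N -> c k ^+ 2 <= C * V n * rate V del n ^+ 2;
  wm_mw : forall n s, (N <= n <= size s)%N ->
    `|m s - mu (size s)| <= C * `|M s| * rate V del n }.

Section fixed.
Variables (m M : seq bool -> R) (mu c V : nat -> R) (C del : R) (N : nat).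
Hypothesis model : walk_model m M mu c V C del N.

Let m1 := wm_m1 model.
Let C1 := wm_C1 model.
Let C0 : 0 < C. Proof. exact: lt_le_trans C1. Qed.
Let V0 := wm_V0 model.
Let w := rate V del.

Lemma walk_V_succ n : V n.+1 <= V n.
Proof.
rewrite -subr_ge0 (wm_VS model) mulr_ge0 ?sqr_ge0// subr_ge0.
have := wm_mu1 model n; rewrite ler_norml => /andP[? ?]; nra.
Qed.

Lemma walk_V_le : {homo V : i j / (i <= j)%N >-> j <= i}.
Proof. by apply/nonincreasing_seqP => n; exact: walk_V_succ. Qed.

Lemma rate_gt0 n : 0 < w n. Proof. exact: expR_gt0. Qed.

Lemma rate_le1 n : (N <= n)%N -> w n <= 1.
Proof.
move=> Nn; rewrite /w /rate -expR0 ler_expR mulr_ge0_le0 ?(ltW (wm_del0 model))//.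
by rewrite ln_le0// (le_trans (walk_V_le Nn) (wm_VN model)).
Qed.

Lemma step_sqr_le s : (N <= size s)%N ->
  step m (fun s => M s ^+ 2 + C * V (size s)) s <= M s ^+ 2 + C * V (size s).
Proof.
move=> Ns; have := wm_c2 model Ns; have := m1 s.
rewrite ler_norml => /andP[h1 h2] hc.
rewrite /step /= !(wm_MS model) /sgb.
set x := M s in hc *; set mm := m s in h1 h2 *; set cc := c _ in hc *.
have : (1 - mm ^+ 2) * cc ^+ 2 <= cc ^+ 2.
  rewrite ler_piMl ?sqr_ge0// gerBl sqr_ge0//.
nra.
Qed.

Lemma Ev_sq j s : (N <= size s)%N ->
  Ev m j (fun s => M s ^+ 2) s <= M s ^+ 2 + C * V (size s).
Proof.
move=> Ns; apply: le_trans (Ev_super m1 j step_sqr_le Ns).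
by apply: Ev_le => // u _; rewrite lerDl mulr_ge0// ltW.
Qed.

(** Before N nothing is known about the weights, but there are only finitely
    many histories of length N. *)
Lemma Ev_sq_root : exists2 D : R, 0 <= D & forall n, (N <= n)%N ->
  Ev m n (fun s => M s ^+ 2) [::] <= D.
Proof.
exists (Ev m N (fun s => M s ^+ 2 + C * V (size s)) [::]).
  by apply: Ev_ge0 => // s; rewrite addr_ge0 ?sqr_ge0// mulr_ge0// ltW.
move=> n Nn; rewrite -(subnKC Nn) Ev_add; apply: Ev_le => // u uN.
by rewrite cats0; apply: Ev_sq; rewrite uN.
Qed.

Lemma hit_cat n (A : pred (seq bool)) u v : (n <= size u)%N -> A u ->
  hit n A (v ++ u).
Proof.
move=> nu Au; elim: v => [|b v IH]; first by case: u {nu} Au => [|b u] /= ->.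
by rewrite /= IH size_cat (leq_trans nu) ?leq_addl// orbT.
Qed.

Lemma hit_sub n (A B : pred (seq bool)) s : (n <= size s)%N ->
  (forall u v, s = v ++ u -> (n <= size u)%N -> A u -> B u) ->
  hit n A s -> hit n B s.
Proof.
elim: s => [|b s IH] ns AB /=.
  by rewrite !orbF; apply: (AB [::] [::]).
case/orP => [As|/andP[ns' hs]]; first by rewrite (AB (b :: s) [::]).
by rewrite ns' IH ?orbT// => u v sE; apply: (AB _ (b :: v)); rewrite sE.
Qed.

(** The exponential of lam (M - M s), multiplied by exp (- 8 lam^2 C (V_n -
    V_k)), is a supermartingale by the sub-Gaussian bound for one step; the
    maximal inequality applies to it. *)
Lemma walk_maximal (sg x lam : R) s j : sg ^+ 2 = 1 -> 0 <= lam ->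
  (N <= size s)%N ->
  Ev m j (fun s' => (hit (size s) (fun u => x < sg * (M u - M s)) s')%:R) s
  <= expR (- (lam * x) + 8 * lam ^+ 2 * C * (V (size s) - V (size s + j)%N)).
Proof.
move=> sg2 lam0 Ns; set n := size s.
(* 8 = 2 * 4: the factor 2 of the sub-Gaussian bound and (sgb b - m)^2 <= 4 *)
pose H u := expR (lam * (sg * (M u - M s)) - 8 * lam ^+ 2 * C * (V n - V (size u))).
set k := 8 * lam ^+ 2 * C * _.
have superH u : (n <= size u)%N -> step m H u <= H u.
  move=> nu; have Nu : (N <= size u)%N by rewrite (leq_trans Ns).
  have hc := wm_c2 model Nu; have := m1 u; rewrite ler_norml => /andP[h1 h2].
  pose g b := lam * (sg * ((sgb b - m u) * c (size u))).
  pose B := 8 * lam ^+ 2 * C * (V (size u) - V (size u).+1).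
  have HE b : H (b :: u) = H u * expR (- B) * expR (g b).
    rewrite /H /= (wm_MS model) -!expRD /B /g; congr expR; ring.
  have gb b : expR (g b) <= g b + expR B.
    apply: (le_trans (expR_le_sub _)); rewrite lerD2l ler_expR /g /B.
    rewrite !exprMn sg2 mul1r.
    have hb : (sgb b - m u) ^+ 2 <= 4 by case: b; rewrite /sgb; nra.
    have c20 : 0 <= c (size u) ^+ 2 by exact: sqr_ge0.
    have l20 : 0 <= lam ^+ 2 by exact: sqr_ge0.
    apply: (@le_trans _ _ (2 * (lam ^+ 2 * (4 * c (size u) ^+ 2)))).
      by rewrite ler_pM2l// ler_wpM2l// ler_wpM2r.
    rewrite (_ : 8 * lam ^+ 2 * C * _ = 2 * (lam ^+ 2 * (4 * (C * (V (size u) - V (size u).+1))))).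
      by rewrite ler_pM2l// ler_wpM2l// ler_pM2l.
    ring.
  rewrite /step !HE.
  have Hu : 0 <= H u * expR (- B) by rewrite mulr_ge0// expR_ge0.
  have : (1 + m u) / 2 * expR (g true) + (1 - m u) / 2 * expR (g false) <= expR B.
    have e1 : (1 + m u) / 2 * expR (g true) <= (1 + m u) / 2 * (g true + expR B).
      by rewrite ler_wpM2l//; lra.
    have e2 : (1 - m u) / 2 * expR (g false) <= (1 - m u) / 2 * (g false + expR B).
      by rewrite ler_wpM2l//; lra.
    apply: (le_trans (lerD e1 e2)).
    by rewrite le_eqVlt; apply/orP; left; apply/eqP; rewrite /g /sgb; field.
  move=> /(ler_wpM2l Hu); rewrite -[H u * expR (- B) * expR B]mulrA -[expR (- B) * expR B]expRD addNr expR0 mulr1.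
  by apply: le_trans; rewrite le_eqVlt; apply/orP; left; apply/eqP; ring.
have k0 : 0 < expR (lam * x - k) by exact: expR_gt0.
have Hs : H s = 1 by rewrite /H !subrr !mulr0 subr0 expR0.
have := @Ev_maximal _ m m1 n H j s _ k0 erefl (fun s _ => expR_ge0 _) superH.
rewrite Hs div1r -expRN opprB [k - _]addrC; apply: le_trans.
apply: Ev_le => // u uj; rewrite ler_nat.
case hA : (hit _ _ _) => //; rewrite (hit_sub _ _ hA)// ?size_cat ?leq_addl// => v v' uE nv xv.
have vj : (size v <= size (u ++ s))%N by rewrite uE size_cat leq_addl.
move: vj; rewrite size_cat => vj; rewrite ler_expR; apply: lerB.
  by rewrite ler_wpM2l// ltW.
rewrite /k ler_wpM2l ?mulr_ge0 ?sqr_ge0 ?(ltW C0)//.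
by rewrite lerD2l lerN2 walk_V_le// -uj addnC.
Qed.

(** Average of the two one-step expansions: the first order terms cancel
    because the increment is centred, and what remains is half the second
    derivative times the error in the variance. *)
Lemma heat_step_sum (x y p F0 F1 F2 hx hxx D eps : R) :
  `|p| <= 1 -> 0 <= eps ->
  `|F1 - F0 - hx * x - hxx / 2 * (x ^+ 2 - D)| <= eps ->
  `|F2 - F0 - hx * y - hxx / 2 * (y ^+ 2 - D)| <= eps ->
  (1 + p) / 2 * x + (1 - p) / 2 * y = 0 ->
  `|(1 + p) / 2 * F1 + (1 - p) / 2 * F2 - F0|
  <= `|hxx| / 2 * `|(1 + p) / 2 * x ^+ 2 + (1 - p) / 2 * y ^+ 2 - D| + eps.
Proof.
rewrite ler_norml => /andP[p1 p2] eps0 h1 h2 h0.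
set A := F1 - _ - _ - _ in h1; set B := F2 - _ - _ - _ in h2.
rewrite (_ : _ - F0 = hx * ((1 + p) / 2 * x + (1 - p) / 2 * y) +
  hxx / 2 * ((1 + p) / 2 * x ^+ 2 + (1 - p) / 2 * y ^+ 2 - D) +
  ((1 + p) / 2 * A + (1 - p) / 2 * B)); last by rewrite /A /B; field.
rewrite h0 mulr0 add0r; apply: (le_trans (ler_normD _ _)); apply: lerD.
  by rewrite !normrM normfV (@ger0_norm _ 2).
apply: (le_trans (ler_normD _ _)); rewrite !normrM.
rewrite (_ : eps = (1 + p) / 2 * eps + (1 - p) / 2 * eps); last by field.
have q1 : 0 <= (1 + p) / 2 by lra.
have q2 : 0 <= (1 - p) / 2 by lra.
rewrite -!normrM !(normrM (_ / _)) (ger0_norm q1) (ger0_norm q2).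
by apply: lerD; apply: ler_wpM2l.
Qed.

(** The quantitative central limit theorem, conditionally on the history s
    and uniformly in the horizon j. The function f interpolates between the
    smoothed indicator at the horizon and the Gaussian value at s. Its
    one-step errors come from the third moment of the increment and from the
    difference between the conditional variance and its deterministic
    counterpart; both are at most const (1 + M^2) V_n^del times the fraction
    of variance spent in the step. The factor 1 + M^2 is random, which is
    why the compensating supermartingale contains M^2. *)
Lemma walk_clt (e : R) : 0 < e -> exists2 K : R, 0 <= K &
  forall (sg y : R) s j, sg ^+ 2 = 1 -> (N <= size s)%N ->
  `|Ev m j (fun s' => heat e y (V (size s') / V (size s))
       (sg * (M s' - M s) / Num.sqrt (V (size s)))) s
    - gcdf (- y / Num.sqrt (e + 1))| <= K * (1 + M s ^+ 2) * w (size s).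
Proof.
move=> e0; have [K K0 hK] := heat_step e0.
have CC : 0 <= C ^+ 2 * (1 + C) by rewrite mulr_ge0 ?sqr_ge0// addr_ge0// ltW.
exists (10 * K * (C ^+ 2 * (1 + C))); first nonneg.
move=> sg y s j sg2 Ns; set n := size s.
set f := fun s' => heat _ _ _ _.
have Vn0 := V0 n; have sV0 : 0 < Num.sqrt (V n) by rewrite sqrtr_gt0.
have sVV : Num.sqrt (V n) ^+ 2 = V n by rewrite sqr_sqrtr// ltW.
have w0 := rate_gt0 n; have w1 : w n <= 1 by exact: rate_le1.
have -> : gcdf (- y / Num.sqrt (e + 1)) = f s.
  by rewrite /f /heat subrr mulr0 mul0r sub0r divff// gt_eqF.
(* 10 collects 1 from the variance error, 8 from the cubed increment and 1
   from the squared time step *)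
pose B := 10 * K * C ^+ 2 * w n / V n.
have B0 : 0 <= B by rewrite /B; nonneg.
pose F u := 1 + (M u ^+ 2 + C * V (size u)).
have F1 u : 1 + M u ^+ 2 <= F u.
  by rewrite /F addrA lerDl mulr_ge0 ?ltW.
have F0 u : 0 <= F u by rewrite (le_trans _ (F1 u))// addr_ge0// sqr_ge0.
have main u : (n <= size u)%N ->
    `|step m f u - f u| <= B * (1 + M u ^+ 2) * (V (size u) - V (size u).+1).
  move=> nu; have Nu : (N <= size u)%N by rewrite (leq_trans Ns).
  set k := size u in nu Nu *.
  have hmu : `|m u - mu k| <= C * `|M u| * w n by apply: (wm_mw model); rewrite Ns.
  have hcw : c k ^+ 2 <= C * V n * w n ^+ 2 by apply: (wm_cw model); rewrite Ns.
  have hc := wm_c2 model Nu.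
  have hVS := wm_VS model k.
  pose a := c k ^+ 2 / V n.
  have a0 : 0 <= a by rewrite divr_ge0 ?sqr_ge0 ?ltW.
  have aw : a <= C * w n ^+ 2 by rewrite ler_pdivrMr// mulrAC.
  have mu2 : mu k ^+ 2 <= 1.
    have := wm_mu1 model k; rewrite ler_norml => /andP[? ?]; nra.
  have mu20 : 0 <= mu k ^+ 2 by exact: sqr_ge0.
  pose t := V k / V n; pose t' := V k.+1 / V n.
  have tt' : t - t' = (1 - mu k ^+ 2) * a by rewrite /t /t' -mulrBl hVS /a; ring.
  have tt'0 : 0 <= t - t' by rewrite tt' mulr_ge0// subr_ge0.
  have tt'a : t - t' <= a by rewrite tt' ler_piMl// gerBl.
  have t'0 : 0 <= t' <= t.
    by apply/andP; split; [rewrite divr_ge0 ?ltW|rewrite -subr_ge0].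
  pose d b := sg * ((sgb b - m u) * c k) / Num.sqrt (V n).
  pose x := sg * (M u - M s) / Num.sqrt (V n).
  have fb b : f (b :: u) = heat e y t' (x + d b).
    rewrite /f /= (wm_MS model) -/k; congr (heat _ _ _ _).
    by rewrite /x /d -mulrDl -mulrDr; congr (_ * _ / _); ring.
  have d2 b : d b ^+ 2 = (sgb b - m u) ^+ 2 * a.
    by rewrite /d /a !exprMn exprVn sVV sg2 mul1r mulrA.
  have m1u := m1 u; have := m1u; rewrite ler_norml => /andP[h1 h2].
  have hb b : (sgb b - m u) ^+ 2 <= 4 by case: b; rewrite /sgb; nra.
  have d2a b : d b ^+ 2 <= 4 * a by rewrite d2 ler_wpM2r.
  have d1w b : `|d b| <= 2 * C * w n.
    rewrite -(@ler_pXn2r _ 2)// ?nnegrE ?mulr_ge0 ?(ltW C0) ?(ltW w0)//.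
    rewrite -normrX ger0_norm ?sqr_ge0// (le_trans (d2a b))//.
    rewrite !exprMn (_ : 2 ^+ 2 = 4 :> R); last by rewrite -natrX.
    rewrite -mulrA ler_pM2l// (le_trans aw)// ler_wpM2r ?sqr_ge0// expr2.
    by rewrite ler_peMl// ltW.
  pose eps := K * (8 * C * w n * a + C * w n * a).
  have Cw0 : 0 <= C * w n by rewrite mulr_ge0 ?ltW.
  have eps0 : 0 <= eps by rewrite /eps; nonneg.
  have hd b : K * (`|d b| ^+ 3 + (t - t') ^+ 2) <= eps.
    rewrite ler_wpM2l//; apply: lerD.
      rewrite exprS -normrX (ger0_norm (sqr_ge0 _)) (_ : 8 * C * w n * a = 2 * C * w n * (4 * a)); last ring.
      by apply: ler_pM => //; rewrite sqr_ge0.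
    rewrite expr2; apply: ler_pM => //.
    apply: (le_trans tt'a); apply: (le_trans aw); rewrite expr2 mulrA.
    by rewrite ler_piMr.
  have [hxxK _] := hK y t t' x 0 t'0.
  have st b : `|heat e y t' (x + d b) - heat e y t x - heat_x e y t' x * d b -
      heat_xx e y t' x / 2 * (d b ^+ 2 - (t - t'))| <= eps.
    by apply: le_trans (hd b); have [] := hK y t t' x (d b) t'0.
  have fu : f u = heat e y t x by [].
  rewrite /step !fb fu.
  apply: (le_trans (heat_step_sum m1u eps0 (st true) (st false) _)).
    by rewrite /d /sgb; field; rewrite gt_eqF.
  have -> : (1 + m u) / 2 * d true ^+ 2 + (1 - m u) / 2 * d false ^+ 2 - (t - t')
      = (mu k ^+ 2 - m u ^+ 2) * a.
    by rewrite !d2 tt' /sgb; field.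
  have hm : `|mu k ^+ 2 - m u ^+ 2| <= C * (1 + M u ^+ 2) * w n.
    rewrite subr_sqr normrM.
    apply: (@le_trans _ _ (C * `|M u| * w n * 2)).
      rewrite ler_pM// 1?distrC//.
      by apply: (le_trans (ler_normD _ _)); have := wm_mu1 model k; lra.
    have : 2 * `|M u| <= 1 + M u ^+ 2.
      have := sqr_ge0 (1 - `|M u|); rewrite sqrrB expr1n -normrX.
      by rewrite (ger0_norm (sqr_ge0 _)); lra.
    by move=> /(ler_wpM2l Cw0); lra.
  rewrite [`|(_ - _) * a|]normrM (ger0_norm a0).
  have X1 : `|heat_xx e y t' x| / 2 * (`|mu k ^+ 2 - m u ^+ 2| * a)
      <= K * (C * (1 + M u ^+ 2) * w n * a).
    apply: ler_pM => //; last by rewrite ler_wpM2r.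
      by rewrite mulr_ge0.
    by rewrite ler_pdivrMr// (le_trans hxxK)// ler_peMr// ler1n.
  apply: (le_trans (lerD X1 (lexx eps))).
  have Mu0 := sqr_ge0 (M u).
  apply: (@le_trans _ _ (10 * (K * (C * (1 + M u ^+ 2) * w n * a)))).
    have P0 : 0 <= K * (C * w n * a * M u ^+ 2) by nonneg.
    rewrite /eps; nra.
  have ha : a <= C * (V k - V k.+1) / V n by rewrite ler_wpM2r// invr_ge0 ltW.
  have Z : 0 <= 10 * K * (C * (1 + M u ^+ 2) * w n).
    by nonneg.
  move/(ler_wpM2l Z): ha => ha; apply: (le_trans _ (le_trans ha _)).
    by rewrite le_eqVlt; apply/orP; left; apply/eqP; ring.
  by rewrite le_eqVlt /B; apply/orP; left; apply/eqP; ring.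
have comp u : (n <= size u)%N ->
    `|step m f u - f u| <= B * (F u * V (size u))
       - step m (fun u => B * (F u * V (size u))) u.
  move=> nu; have Nu : (N <= size u)%N by rewrite (leq_trans Ns).
  apply: (le_trans (main u nu)).
  have hs := step_sqr_le Nu.
  have : step m (fun u => B * (F u * V (size u))) u <= B * (F u * V (size u).+1).
    have BV0 : 0 <= B * V (size u).+1 by rewrite mulr_ge0// ltW.
    move: hs; rewrite /step /F /= => /(ler_wpM2l BV0) hs.
    by move: hs; lra.
  have d0 : 0 <= V (size u) - V (size u).+1 by rewrite subr_ge0 walk_V_succ.
  have := ler_wpM2r d0 (ler_wpM2l B0 (F1 u)).
  by lra.
have HH u : (n <= size u)%N -> 0 <= B * (F u * V (size u)).
  by move=> _; have := V0 (size u); have := F0 u; move=> ? ?; nonneg.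
apply: (le_trans (Ev_compensated m1 j comp HH (leqnn _))).
rewrite -/n /B.
have -> : 10 * K * C ^+ 2 * w n / V n * (F s * V n) = 10 * K * C ^+ 2 * w n * F s.
  by field; rewrite gt_eqF.
have hF : F s <= (1 + C) * (1 + M s ^+ 2).
  have : V n <= 1 by exact: le_trans (walk_V_le Ns) (wm_VN model).
  move=> /(ler_wpM2l (ltW C0)); rewrite mulr1 /F -/n.
  have := mulr_ge0 (ltW C0) (sqr_ge0 (M s)); lra.
have Z : 0 <= 10 * K * C ^+ 2 * w n by nonneg.
move/(ler_wpM2l Z): hF => hF; apply: (le_trans hF).
by rewrite le_eqVlt; apply/orP; left; apply/eqP; ring.
Qed.

End fixed.
End walk.

(** * Tail bounds for the martingale increments *)

Section tails.
Context {R : realType}.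
Variables (m M : seq bool -> R) (mu c V : nat -> R) (C del : R) (N : nat).
Hypothesis model : walk_model m M mu c V C del N.
Implicit Types (s u : seq bool).

Let m1 := wm_m1 model.
Let V0 := wm_V0 model.
Let w := rate V del.

Lemma walk_V_lt (eps : R) : 0 < eps -> exists n0, forall n, (n0 <= n)%N -> V n < eps.
Proof.
move=> e0; have /cvgrPdist_lt/(_ _ e0) [n0 _ h] := wm_Vcvg model.
exists n0 => n n0n; have := h n n0n.
by rewrite /= sub0r normrN gtr0_norm.
Qed.

Lemma rate_lt (eps : R) : 0 < eps -> exists n0, forall n, (n0 <= n)%N -> w n < eps.
Proof.
move=> e0; have [n0 h] := @walk_V_lt (expR (ln eps / del)) (expR_gt0 _).
exists n0 => n /h; rewrite -ltr_ln ?posrE ?expR_gt0// expRK.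
rewrite ltr_pdivlMr ?(wm_del0 model)// => hn.
by rewrite /w /rate mulrC -[X in _ < X]lnK ?posrE// ltr_expR.
Qed.

(** Unconditional form, for any level curve that dominates the indicator of
    x > y by the smoothed step. *)
Lemma walk_clt_root (e : R) : 0 < e -> exists2 K : R, 0 <= K &
  forall (sg y y' A B : R) n k, sg ^+ 2 = 1 -> (N <= n)%N -> 0 <= A ->
  (forall x, (y < x)%R%:R <= A * heat e y' (V (n + k)%N / V n) x + B) ->
  Ev m (n + k)%N
    (fun s => (y * Num.sqrt (V n) < sg * (M s - M (past n s)))%R%:R) [::]
  <= A * (gcdf (- y' / Num.sqrt (e + 1)) + K * w n) + B.
Proof.
move=> e0; have [K K0 hK] := walk_clt model e0.
have [D D0 hD] := Ev_sq_root model.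
exists (K * (1 + D)); first by nonneg.
move=> sg y y' A B n k sg2 Nn A0 hAB.
have sV0 : 0 < Num.sqrt (V n) by rewrite sqrtr_gt0.
have w0 : 0 < w n by exact: rate_gt0.
rewrite Ev_add.
pose G := gcdf (- y' / Num.sqrt (e + 1)).
apply: (@le_trans _ _ (Ev m n
    (fun s => (A * (G + K * w n) + B) + (A * (K * w n)) * M s ^+ 2) [::])).
  apply: Ev_le => // s; rewrite cats0 => sn.
  apply: (@le_trans _ _ (Ev m k (fun s' => A * heat e y' (V (size s') / V (size s))
      (sg * (M s' - M s) / Num.sqrt (V (size s))) + B) s)).
    apply: Ev_le => // u uk; rewrite past_cat// size_cat uk sn addnC.
    by rewrite -ltr_pdivlMr//; apply: hAB.
  rewrite (EvD m k) EvZ Ev_cst.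
  have Ns : (N <= size s)%N by rewrite sn.
  have := hK sg y' s k sg2 Ns; rewrite ler_norml => /andP[_].
  rewrite lerBlDr => h; rewrite sn in h *.
  by have := ler_wpM2l A0 h; rewrite -/G /w; lra.
rewrite (EvD m n) Ev_cst EvZ.
have AKw : 0 <= A * (K * w n) by nonneg.
by have := ler_wpM2l AKw (hD n Nn); rewrite -/G; lra.
Qed.

(** At the price of a constant factor, the indicator of x > y is dominated
    by the smoothed step, which is at least gcdf 0 there. The variance 1 + e
    can be taken as close to 1 as desired, which suffices for the iterated
    logarithm. *)
Lemma walk_tail (e : R) : 0 < e -> exists2 K : R, 0 <= K &
  forall (sg y : R) n k, sg ^+ 2 = 1 -> (N <= n)%N ->
  Ev m (n + k)%N
    (fun s => (y * Num.sqrt (V n) < sg * (M s - M (past n s)))%R%:R) [::]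
  <= K * (gcdf (- y / Num.sqrt (e + 1)) + w n).
Proof.
move=> e0; have [K K0 hK] := walk_clt_root e0.
have g0 : 0 < gcdf (0 : R) by exact: gcdf_gt0.
have gi0 : 0 < (gcdf (0 : R))^-1 by rewrite invr_gt0.
exists ((gcdf 0)^-1 * (1 + K)); first by nonneg.
move=> sg y n k sg2 Nn.
apply: (le_trans (hK sg y y (gcdf 0)^-1 0 n k sg2 Nn (ltW gi0) _)).
  move=> x; rewrite addr0; case: ltP => yx /=; last first.
    by rewrite mulr_ge0 ?gcdf_ge0// ltW.
  rewrite -ler_pdivrMl// invrK mulr1; apply: gcdf_le.
  by rewrite divr_ge0 ?sqrtr_ge0// subr_ge0 ltW.
rewrite addr0 -mulrA ler_pM2l//.
have w0 : 0 <= w n by apply: ltW; exact: rate_gt0.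
by have := mulr_ge0 K0 (gcdf_ge0 (- y / Num.sqrt (e + 1))); lra.
Qed.

(** Here the constant must be 1: the level is shifted by d, so that the
    smoothed step is within eta / 4 of 1 above y once e and the remaining
    variance at the horizon are small compared with d^2. *)
Lemma walk_cdf_upper (sg y eta : R) : sg ^+ 2 = 1 -> 0 < eta ->
  exists n0, forall n, (n0 <= n)%N -> exists k0, forall k, (k0 <= k)%N ->
  Ev m (n + k)%N
    (fun s => (y * Num.sqrt (V n) < sg * (M s - M (past n s)))%R%:R) [::]
  <= gcdf (- y) + eta.
Proof.
move=> sg2 eta0; pose d := eta / 8.
have d0 : 0 < d by rewrite /d; lra.
have eta4 : 0 < eta / 4 by lra.
have [z0 z01 hz0] := gcdf_small eta4.
have z0sq : 0 < 2 * z0 ^+ 2 by rewrite mulr_gt0// exprn_gt0//; lra.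
(* the first bound makes the factor sqrt (e + 1) harmless at the level y - d,
   the second makes the smoothed step close to 1 above y *)
pose e := Num.min (d / (1 + `|y - d|)) (d ^+ 2 / (2 * z0 ^+ 2)).
have p1 : 0 < 1 + `|y - d| by apply: (lt_le_trans ltr01); rewrite lerDl.
have e0 : 0 < e by rewrite /e lt_min !divr_gt0 ?exprn_gt0.
have [K K0 hK] := walk_clt_root e0.
have K10 : 0 < 1 + K by lra.
have [n1 hn1] := rate_lt (divr_gt0 eta4 K10).
exists (maxn n1 N) => n; rewrite geq_max => /andP[/hn1 wn Nn].
have [k0 hk0] := walk_V_lt (mulr_gt0 e0 (V0 n)).
exists k0 => k k0k.
have te : V (n + k)%N / V n <= e.
  by rewrite ler_pdivrMr// ltW// hk0// (leq_trans k0k)// leq_addl.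
have t0 : 0 < V (n + k)%N / V n by rewrite divr_gt0.
apply: (le_trans (hK sg y (y - d) 1 (eta / 4) n k sg2 Nn ler01 _)).
  move=> x; rewrite mul1r; case: ltP => yx /=; last first.
    by rewrite addr_ge0 ?gcdf_ge0// ltW.
  set t := V _ / _ in te t0 *.
  have r0 : 0 < Num.sqrt (e + t) by rewrite sqrtr_gt0 addr_gt0.
  have hz : z0 <= d / Num.sqrt (e + t).
    rewrite ler_pdivlMr// -(@ler_pXn2r _ 2)// ?nnegrE; [|nonneg; lra|exact: ltW].
    rewrite exprMn sqr_sqrtr; last by rewrite addr_ge0 ?ltW.
    have : e <= d ^+ 2 / (2 * z0 ^+ 2) by rewrite /e ge_min lexx orbT.
    rewrite ler_pdivlMr// => he.
    have := ler_wpM2l (sqr_ge0 z0) te; lra.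
  have := hz0 _ hz; rewrite gcdfN => h.
  have : gcdf (d / Num.sqrt (e + t)) <= heat e (y - d) t x.
    apply: gcdf_le; rewrite ler_pM2r ?invr_gt0//; lra.
  lra.
rewrite mul1r.
have s1 : 1 <= Num.sqrt (e + 1) <= 1 + e.
  apply/andP; split; first by rewrite -[X in X <= _]sqrtr1 ler_sqrt; lra.
  rewrite -(@ler_pXn2r _ 2)// ?nnegrE; [|nonneg|lra].
  by rewrite sqr_sqrtr; nra.
have Kw : K * w n <= eta / 4.
  move: wn; rewrite ltr_pdivlMr// => wn.
  have : 0 < w n by exact: rate_gt0.
  lra.
have hG : - (y - d) / Num.sqrt (e + 1) <= - y + 2 * d.
  move/andP: s1 => [s1 s2]; have sp : 0 < Num.sqrt (e + 1) by lra.
  rewrite ler_pdivrMr//.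
  have : e <= d / (1 + `|y - d|) by rewrite /e ge_min lexx.
  rewrite ler_pdivlMr// => he.
  have hab : `|y - d| * e <= d by nra.
  set q := Num.sqrt _ in s1 s2 sp *.
  have : (y - d) * (q - 1) <= d.
    apply: le_trans hab; apply: (le_trans (ler_norm _)).
    by rewrite normrM ler_wpM2l// ger0_norm; lra.
  nra.
apply: (le_trans (lerD (lerD (gcdf_le hG) (lexx _)) (lexx _))).
have := @gcdf_lipschitz _ (- y) (- y + 2 * d); rewrite /d in Kw *; lra.
Qed.

(** The indicator of x > z is at least the smoothed step at y minus the
    value of this step at z; the latter is small when z is below y by much
    more than the smoothing. *)
Lemma walk_tail_lower (e : R) : 0 < e -> exists2 K : R, 0 <= K &
  forall (sg y z : R) s k, sg ^+ 2 = 1 -> (N <= size s)%N ->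
  gcdf (- y / Num.sqrt (e + 1)) - K * (1 + M s ^+ 2) * w (size s)
    - gcdf ((z - y) / Num.sqrt (e + V (size s + k)%N / V (size s)))
  <= Ev m k (fun s' => (z * Num.sqrt (V (size s)) < sg * (M s' - M s))%R%:R) s.
Proof.
move=> e0; have [K K0 hK] := walk_clt model e0.
exists K => // sg y z s k sg2 Ns; set n := size s.
have sV0 : 0 < Num.sqrt (V n) by rewrite sqrtr_gt0.
have := hK sg y s k sg2 Ns; rewrite ler_norml => /andP[h _].
set t := V (n + k)%N / V n.
have t0 : 0 < t by rewrite divr_gt0.
have r0 : 0 < Num.sqrt (e + t) by rewrite sqrtr_gt0 addr_gt0.
have : Ev m k (fun s' => heat e y (V (size s') / V n)
       (sg * (M s' - M s) / Num.sqrt (V n)) + - gcdf ((z - y) / Num.sqrt (e + t))) s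
   <= Ev m k (fun s' => (z * Num.sqrt (V n) < sg * (M s' - M s))%R%:R) s.
  apply: Ev_le => // u uk; rewrite size_cat uk addnC -/n -/t -ltr_pdivlMr//.
  case: ltP => zx /=.
    by rewrite lerBlDr (le_trans (gcdf_le1 _))// lerDl gcdf_ge0.
  by rewrite subr_le0; apply: gcdf_le; rewrite ler_pM2r ?invr_gt0// lerD2r.
rewrite (EvD m k) Ev_cst; rewrite -/n in h *; rewrite /w; lra.
Qed.

(** The index n_r is the first n with V_n <= rho^r. For r large the blocks
    cover all large n, although some of them may be empty. *)
Lemma block_ex (rho : R) : 0 < rho < 1 -> exists nn : nat -> nat,
  [/\ forall r, V (nn r) <= rho ^+ r,
      forall r n, (n < nn r)%N -> rho ^+ r < V n,
      {homo nn : i j / (i <= j)%N},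
      forall n0, exists r0, forall r, (r0 <= r)%N -> (n0 <= nn r)%N &
      forall r0, exists n0, forall n, (n0 <= n)%N ->
        exists2 r, (r0 <= r)%N & (nn r <= n < nn r.+1)%N].
Proof.
move=> rho01; have /andP[rho0 rho1] := rho01.
have ex r : exists n, V n <= rho ^+ r.
  have [n0 h] := @walk_V_lt (rho ^+ r) (exprn_gt0 _ rho0).
  by exists n0; rewrite ltW// h.
pose nn r := ex_minn (ex r).
have P1 r : V (nn r) <= rho ^+ r by rewrite /nn; case: ex_minnP.
have P2 r n : (n < nn r)%N -> rho ^+ r < V n.
  rewrite /nn; case: ex_minnP => k _ hk nk; rewrite ltNge; apply/negP => /hk.
  by rewrite leqNgt nk.
have rho_le i j : (i <= j)%N -> rho ^+ j <= rho ^+ i.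
  by move=> ij; apply: ler_wiXn2l => //; exact: ltW.
have P3 : {homo nn : i j / (i <= j)%N}.
  move=> i j ij; rewrite leqNgt; apply/negP => /P2.
  by rewrite ltNge (le_trans (P1 j))// rho_le.
have P4 n0 : exists r0, forall r, (r0 <= r)%N -> (n0 <= nn r)%N.
  have [r0 h] := geometric_lt rho01 (V0 n0).
  exists r0 => r /h hr; rewrite leqNgt; apply/negP => rn.
  have := le_lt_trans (P1 r) hr; rewrite ltNge => /negP; apply.
  by apply: (walk_V_le model); exact: ltnW.
exists nn; split => // r0; exists (nn r0) => n rn.
have [R0 hR0] := P4 n.+1.
have bnd r : (nn r <= n)%N -> (r <= R0)%N.
  move=> h; rewrite leqNgt; apply/negP => /ltnW/hR0.
  by rewrite ltnNge h.
have exr : exists r, (nn r <= n)%N by exists r0.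
have [r nr hmax] := ex_maxnP exr bnd.
exists r; first exact: hmax.
rewrite nr ltnNge; apply/negP => /hmax; by rewrite ltnn.
Qed.

End tails.

(** * From the tree to a probability space; the central limit theorem *)

Section borel_cantelli_le.
Context d (T : measurableType d) (R : realType) (P : probability T R).

(** The first Borel-Cantelli lemma, for explicit bounds on the partial sums. *)
Lemma borel_cantelli_le (A : nat -> set T) (b : nat -> R) (B : R) r1 :
  (forall r, measurable (A r)) -> (forall r, (r1 <= r)%N -> (P (A r) <= (b r)%:E)%E) ->
  (forall r, 0 <= b r) -> (forall n, \sum_(0 <= r < n) b r <= B) ->
  {ae P, forall w, exists r0, forall r, (r0 <= r)%N -> ~ A r w}.
Proof.
move=> mA PA b0 bB; pose A' r := if (r1 <= r)%N then A r else set0.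
have mA' r : measurable (A' r) by rewrite /A'; case: ifP.
have PA' r : (P (A' r) <= (b r)%:E)%E.
  by rewrite /A'; case: ifPn => [/PA//|_]; rewrite measure0 lee_fin.
have P0 : P (lim_sup_set A') = 0%E.
  apply: lim_sup_set_cvg0 => //.
  apply: (@le_lt_trans _ _ B%:E); last exact: ltry.
  apply: lime_le; first exact: is_cvg_nneseries.
  apply: nearW => n; apply: (@le_trans _ _ (\sum_(0 <= r < n) b r)%:E).
    by rewrite -sumEFin; apply: lee_sum => i _; exact: PA'.
  by rewrite lee_fin.
exists (lim_sup_set A'); split => //.
  apply: bigcap_measurable => // k _; exact: bigcup_measurable.
move=> w /=; apply: contra_notP => hw.
have [n hn] : exists n, ~ exists2 r, (n <= r)%N & A' r w.
  apply: contrapT => /forallNP h; apply: hw => n _.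
  by have := h n; move=> /contrapT[r nr Ar]; exists r.
exists (maxn n r1) => r; rewrite geq_max => /andP[nr rr] Arw; apply: hn.
by exists r => //; rewrite /A' rr.
Qed.

End borel_cantelli_le.

Section process.
Context d (T : measurableType d) (R : realType) (P : probability T R).
Implicit Types (s u : seq bool) (w : T) (A : pred (seq bool)).

(** The random history of the process has, at each length, the law of the
    tree with conditional means m. *)
Record walk_process (m : seq bool -> R) (hist : nat -> T -> seq bool) : Prop :=
  WalkProcess {
  wp_size : forall n w, size (hist n w) = n;
  wp_behead : forall n w, behead (hist n.+1 w) = hist n w;
  wp_meas : forall n A, measurable [set w | A (hist n w)];
  wp_law : forall n A,
    P [set w | A (hist n w)] = (Ev m n (fun s => (A s)%:R) [::])%:E }.

Variables (m : seq bool -> R) (hist : nat -> T -> seq bool).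
Hypothesis proc : walk_process m hist.

Lemma hist_past n k w : past n (hist (n + k) w) = hist n w.
Proof.
elim: k => [|k IH].
  by rewrite addn0 /past (wp_size proc) subnn drop0.
rewrite -IH /past !(wp_size proc) addnS subSn ?leq_addr// addKn.
by rewrite -(wp_behead proc (n + k)) -drop1 drop_drop addn1.
Qed.

Lemma measurable_hist (g : seq bool -> R) n :
  measurable_fun setT (fun w => g (hist n w)).
Proof.
move=> _ B mB; rewrite setTI.
have := wp_meas proc n (fun s => `[< B (g s) >]).
by congr (measurable _); apply/seteqP; split => w /= /asboolP.
Qed.

Variables (M : seq bool -> R) (mu c V : nat -> R) (C del : R) (N : nat).
Hypothesis model : walk_model m M mu c V C del N.
Variable L : T -> R.
Hypothesis mL : measurable_fun setT L.
Hypothesis cvgP_L : forall delta eps : R, 0 < delta -> 0 < eps ->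
  exists n0, forall n, (n0 <= n)%N ->
    (P [set w | (delta <= `|M (hist n w) - L w|)%R] <= eps%:E)%E.

Lemma measurable_tail (sg y : R) n :
  measurable [set w | y < sg * (L w - M (hist n w))].
Proof.
have mf : measurable_fun setT (fun w => sg * (L w - M (hist n w))).
  apply: measurable_realfun.measurable_funM => //.
  by apply: measurable_realfun.measurable_funB => //; exact: measurable_hist.
have := mf measurableT `]y, +oo[%classic (measurable_itv _).
rewrite setTI; congr (measurable _); apply/seteqP; split => w /=.
  by rewrite in_itv/= andbT.
by rewrite in_itv/= andbT.
Qed.

(** Convergence in probability replaces the limit L by M at a large horizon,
    where the tree estimates are available. *)
Lemma limit_tail (sg y y' B : R) n k0 : sg ^+ 2 = 1 -> y' < y ->
  (forall k, (k0 <= k)%N -> Ev m (n + k)%N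
     (fun s => (y' < sg * (M s - M (past n s)))%R%:R) [::] <= B) ->
  (P [set w | (y < sg * (L w - M (hist n w)))%R] <= B%:E)%E.
Proof.
move=> sg2 yy' hB; apply/lee_addgt0Pr => eps eps0.
have dy : 0 < y - y' by rewrite subr_gt0.
have [n0 hn0] := cvgP_L dy eps0.
pose k := maxn k0 n0.
pose E1 := [set w | (y' < sg * (M (hist (n + k) w) - M (hist n w)))%R].
pose E2 := [set w | (y - y' <= `|M (hist (n + k) w) - L w|)%R].
have mE1 : measurable E1.
  have := wp_meas proc (n + k) (fun s => y' < sg * (M s - M (past n s))).
  by rewrite /E1; congr (measurable _); apply/seteqP; split => w /=; rewrite hist_past.
have mE2 : measurable E2.
  have mf : measurable_fun setT (fun w => `|M (hist (n + k) w) - L w|).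
    apply: measurableT_comp => //.
    by apply: measurable_realfun.measurable_funB => //; exact: measurable_hist.
  have := mf measurableT `[y - y', +oo[%classic (measurable_itv _).
  rewrite setTI; congr (measurable _); apply/seteqP; split => w /=.
    by rewrite in_itv/= andbT.
  by rewrite in_itv/= andbT.
have PE1 : (P E1 <= B%:E)%E.
  have := wp_law proc (n + k) (fun s => y' < sg * (M s - M (past n s))).
  rewrite (_ : [set w | _] = E1); last first.
    by rewrite /E1; apply/seteqP; split => w /=; rewrite hist_past.
  by move=> ->; rewrite lee_fin; apply: hB; rewrite leq_maxl.
have PE2 : (P E2 <= eps%:E)%E.
  by apply: hn0; rewrite (leq_trans (leq_maxr k0 n0))// leq_addl.
apply: (@le_trans _ _ (P (E1 `|` E2))).
  apply: le_measure; rewrite ?inE//.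
  - exact: measurable_tail.
  - exact: measurableU.
  move=> w /= hy; have [|h1] := ltP y' (sg * (M (hist (n + k) w) - M (hist n w))).
    by left.
  right; rewrite /E2/=.
  have : y - y' <= sg * (L w - M (hist (n + k) w)) by lra.
  move=> /le_trans; apply; apply: (le_trans (ler_norm _)).
  rewrite normrM distrC.
  have -> : `|sg| = 1 by apply/eqP; rewrite -sqrp_eq1// -normrX sg2 normr1.
  by rewrite mul1r.
by apply: (le_trans (measureU2 _ _ _)) => //; apply: leeD.
Qed.

(** Applied to both signs, this one-sided bound gives the central limit
    theorem, since the normal law is symmetric and continuous. *)
Lemma process_tail (sg y eta : R) : sg ^+ 2 = 1 -> 0 < eta ->
  exists n0, forall n, (n0 <= n)%N ->
  (P [set w | (y * Num.sqrt (V n) < sg * (L w - M (hist n w)))%R] <= (gcdf (- y) + eta)%:E)%E.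
Proof.
move=> sg2 eta0; have eta2 : 0 < eta / 2 by lra.
have [n0 hn0] := walk_cdf_upper model (y - eta / 2) sg2 eta2.
exists n0 => n /hn0[k0 hk0].
apply: (limit_tail (k0 := k0) sg2 (y' := (y - eta / 2) * Num.sqrt (V n))).
  by rewrite ltr_pM2r ?sqrtr_gt0 ?(wm_V0 model)//; lra.
move=> k /hk0 /le_trans; apply.
by have := @gcdf_lipschitz _ (- y) (- (y - eta / 2)); lra.
Qed.

Lemma process_clt (x : R) :
  P [set w | (M (hist n w) - L w) / Num.sqrt (V n) <= x] @[n --> \oo] --> (gcdf x)%:E.
Proof.
have sV n : 0 < Num.sqrt (V n) by rewrite sqrtr_gt0 (wm_V0 model).
have one2 : (1 : R) ^+ 2 = 1 by rewrite expr1n.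
have mone2 : (- 1 : R) ^+ 2 = 1 by rewrite sqrrN expr1n.
pose A n := [set w | (M (hist n w) - L w) / Num.sqrt (V n) <= x].
have AE n : A n = ~` [set w | x * Num.sqrt (V n) < -1 * (L w - M (hist n w))].
  apply/seteqP; split => w /=; rewrite /A/= ler_pdivrMr// mulN1r opprB.
    by move=> h; apply/negP; rewrite -leNgt.
  by move=> /negP; rewrite -leNgt.
have mA n : measurable (A n) by rewrite AE; apply: measurableC; exact: measurable_tail.
apply/fine_cvgP; split; first by apply: nearW => n; exact: (fin_num_measure _ _ (mA n)).
apply/cvgrPdist_le => eps eps0.
have eps2 : 0 < eps / 2 by lra.
have [n1 hn1] := process_tail x mone2 eps0.
have [n2 hn2] := process_tail (- x - eps / 2) one2 eps2.
exists (maxn n1 n2) => // n; rewrite /= geq_max => /andP[/hn1 h1 /hn2 h2].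
rewrite -/(A n) ler_norml; apply/andP; split.
  rewrite lerBrDl lerBlDr -lee_fin fineK ?fin_num_measure//.
  apply: (@le_trans _ _ (gcdf (- (- x - eps / 2)) + eps / 2)%:E); last first.
    by rewrite lee_fin; have := @gcdf_lipschitz _ x (- (- x - eps / 2)); lra.
  apply: le_trans h2; apply: le_measure; rewrite ?inE//; first exact: measurable_tail.
  move=> w; rewrite /A /= ler_pdivrMr// => h.
  have := mulr_gt0 eps2 (sV n); lra.
move: h1; rewrite -[X in P X]setCK -AE probability_setC// gcdfN.
have -> : P (A n) = (fine (P (A n)))%:E by rewrite fineK ?fin_num_measure.
by rewrite -EFinB lee_fin /=; lra.
Qed.

End process.

(** * Iterated logarithm: behaviour along geometric blocks *)

Section lil_upper.
Context d (T : measurableType d) (R : realType) (P : probability T R).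
Implicit Types (s u : seq bool) (w : T).

Variables (m : seq bool -> R) (hist : nat -> T -> seq bool).
Hypothesis proc : walk_process P m hist.
Variables (M : seq bool -> R) (mu c V : nat -> R) (C del : R) (N : nat).
Hypothesis model : walk_model m M mu c V C del N.
Variable L : T -> R.
Hypothesis mL : measurable_fun setT L.
Hypothesis cvgP_L : forall delta eps : R, 0 < delta -> 0 < eps ->
  exists n0, forall n, (n0 <= n)%N ->
    (P [set w | (delta <= `|M (hist n w) - L w|)%R] <= eps%:E)%E.

Let V0 := wm_V0 model.
Let C0 : 0 < C := lt_le_trans ltr01 (wm_C1 model).

(** The scale of the iterated logarithm over the block r, where the
    remaining variance is about rho^r and its iterated logarithm is about
    log r. *)
Definition lil_scale (rho : R) r : R := Num.sqrt (2 * rho ^+ r * ln r%:R).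

Variables (rho : R) (nn : nat -> nat).
Hypothesis rho01 : 0 < rho < 1.
Hypothesis nnV : forall r, V (nn r) <= rho ^+ r.
Hypothesis Vnn : forall r n, (n < nn r)%N -> rho ^+ r < V n.
Hypothesis nn_infty : forall n0, exists r0, forall r, (r0 <= r)%N -> (n0 <= nn r)%N.

Let rho0 : 0 < rho. Proof. by case/andP: rho01. Qed.
Let rhoX r : 0 < rho ^+ r. Proof. exact: exprn_gt0. Qed.
Let bb := - (del * ln rho).

Lemma decay_exponent_gt0 : 0 < bb.
Proof.
rewrite /bb -mulrN mulr_gt0 ?(wm_del0 model)// oppr_gt0 ln_lt0//.
Qed.

Lemma lil_scale_sqr r : lil_scale rho r ^+ 2 = 2 * rho ^+ r * ln r%:R.
Proof.
by rewrite sqr_sqrtr// !mulr_ge0 ?ln_nat_ge0// ltW.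
Qed.

Lemma lil_scale_gt0 r : (2 <= r)%N -> 0 < lil_scale rho r.
Proof.
move=> r2; rewrite sqrtr_gt0 !mulr_gt0//.
by apply: lt_le_trans (ln_nat_ge_half r2); lra.
Qed.

(** Along the blocks the error of the central limit theorem decays
    geometrically. *)
Lemma rate_block r : rate V del (nn r) <= expR (- (bb * r%:R)).
Proof.
rewrite /rate ler_expR /bb mulNr opprK -mulrA ler_pM2l ?(wm_del0 model)//.
rewrite mulr_natr -lnXn// ler_ln ?posrE//.
Qed.

(** The Gaussian tail at the scale (1 + eta) gives the summable probability
    r^-(1+e), and the error term of the conditional central limit theorem is
    geometric. *)
Lemma block_start_ae (sg eta : R) : sg ^+ 2 = 1 -> 0 < eta ->
  {ae P, forall w, exists r0, forall r, (r0 <= r)%N ->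
    sg * (L w - M (hist (nn r) w)) <= (1 + eta) * lil_scale rho r}.
Proof.
move=> sg2 eta0; pose e := eta / 2; have e0 : 0 < e by rewrite /e; lra.
have [K K0 hK] := walk_tail model e0.
pose b r := K * (expR (- ((1 + e) * ln (r%:R : R))) + expR (- (bb * r%:R))).
have [r1 hr1] := nn_infty N.
pose A r := [set w | (1 + eta) * lil_scale rho r < sg * (L w - M (hist (nn r) w))].
have : {ae P, forall w, exists r0, forall r, (r0 <= r)%N -> ~ A r w}.
  apply: (@borel_cantelli_le _ _ _ P A b (K * ((2 + e^-1) + (1 - expR (- bb))^-1)) (maxn r1 2)).
  - by move=> r; exact: (measurable_tail proc).
  - move=> r; rewrite geq_max => /andP[/hr1 Nr r2].
    have ln0 : 1 / 2 <= ln (r%:R : R) by exact: ln_nat_ge_half.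
    have ln00 : 0 < ln (r%:R : R) by lra.
    (* half of eta pays for the variance e + 1 in the tail bound, the other
       half for passing from M at a large horizon to its limit *)
    pose y := (1 + e) * Num.sqrt (2 * ln (r%:R : R)).
    apply: (limit_tail proc mL cvgP_L (k0 := 0%N) sg2 (y' := y * Num.sqrt (V (nn r)))).
      apply: (@le_lt_trans _ _ ((1 + e) * lil_scale rho r)); last first.
        by rewrite ltr_pM2r ?lil_scale_gt0// /e; lra.
      rewrite /y -mulrA ler_pM2l; last by lra.
      rewrite /lil_scale (_ : 2 * rho ^+ r * _ = 2 * ln r%:R * rho ^+ r); last by ring.
      rewrite [X in _ <= X]sqrtrM; last by lra.
      by rewrite ler_wpM2l ?sqrtr_ge0// ler_wsqrtr.
    move=> k _; apply: (le_trans (hK sg y (nn r) k sg2 Nr)).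
    rewrite /b ler_wpM2l//; apply: lerD; last exact: rate_block.
    pose z := Num.sqrt (1 + e) * Num.sqrt (2 * ln (r%:R : R)).
    have s1 : 0 < Num.sqrt (1 + e) by rewrite sqrtr_gt0; lra.
    have -> : - y / Num.sqrt (e + 1) = - z.
      rewrite /y /z mulNr [e + 1]addrC -[X in X * Num.sqrt (2 * _)](@sqr_sqrtr _ (1 + e)); last by lra.
      by congr (- _); field; rewrite gt_eqF.
    have zz : z ^+ 2 = 2 * ((1 + e) * ln (r%:R : R)).
      by rewrite /z exprMn !sqr_sqrtr; [ring|lra|lra].
    have z0 : 0 <= z by rewrite mulr_ge0 ?sqrtr_ge0.
    have z1 : 1 <= z.
      rewrite -(@ler_pXn2r _ 2)// ?nnegrE// zz expr1n; nra.
    apply: (le_trans (gcdf_upper_tail z1)); apply: (le_trans (gpdf_le_exp z)).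
    by rewrite ler_expR mulNr zz lerN2; lra.
  - by move=> r; rewrite /b mulr_ge0// addr_ge0// expR_ge0.
  - move=> n; rewrite /b -mulr_sumr ler_wpM2l// big_split/= lerD//.
      exact: sum_pow_le.
    exact: sum_geometric_le decay_exponent_gt0.
apply: filterS => w [r0 h]; exists r0 => r /h /negP.
by rewrite -leNgt.
Qed.

(** The variance spent inside a block is at most rho^r (1 - rho), a small
    fraction of rho^r by the assumption on rho; optimising the exponential
    bound in lam makes the exceedance probability at most r^-2. *)
Lemma block_oscillation_ae (sg eta : R) : sg ^+ 2 = 1 -> 0 < eta ->
  32 * C * (1 - rho) <= eta ^+ 2 ->
  {ae P, forall w, exists r0, forall r n, (r0 <= r)%N -> (nn r <= n < nn r.+1)%N ->
    sg * (M (hist n w) - M (hist (nn r) w)) <= eta * lil_scale rho r}.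
Proof.
move=> sg2 eta0 heta.
pose b r := expR (- ((1 + 1) * ln (r%:R : R))).
have [r1 hr1] := nn_infty N.
pose B r s := (nn r < nn r.+1)%N && hit (nn r)
  (fun u => eta * lil_scale rho r < sg * (M u - M (past (nn r) u))) s.
pose A r := [set w | B r (hist (nn r.+1).-1 w)].
have : {ae P, forall w, exists r0, forall r, (r0 <= r)%N -> ~ A r w}.
  apply: (@borel_cantelli_le _ _ _ P A b (2 + 1^-1) (maxn r1 2)).
  - by move=> r; exact: (wp_meas proc).
  - move=> r; rewrite geq_max => /andP[/hr1 Nr r2].
    rewrite (wp_law proc) lee_fin.
    have [rr|rr] := boolP (nn r < nn r.+1)%N; last first.
      rewrite (Ev_ext (wm_m1 model) (g := fun=> 0)) ?Ev_cst ?expR_ge0// => u _.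
      by rewrite /B (negbTE rr).
    have ln0 : 1 / 2 <= ln (r%:R : R) by exact: ln_nat_ge_half.
    have hk : (nn r + ((nn r.+1).-1 - nn r))%N = (nn r.+1).-1.
      by rewrite subnKC// -ltnS prednK// (leq_ltn_trans _ rr).
    rewrite -hk Ev_add -(Ev_cst m (b r) (nn r) [::]).
    apply: (Ev_le (wm_m1 model)) => s sr; rewrite cats0.
    set x := lil_scale rho r.
    have x0 : 0 < x by exact: lil_scale_gt0.
    set k := (_ - _)%N in hk *.
    have q0 : 0 < 16 * C * rho ^+ r * (1 - rho).
      by rewrite !mulr_gt0// subr_gt0; case/andP: rho01.
    (* the minimiser of the exponent - lam eta x + 8 lam^2 C rho^r (1 - rho) *)
    pose lam := eta * x / (16 * C * rho ^+ r * (1 - rho)).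
    have lam0 : 0 <= lam by apply: divr_ge0; nonneg.
    have Ns : (N <= size s)%N by rewrite sr.
    have := walk_maximal model (eta * x) k sg2 lam0 Ns.
    rewrite sr hk => hm.
    apply: (le_trans (y := expR (- (lam * (eta * x)) + 8 * lam ^+ 2 * C *
       (V (nn r) - V (nn r.+1).-1)))); first apply: le_trans hm.
      apply: (Ev_le (wm_m1 model)) => u uk; rewrite ler_nat /B rr/=.
      case hA : (hit _ _ _) => //.
      rewrite (hit_sub _ _ hA)//; first by rewrite size_cat sr leq_addl.
      move=> v v' uE nv; suff -> : past (nn r) v = s by [].
      have : past (nn r) (v' ++ v) = s by rewrite -uE past_cat.
      rewrite /past size_cat -addnBA// drop_cat ltnNge leq_addr/= addKn//.
    rewrite /b ler_expR.
    have V1 : V (nn r) - V (nn r.+1).-1 <= rho ^+ r * (1 - rho).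
      rewrite mulrBr mulr1 -exprSr; apply: lerB => //.
      by apply: ltW; apply: Vnn; rewrite prednK// (leq_ltn_trans _ rr).
    have h1 : 8 * lam ^+ 2 * C * (V (nn r) - V (nn r.+1).-1) <= lam * (eta * x) / 2.
      have D0 : 0 <= 8 * lam ^+ 2 * C by nonneg.
      apply: (le_trans (ler_wpM2l D0 V1)).
      rewrite le_eqVlt; apply/orP; left; apply/eqP.
      rewrite /lam; field; rewrite !gt_eqF// subr_gt0.
      by case/andP: rho01.
    have h2 : 4 * ln (r%:R : R) <= lam * (eta * x).
      have -> : lam * (eta * x) = eta ^+ 2 * x ^+ 2 / (16 * C * rho ^+ r * (1 - rho)).
        by rewrite /lam; ring.
      rewrite ler_pdivlMr// lil_scale_sqr.
      have P0 : 0 <= 2 * rho ^+ r * ln (r%:R : R) by apply: mulr_ge0; [rewrite mulr_ge0// ltW|lra].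
      have := ler_wpM2r P0 heta; lra.
    lra.
  - by move=> r; exact: expR_ge0.
  - by move=> n; exact: sum_pow_le.
apply: filterS => w [r0 h]; exists r0 => r n rr /andP[rn nr]; rewrite leNgt; apply/negP => hlt.
apply: (h r rr); rewrite /A/= /B (leq_ltn_trans rn nr)/=.
have nE : (nn r.+1).-1 = (n + ((nn r.+1).-1 - n))%N.
  by rewrite subnKC// -ltnS prednK// (leq_ltn_trans _ nr).
rewrite nE -(cat_take_drop (size (hist (n + ((nn r.+1).-1 - n)) w) - n) (hist _ w)).
rewrite -/(past n _) (hist_past proc); apply: hit_cat; first by rewrite (wp_size proc).
have {2}-> : n = (nn r + (n - nn r))%N by rewrite subnKC.
by rewrite (hist_past proc).
Qed.

End lil_upper.

(** * Iterated logarithm: upper bound *)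

Lemma limn_esup_eq1 (R : realType) (u : nat -> R) :
  (forall k : nat, exists n0, forall n, (n0 <= n)%N -> u n <= 1 + k.+1%:R^-1) ->
  (forall k n0 : nat, exists2 n, (n0 <= n)%N & 1 - k.+1%:R^-1 <= u n) ->
  limn_esup (fun n => (u n)%:E) = 1%E.
Proof.
move=> uU uL.
have small (e : R) : 0 < e -> exists k : nat, k.+1%:R^-1 <= e.
  move=> e0; have [k _ hk] := nbhs_infty_ger e^-1.
  have k1 : 0 < (k.+1%:R : R) by rewrite ltr0n.
  exists k; rewrite -[e]invrK lef_pV2 ?posrE ?invr_gt0//.
  by apply: hk => /=; rewrite ltnW.
apply/eqP; rewrite eq_le; apply/andP; split.
  apply/lee_addgt0Pr => e e0; have [k ke] := small e e0.
  have [n0 hn0] := uU k.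
  apply: (@le_trans _ _ (ereal_sup ((fun n => (u n)%:E) @` [set n | (n0 <= n)%N]))).
    by apply: ereal_inf_lbound; exists [set n | (n0 <= n)%N] => //; exists n0.
  apply: ge_ereal_sup => _ [n /= nn <-]; rewrite -EFinD lee_fin.
  by apply: (le_trans (hn0 n nn)); rewrite lerD2l.
apply: le_ereal_inf_tmp => _ [A [n0 _ An0] <-].
apply/lee_addgt0Pr => e e0; have [k ke] := small e e0.
have [n nn hn] := uL k n0.
apply: (@le_trans _ _ ((u n)%:E + e%:E)%E); first by rewrite -EFinD lee_fin -lerBlDr (le_trans _ hn)// lerD2l lerN2.
by rewrite leeD2r//; apply: ereal_sup_ubound; exists n => //; exact: An0.
Qed.

Section lil.
Context d (T : measurableType d) (R : realType) (P : probability T R).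
Implicit Types (s u : seq bool) (w : T).
Variables (m : seq bool -> R) (hist : nat -> T -> seq bool).
Hypothesis proc : walk_process P m hist.
Variables (M : seq bool -> R) (mu c V : nat -> R) (C del : R) (N : nat).
Hypothesis model : walk_model m M mu c V C del N.
Variable L : T -> R.
Hypothesis mL : measurable_fun setT L.
Hypothesis cvgP_L : forall delta eps : R, 0 < delta -> 0 < eps ->
  exists n0, forall n, (n0 <= n)%N ->
    (P [set w | (delta <= `|M (hist n w) - L w|)%R] <= eps%:E)%E.

Let V0 := wm_V0 model.
Let C1 := wm_C1 model.
Let C0 : 0 < C := lt_le_trans ltr01 (wm_C1 model).

Definition psi n : R := Num.sqrt (2 * V n * ln `|ln (V n)|).

Lemma ln_rho_lt0 (rho : R) : 0 < rho < 1 -> 0 < - ln rho.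
Proof. by move=> rho01; rewrite oppr_gt0 ln_lt0. Qed.

(** On the block r the remaining variance is at least rho^(r+1), and the
    iterated logarithm of V is log r + O(1). *)
Lemma lil_scale_le_psi (rho eta K1 K2 : R) : 0 < rho < 1 -> 0 < eta ->
  0 <= K1 -> 0 <= K2 -> K1 ^+ 2 * (1 + eta) <= K2 ^+ 2 * rho ->
  exists r0, forall r n, (r0 <= r)%N -> rho ^+ r.+1 < V n <= rho ^+ r ->
    K1 * lil_scale rho r <= K2 * psi n.
Proof.
move=> rho01 eta0 K10 K20 hK; have /andP[rho0 rho1] := rho01.
have l0 := ln_rho_lt0 rho01.
(* ln |ln V| is at least ln r - A on the block r *)
pose A := - ln (- ln rho).
have [r0 hr0] := ln_nat_ge (Num.max 1 (A * (1 + eta) / eta)).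
exists (maxn 2 r0) => r n; rewrite geq_max => /andP[r2 /hr0].
rewrite ge_max => /andP[lr1 lrA] /andP[V1 V2].
rewrite ler_pdivrMr// in lrA.
have r0' : (0 : R) < r%:R by rewrite ltr0n (leq_trans _ r2).
have lnV : r%:R * (- ln rho) <= - ln (V n).
  rewrite mulrN lerN2 mulr_natl -lnXn// ler_ln ?posrE// exprn_gt0//.
have lnV0 : 0 < r%:R * (- ln rho) by rewrite mulr_gt0.
have lnlnV : ln (r%:R : R) - A <= ln `|ln (V n)|.
  rewrite -normrN gtr0_norm; last exact: lt_le_trans lnV.
  rewrite /A opprK -lnM ?posrE// ler_ln ?posrE//; exact: lt_le_trans lnV.
have lrA' : ln (r%:R : R) <= (1 + eta) * (ln r%:R - A) by lra.
have sq : (K1 * lil_scale rho r) ^+ 2 <= (K2 * psi n) ^+ 2.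
  have rX : 0 < rho ^+ r by exact: exprn_gt0.
  have B0 : 0 < ln (r%:R : R) - A by nra.
  have P0 : 0 <= ln `|ln (V n)| by apply: le_trans lnlnV; exact: ltW.
  rewrite !exprMn lil_scale_sqr// /psi sqr_sqrtr; last by rewrite !mulr_ge0// ltW.
  have K1s := sqr_ge0 K1; have K2s := sqr_ge0 K2.
  apply: (@le_trans _ _ (K1 ^+ 2 * (1 + eta) * (2 * rho ^+ r * (ln r%:R - A)))).
    have := ler_wpM2l (mulr_ge0 K1s (ltW rX)) lrA'; lra.
  apply: (@le_trans _ _ (K2 ^+ 2 * rho * (2 * rho ^+ r * (ln r%:R - A)))).
    by rewrite ler_wpM2r// !mulr_ge0// ltW.
  rewrite -mulrA ler_wpM2l//.
  rewrite (_ : rho * _ = 2 * (rho ^+ r.+1 * (ln r%:R - A))); last by rewrite exprS; ring.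
  rewrite -[X in _ <= X]mulrA ler_pM2l//.
  by apply: ler_pM => //; [rewrite exprn_ge0// ltW|exact: ltW|exact: ltW].
rewrite -(@ler_pXn2r _ 2)// ?nnegrE; nonneg.
Qed.

Lemma psi_le_scale (rho eta : R) : 0 < rho < 1 -> 0 < eta ->
  exists r0, forall r n, (r0 <= r)%N -> rho ^+ r.+1 <= V n <= rho ^+ r ->
    psi n <= (1 + eta) * lil_scale rho r.
Proof.
move=> rho01 eta0; have /andP[rho0 rho1] := rho01.
have l0 := ln_rho_lt0 rho01.
(* ln |ln V| is at most ln r + A on the block r, as (r + 1) / r <= 2 *)
pose A := ln (2 * (- ln rho)).
have [r0 hr0] := ln_nat_ge (Num.max 1 (A / eta)).
exists (maxn 2 r0) => r n; rewrite geq_max => /andP[r2 /hr0].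
rewrite ge_max => /andP[lr1 lrA] /andP[V1 V2].
rewrite ler_pdivrMr// in lrA.
have r0' : (0 : R) < r%:R by rewrite ltr0n (leq_trans _ r2).
have r1' : (1 : R) <= r%:R by rewrite ler1n (leq_trans _ r2).
have rX : 0 < rho ^+ r by exact: exprn_gt0.
have rX1 : 0 < rho ^+ r.+1 by exact: exprn_gt0.
have lnV : - ln (V n) <= r%:R * (2 * (- ln rho)).
  have : ln (rho ^+ r.+1) <= ln (V n) by rewrite ler_ln ?posrE.
  rewrite lnXn// -mulr_natl -natr1; nra.
have lnV0 : 0 < - ln (V n).
  rewrite oppr_gt0 ln_lt0// V0 /= (le_lt_trans V2)// exprn_ilt1// ?ltW//.
  by rewrite -lt0n (leq_trans _ r2).
have lnlnV : ln `|ln (V n)| <= ln (r%:R : R) + A.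
  rewrite -normrN gtr0_norm// /A -lnM ?posrE ?mulr_gt0// ler_ln ?posrE// ?mulr_gt0//.
rewrite /psi -(@ler_pXn2r _ 2)// ?nnegrE; [|nonneg|nonneg; lra].
have h : 2 * V n * ln `|ln (V n)| <= (1 + eta) * (2 * rho ^+ r * ln r%:R).
  apply: (@le_trans _ _ (2 * V n * ((1 + eta) * ln r%:R))).
    by rewrite ler_pM2l ?mulr_gt0//; lra.
  have : 0 <= (1 + eta) * ln (r%:R : R) by apply: mulr_ge0; lra.
  move=> /(ler_wpM2l)/(_ _ _ V2); lra.
have [hneg|hpos] := leP (2 * V n * ln `|ln (V n)|) 0.
  by rewrite ler0_sqrtr// expr0n/= sqr_ge0.
rewrite sqr_sqrtr ?(ltW hpos)// exprMn lil_scale_sqr//.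
apply: (le_trans h); apply: ler_wpM2r; first by rewrite mulr_ge0 ?ln_nat_ge0 ?mulr_ge0// ltW.
nra.
Qed.

(** At the index n of the block r, M_n - L splits into the oscillation from
    the start of the block and the tail at the start of the block. The
    second part uses the opposite sign. *)
Lemma lil_upper_ae (sg eps : R) : sg ^+ 2 = 1 -> 0 < eps -> eps <= 1 ->
  {ae P, forall w, exists n0, forall n, (n0 <= n)%N ->
    sg * (M (hist n w) - L w) <= (1 + eps) * psi n}.
Proof.
move=> sg2 eps0 eps1; pose eta := eps / 10.
have eta0 : 0 < eta by rewrite /eta; lra.
have eta1 : eta <= 1 / 10 by rewrite /eta; lra.
have epsE : eps = 10 * eta by rewrite /eta; field.
(* the smallest ratio allowed by the bound on the oscillation inside the
   blocks *)
pose rho := 1 - eta ^+ 2 / (32 * C).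
have q0 : 0 < eta ^+ 2 / (32 * C) by rewrite divr_gt0 ?exprn_gt0 ?mulr_gt0.
have qe : eta ^+ 2 / (32 * C) <= eta.
  by rewrite ler_pdivrMr ?mulr_gt0// expr2 ler_pM2l//; have := C1; lra.
have rho01 : 0 < rho < 1 by rewrite /rho; apply/andP; split; lra.
have /andP[rho0 rho1] := rho01.
have hrho : 32 * C * (1 - rho) <= eta ^+ 2.
  by rewrite /rho opprB addrC subrK mulrC divfK// gt_eqF// mulr_gt0.
have [nn [nnV Vnn nn_le nn_infty cover]] := block_ex model rho01.
have msg2 : (- sg) ^+ 2 = 1 by rewrite sqrrN.
have [r1 hr1] : exists r0, forall r n, (r0 <= r)%N -> rho ^+ r.+1 < V n <= rho ^+ r ->
    (1 + 2 * eta) * lil_scale rho r <= (1 + eps) * psi n.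
  apply: (@lil_scale_le_psi _ eta) => //; rewrite ?epsE; [lra|lra|].
  have : 1 - eta <= rho by rewrite /rho; lra.
  have e2 : 0 <= (1 + 10 * eta) ^+ 2 by exact: sqr_ge0.
  move=> /(ler_wpM2l e2) => h; apply: le_trans h; nra.
have h1 := block_start_ae proc model mL cvgP_L rho01 nnV nn_infty msg2 eta0.
have h2 := block_oscillation_ae proc model rho01 nnV Vnn nn_infty sg2 eta0 hrho.
apply: filterS2 h1 h2 => w [r2 h2] [r3 h3].
have [n0 hn0] := cover (maxn r1 (maxn r2 r3)).
exists n0 => n /hn0[r]; rewrite !geq_max => /andP[rr1 /andP[rr2 rr3]] nnr.
have /andP[nr1 nr2] := nnr.
have := h2 _ rr2; have := h3 _ _ rr3 nnr => g3 g2.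
apply: le_trans (hr1 r n rr1 _); last first.
  rewrite (Vnn r.+1)// (le_trans _ (nnV r))//.
  exact: (walk_V_le model).
lra.
Qed.

End lil.

(** * Iterated logarithm: lower bound *)

Section lil_lower.
Context d (T : measurableType d) (R : realType) (P : probability T R).
Implicit Types (s u : seq bool) (w : T).
Variables (m : seq bool -> R) (hist : nat -> T -> seq bool).
Hypothesis proc : walk_process P m hist.
Variables (M : seq bool -> R) (mu c V : nat -> R) (C del : R) (N : nat).
Hypothesis model : walk_model m M mu c V C del N.
Variable L : T -> R.
Hypothesis mL : measurable_fun setT L.
Hypothesis cvgP_L : forall delta eps : R, 0 < delta -> 0 < eps ->
  exists n0, forall n, (n0 <= n)%N ->
    (P [set w | (delta <= `|M (hist n w) - L w|)%R] <= eps%:E)%E.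
Hypothesis cvg_L : {ae P, forall w, M (hist n w) @[n --> \oo] --> L w}.

Let V0 := wm_V0 model.
Let C0 : 0 < C := lt_le_trans ltr01 (wm_C1 model).

(** The lower bound const / r for the Gaussian tail at a level slightly
    below sqrt (2 log r), which is where the divergence of the harmonic
    series is gained. *)
Lemma gcdf_lower_scale (eta : R) : 0 < eta -> eta <= 1 / 2 ->
  exists r1, forall r, (r1 <= r)%N ->
    gpdf 0 / r%:R <= gcdf (- ((1 - eta ^+ 2 / 4) * Num.sqrt (2 * ln (r%:R : R)))).
Proof.
move=> eta0 eta1; have [r0 hr0] := ln_nat_ge (8 / eta ^+ 4).
exists (maxn 1 r0) => r; rewrite geq_max => /andP[r1 /hr0 lnr].
set L2 := Num.sqrt _; have L20 : 0 <= L2 by exact: sqrtr_ge0.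
have L2sq : L2 ^+ 2 = 2 * ln (r%:R : R) by rewrite sqr_sqrtr// mulr_ge0// ln_nat_ge0.
have L2big : 4 / eta ^+ 2 <= L2.
  rewrite -(@ler_pXn2r _ 2)// ?nnegrE ?divr_ge0 ?sqr_ge0// L2sq.
  have -> : (4 / eta ^+ 2) ^+ 2 = 2 * (8 / eta ^+ 4) by field; rewrite gt_eqF.
  by rewrite ler_pM2l.
set y := (1 - _) * L2.
have yE : y + 1 <= L2.
  have : eta ^+ 2 / 4 * (4 / eta ^+ 2) <= eta ^+ 2 / 4 * L2.
    by rewrite ler_pM2l ?divr_gt0 ?exprn_gt0.
  have -> : eta ^+ 2 / 4 * (4 / eta ^+ 2) = 1 by field; rewrite gt_eqF.
  rewrite /y; lra.
have y0 : 0 <= y by rewrite /y mulr_ge0// subr_ge0; nra.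
apply: le_trans (gcdf_lower_tail y0).
rewrite /gpdf expr0n/= oppr0 mul0r expR0 mulr1 ler_wpM2l ?normal_peak_ge0//.
rewrite -expRN_ln ?ltr0n// ler_expR mulNr lerN2.
have : (y + 1) ^+ 2 <= L2 ^+ 2.
  by rewrite ler_pXn2r ?nnegrE// (le_trans y0)// lerDl.
by rewrite L2sq; lra.
Qed.

(** The error made by smoothing: at a distance of order eta times the scale
    and with variance v small compared with eta^2, the tail is at most r^-2. *)
Lemma gcdf_upper_scale (eta v : R) r : 0 < eta -> eta <= 1 / 2 ->
  0 < v -> v <= eta ^+ 2 / 32 -> (2 <= r)%N ->
  gcdf (- (eta / 2 * ((1 - eta / 2) * Num.sqrt (2 * ln (r%:R : R))) / Num.sqrt v))
    <= r%:R^-1 * r%:R^-1.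
Proof.
move=> eta0 eta1 v0 vE r2; have lnr := @ln_nat_ge_half R r r2.
have r0' : (0 : R) < r%:R by rewrite ltr0n (leq_trans _ r2).
have s0 : 0 < Num.sqrt v by rewrite sqrtr_gt0.
set Y := _ / Num.sqrt v.
have Y0 : 0 <= Y.
  by rewrite divr_ge0 ?mulr_ge0 ?sqrtr_ge0 ?subr_ge0//; lra.
have Ysq : 4 * ln (r%:R : R) <= Y ^+ 2.
  have ss : Num.sqrt v ^+ 2 = v by rewrite sqr_sqrtr// ltW.
  have L2sq : Num.sqrt (2 * ln (r%:R : R)) ^+ 2 = 2 * ln r%:R by rewrite sqr_sqrtr//; lra.
  have -> : Y ^+ 2 = (eta / 2) ^+ 2 * (1 - eta / 2) ^+ 2 * (2 * ln r%:R) / v.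
    by rewrite -ss -L2sq /Y; field; rewrite gt_eqF.
  rewrite ler_pdivlMr//.
  have h9 : (1 / 2 : R) <= (1 - eta / 2) ^+ 2 by nra.
  set l := ln _ in lnr *; have l0 : 0 <= 4 * l by lra.
  apply: (le_trans (ler_wpM2l l0 vE)).
  have W0 : 0 <= (eta / 2) ^+ 2 * (2 * l) by rewrite mulr_ge0 ?sqr_ge0//; lra.
  have := ler_wpM2l W0 h9; have := mulr_ge0 (sqr_ge0 eta) l0; lra.
have Y1 : 1 <= Y by rewrite -(@ler_pXn2r _ 2)// ?nnegrE// expr1n; lra.
rewrite -expRN_ln// -expRD (_ : _ + _ = - (2 * ln r%:R)); last by ring.
by apply: gcdf_tail_sqr => //; lra.
Qed.

Section blocks.
Variables (rho : R) (nn : nat -> nat).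
Hypothesis rho01 : 0 < rho < 1.
Hypothesis nnV : forall r, V (nn r) <= rho ^+ r.
Hypothesis Vnn : forall r n, (n < nn r)%N -> rho ^+ r < V n.
Hypothesis nn_le : {homo nn : i j / (i <= j)%N}.
Hypothesis nn_infty : forall n0, exists r0, forall r, (r0 <= r)%N -> (n0 <= nn r)%N.

(** The block start undershoots rho^r by a factor tending to 1, because a
    single step uses a vanishing fraction of the remaining variance. *)
Lemma block_variance_ge (q : R) : 0 < q -> q < 1 ->
  exists r1, forall r, (r1 <= r)%N -> q * rho ^+ r <= V (nn r).
Proof.
move=> q0 qlt; have q1 : 0 < 1 - q by rewrite subr_gt0.
have [n1 hn1] := rate_lt model (divr_gt0 q1 C0).
have [ra hra] := nn_infty (maxn n1 N).+1.
exists ra => r rra.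
have := hra r rra; case E : (nn r) => [//|n']; rewrite ltnS geq_max => /andP[nn1 nN].
have Vn' : rho ^+ r < V n' by apply: Vnn; rewrite E.
have w1 : rate V del n' < (1 - q) / C by exact: hn1.
have w0 : 0 < rate V del n' by exact: rate_gt0.
have w2 : rate V del n' <= 1 by exact: (rate_le1 model).
have hc : c n' ^+ 2 <= C * V n' * rate V del n' ^+ 2 by apply: (wm_cw model); rewrite nN leqnn.
have hv : V n' - V n'.+1 <= c n' ^+ 2.
  by rewrite (wm_VS model) ler_piMl ?sqr_ge0// gerBl sqr_ge0.
have hw : C * rate V del n' ^+ 2 <= 1 - q.
  move: w1; rewrite ltr_pdivlMr// => w1.
  have : C * rate V del n' ^+ 2 <= C * rate V del n'.
    by rewrite ler_pM2l// expr2 ler_piMl// ltW.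
  lra.
have := ler_wpM2l (ltW (V0 n')) hw => hw'.
have : q * rho ^+ r <= q * V n' by rewrite ler_pM2l// ltW.
lra.
Qed.

Lemma rate_block_small (K : R) : 0 <= K -> exists r1, forall r, (r1 <= r)%N ->
  K * rate V del (nn r) <= gpdf 0 / 4 / r%:R.
Proof.
move=> K0; have p0 : 0 < gpdf (0 : R) by exact: gpdf_gt0.
pose bb := - (del * ln rho).
have bb0 : 0 < bb by exact: (decay_exponent_gt0 model rho01).
have [rc _ hrc] := nbhs_infty_ger (K * 16 / (bb ^+ 2 * gpdf 0)).
exists (maxn 1 rc) => r; rewrite geq_max => /andP[r1 /hrc /= hrK].
have r0' : (0 : R) < r%:R by rewrite ltr0n.
have br0 : 0 <= bb * r%:R by rewrite mulr_ge0// ltW.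
have hw : rate V del (nn r) <= 4 / (bb ^+ 2 * r%:R ^+ 2).
  apply: (le_trans (rate_block model rho01 nnV r)); rewrite -/bb expRN.
  have b2 : 0 < (bb * r%:R / 2) ^+ 2 by rewrite exprn_gt0// divr_gt0// mulr_gt0.
  rewrite -[X in _ <= X]invrK lef_pV2 ?posrE ?expR_gt0//; last first.
    by rewrite invr_gt0 divr_gt0// mulr_gt0// exprn_gt0.
  apply: le_trans (expR_quad_lower br0).
  rewrite le_eqVlt; apply/orP; left; apply/eqP.
  by field; rewrite !gt_eqF.
apply: (le_trans (ler_wpM2l K0 hw)).
have bp : 0 < bb ^+ 2 * gpdf 0 by apply: mulr_gt0 => //; exact: exprn_gt0.
move: hrK; rewrite ler_pdivrMr// => hrK.
rewrite mulrA ler_pdivrMr ?mulr_gt0 ?exprn_gt0//.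
rewrite (_ : gpdf 0 / 4 / r%:R * _ = (r%:R * (bb ^+ 2 * gpdf 0)) / 4); last first.
  by field; rewrite gt_eqF.
lra.
Qed.

(** The conditional probability of a large increment over one block. The
    Gaussian main term is at least const / r; the smoothing error is r^-2
    and the error of the conditional central limit theorem is geometric,
    uniformly as long as M stays bounded. *)
Lemma block_increment_prob (sg eta kap : R) : sg ^+ 2 = 1 ->
  0 < eta -> eta <= 1 / 2 -> rho <= eta ^+ 2 / 160 ->
  exists r1, forall r s, (r1 <= r)%N -> size s = nn r -> `|M s| <= kap ->
    gpdf 0 / 4 / r%:R <= Ev m (nn r.+1 - nn r)%N
      (fun s' => ((1 - eta) * lil_scale rho r < sg * (M s' - M s))%R%:R) s.
Proof.
move=> sg2 eta0 eta1 rhoE; have /andP[rho0 rho1] := rho01.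
have p0 : 0 < gpdf (0 : R) by exact: gpdf_gt0.
have [K K0 hK] := walk_tail_lower model rho0.
(* the loss of variance at the block start that turns the factor 1 - eta into
   1 - eta / 2 *)
pose q := ((1 - eta) / (1 - eta / 2)) ^+ 2.
have e2 : 0 < 1 - eta / 2 by lra.
have qlt : q < 1.
  rewrite /q expr_lt1//; first by rewrite ltr_pdivrMr//; lra.
  by rewrite divr_ge0 ?(ltW e2)//; lra.
have qge : 1 / 4 <= q.
  have : 1 / 2 <= (1 - eta) / (1 - eta / 2) by rewrite ler_pdivlMr//; lra.
  rewrite /q; nra.
have q0 : 0 < q by lra.
have [r1 hr1] := block_variance_ge q0 qlt.
have [r2 hr2] := nn_infty N.
have [r3 hr3] := gcdf_lower_scale eta0 eta1.
have Kk0 : 0 <= K * (1 + kap ^+ 2) by nonneg.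
have [r4 hr4] := rate_block_small Kk0.
have [r5 _ hr5] := nbhs_infty_ger (4 / gpdf (0 : R)).
exists (maxn 2 (maxn r1 (maxn r2 (maxn r3 (maxn r4 r5))))) => r s.
rewrite !geq_max => /andP[rr2 /andP[/hr1 Vq /andP[/hr2 Nr /andP[/hr3 g1 /andP[/hr4 g2 /hr5 /= hr]]]]].
move=> sr Mk.
have r0' : (0 : R) < r%:R by rewrite ltr0n (leq_trans _ rr2).
pose L2 := Num.sqrt (2 * ln (r%:R : R)).
have L20 : 0 <= L2 by exact: sqrtr_ge0.
have L2sq : L2 ^+ 2 = 2 * ln (r%:R : R).
  by rewrite sqr_sqrtr// mulr_ge0// ln_nat_ge0.
(* the smoothed step is placed at y, between the level z and sqrt (2 log r) *)
pose z := (1 - eta / 2) * L2.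
pose y := (1 - eta ^+ 2 / 4) * L2.
have sV0 : 0 < Num.sqrt (V (nn r)) by rewrite sqrtr_gt0.
have hz : (1 - eta) * lil_scale rho r <= z * Num.sqrt (V (nn r)).
  rewrite -(@ler_pXn2r _ 2)// ?nnegrE; first last.
  - by rewrite /z !mulr_ge0 ?(ltW e2) ?(ltW sV0).
  - by rewrite mulr_ge0 ?sqrtr_ge0 ?subr_ge0//; lra.
  rewrite /z !exprMn lil_scale_sqr// L2sq sqr_sqrtr ?(ltW (V0 _))//.
  have qE : (1 - eta) ^+ 2 = q * (1 - eta / 2) ^+ 2.
    by rewrite /q -exprMn divfK// gt_eqF.
  rewrite qE; have W0 : 0 <= (1 - eta / 2) ^+ 2 * (2 * ln (r%:R : R)).
    by rewrite mulr_ge0 ?sqr_ge0// mulr_ge0 ?ln_nat_ge0.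
  by have := ler_wpM2l W0 Vq; lra.
apply: (@le_trans _ _ (Ev m (nn r.+1 - nn r)%N
  (fun s' => (z * Num.sqrt (V (size s)) < sg * (M s' - M s))%R%:R) s)); last first.
  apply: (Ev_le (wm_m1 model)) => u _; rewrite ler_nat sr.
  by case: ltP => //= h; rewrite (le_lt_trans hz h).
have Ns : (N <= size s)%N by rewrite sr.
apply: le_trans (hK sg y z s (nn r.+1 - nn r)%N sg2 Ns).
rewrite sr subnKC ?nn_le//.
set t := V (nn r.+1) / V (nn r).
have t4 : t <= 4 * rho.
  rewrite ler_pdivrMr//; apply: (le_trans (nnV r.+1)); rewrite exprS.
  have rr0 : 0 <= rho * rho ^+ r by rewrite mulr_ge0 ?exprn_ge0// ltW.
  have := ler_wpM2l rr0 qge; have := ler_wpM2l (ltW rho0) Vq; lra.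
have t0 : 0 < t by rewrite divr_gt0.
have y0 : 0 <= y by rewrite /y mulr_ge0// subr_ge0; nra.
have g1' : gpdf 0 / r%:R <= gcdf (- y / Num.sqrt (rho + 1)).
  apply: (le_trans g1); apply: gcdf_le.
  have s1 : 1 <= Num.sqrt (rho + 1).
    by rewrite -[X in X <= _]sqrtr1 ler_wsqrtr// lerDr ltW.
  rewrite -/L2 -/y mulNr lerN2 ler_pdivrMr ?(lt_le_trans ltr01)//.
  by rewrite ler_peMr.
have g3 : gcdf ((z - y) / Num.sqrt (rho + t)) <= r%:R^-1 * r%:R^-1.
  have v0 : 0 < rho + t by rewrite addr_gt0.
  have vE : rho + t <= eta ^+ 2 / 32 by lra.
  have := gcdf_upper_scale eta0 eta1 v0 vE rr2; apply: le_trans.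
  apply: gcdf_le; rewrite le_eqVlt; apply/orP; left; apply/eqP.
  have s0 : 0 < Num.sqrt (rho + t) by rewrite sqrtr_gt0.
  by rewrite -/L2 /z /y; field; rewrite gt_eqF.
have g2' : K * (1 + M s ^+ 2) * rate V del (nn r) <= gpdf 0 / 4 / r%:R.
  apply: le_trans g2; rewrite ler_wpM2r ?expR_ge0// ler_wpM2l// lerD2l.
  rewrite -(ger0_norm (sqr_ge0 (M s))) normrX ler_pXn2r ?nnegrE//.
  exact: le_trans Mk.
have g4 : (r%:R^-1 : R) * r%:R^-1 <= gpdf (0 : R) / 4 / r%:R.
  rewrite ler_pM2r ?invr_gt0//; move: hr; rewrite ler_pdivrMr// => hr.
  by rewrite -div1r ler_pdivrMr//; lra.
apply: le_trans (lerB (lerB g1' g2') (le_trans g3 g4)).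
have -> : gpdf 0 / r%:R - gpdf 0 / 4 / r%:R - gpdf 0 / 4 / r%:R = gpdf 0 / 4 / r%:R *+ 2 :> R.
  by rewrite mulr2n; field; rewrite gt_eqF.
by rewrite mulr2n lerDl !divr_ge0// ltW.
Qed.

(** Since M converges, almost every path stays below some bound kap. For
    each kap, the event that M stays below kap and that no block from a on
    has a large increment is contained in an intersection of block events of
    conditional probability at most 1 - const / r, whose probability is 0. *)
Lemma block_increment_io (sg eta : R) : sg ^+ 2 = 1 ->
  0 < eta -> eta <= 1 / 2 -> rho <= eta ^+ 2 / 160 ->
  {ae P, forall w, forall r0, exists2 r, (r0 <= r)%N &
    (1 - eta) * lil_scale rho r
      < sg * (M (hist (nn r.+1) w) - M (hist (nn r) w))}.
Proof.
move=> sg2 eta0 eta1 rhoE.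
pose B r w := (1 - eta) * lil_scale rho r
      < sg * (M (hist (nn r.+1) w) - M (hist (nn r) w)).
have p0 : 0 < gpdf (0 : R) by exact: gpdf_gt0.
have p1 : gpdf (0 : R) <= 1.
  by have := gpdf_le_exp (0 : R); rewrite expr0n/= oppr0 mul0r expR0.
have main (kap r0 : nat) : {ae P, forall w,
    (forall n, `|M (hist n w)| <= kap%:R) -> exists2 r, (r0 <= r)%N & B r w}.
  have [r1 hr1] := block_increment_prob kap%:R sg2 eta0 eta1 rhoE.
  pose a := maxn (maxn r0 r1) 1.
  have a1 : (0 < a)%N by rewrite leq_max leqnn orbT.
  have ar1 r : (a <= r)%N -> (r1 <= r)%N.
    by apply: leq_trans; rewrite !leq_max leqnn orbT.
  have ar0 r : (a <= r)%N -> (r0 <= r)%N.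
    by apply: leq_trans; rewrite !leq_max leqnn.
  pose k4 := gpdf (0 : R) / 4.
  have k40 : 0 < k4 by rewrite divr_gt0.
  have kr r : (a <= r)%N -> k4 / r%:R <= 1.
    move=> ar; have r1' : (1 : R) <= r%:R by rewrite ler1n (leq_trans a1).
    by rewrite ler_pdivrMr ?(lt_le_trans ltr01)// mul1r /k4; lra.
  pose q r : R := if (a <= r)%N then 1 - k4 / r%:R else 1.
  have q0 r : 0 <= q r.
    by rewrite /q; case: ifPn => // /kr; rewrite subr_ge0.
  (* the bound on M at the start of the block belongs to the block event, so
     that the conditional estimate applies to it *)
  pose F r s s' := (`|M s| <= kap%:R) &&
     ~~ ((1 - eta) * lil_scale rho r < sg * (M s' - M s)).
  pose G k s := all (fun r => F r (past (nn r) s) (past (nn r.+1) s)) (iota a k).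
  have Fq r s : (a <= r)%N -> size s = nn r ->
      Ev m (nn r.+1 - nn r)%N (fun s' => (F r s s')%:R) s <= q r.
    move=> ar sr; rewrite /q ar /F.
    have [Mk|Mk] := boolP (`|M s| <= kap%:R); last first.
      by rewrite /= (Ev_cst m 0) subr_ge0 kr.
    have := hr1 r s (ar1 _ ar) sr Mk.
    set E := (X in _ <= X); rewrite -/k4 => hE.
    have -> : Ev m (nn r.+1 - nn r)%N (fun s' => (true &&
        ~~ ((1 - eta) * lil_scale rho r < sg * (M s' - M s)))%:R) s = 1 - E.
      apply/eqP; rewrite eq_sym subr_eq eq_sym /E -EvD -[X in _ == X](Ev_cst m 1 (nn r.+1 - nn r)%N s).
      apply/eqP; apply: (Ev_ext (wm_m1 model)) => u _ /=.
      by case: (_ < _); rewrite ?addr0 ?add0r.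
    by rewrite lerD2l lerN2.
  have PG k : (P [set w | G k (hist (nn (a + k)%N) w)] <= (\prod_(a <= r < (a + k)%N) q r)%:E)%E.
    rewrite (wp_law proc) lee_fin.
    exact: (Ev_chain (wm_m1 model) k nn_le q0 Fq).
  have lim0 : \prod_(a <= r < (a + k)%N) q r @[k --> \oo] --> (0 : R).
    apply: (prod_harmonic k40 a1 q0) => r ar; by rewrite /q ar.
  pose Z := \bigcap_k [set w | G k (hist (nn (a + k)%N) w)].
  have mZ : measurable Z by apply: bigcap_measurable => // k _; exact: (wp_meas proc).
  have PZ : P Z = 0%E.
    apply/eqP; rewrite eq_le measure_ge0 andbT.
    apply/lee_addgt0Pr => e e0; rewrite add0e.
    move/cvgrPdist_lt/(_ _ e0): lim0 => [k _ /(_ k (leqnn _))] /=.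
    rewrite sub0r normrN => hk.
    apply: (@le_trans _ _ (P [set w | G k (hist (nn (a + k)%N) w)])).
      apply: le_measure; rewrite ?inE//; first exact: (wp_meas proc).
      by move=> w; apply.
    apply: (le_trans (PG k)); rewrite lee_fin; apply: ltW.
    exact: le_lt_trans (ler_norm _) hk.
  exists Z; split => // w /= /not_implyP[Mw noB] k _ /=.
  apply/allP => r; rewrite mem_iota => /andP[ar rk].
  have pE i : (i <= a + k)%N -> past (nn i) (hist (nn (a + k)%N) w) = hist (nn i) w.
    by move=> ik; rewrite -(subnKC (nn_le ik)) (hist_past proc).
  rewrite !pE//; last exact: ltnW.
  rewrite /F Mw/=; apply/negP => h; apply: noB; exists r => //; exact: ar0.
have : {ae P, forall w, forall kap r0 : nat,
    (forall n, `|M (hist n w)| <= kap%:R) -> exists2 r, (r0 <= r)%N & B r w}.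
  by apply: ae_foralln => kap; apply: ae_foralln => r0; exact: main.
apply: filterS2 cvg_L => w cw h r0.
have [K [_ hK]] := cvg_seq_bounded (cvgP _ cw).
have [kap _ hkap] := nbhs_infty_ger (K + 1).
apply: (h kap r0) => n; apply: (le_trans (hK (K + 1) _ n I)); first by rewrite ltrDl.
exact: (hkap kap (leqnn kap)).
Qed.

Lemma lil_scale_succ (delta : R) : 0 <= delta -> 2 * rho <= delta ^+ 2 ->
  forall r, (2 <= r)%N -> lil_scale rho r.+1 <= delta * lil_scale rho r.
Proof.
move=> delta0 hd r r2; have /andP[rho0 rho1] := rho01.
rewrite -(@ler_pXn2r _ 2)// ?nnegrE ?mulr_ge0 ?sqrtr_ge0//.
rewrite exprMn !lil_scale_sqr// exprS.
have r0' : (0 : R) < r%:R by rewrite ltr0n (leq_trans _ r2).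
have hl : ln (r.+1%:R : R) <= 2 * ln r%:R.
  rewrite mulr_natl -lnXn// ler_ln ?posrE ?ltr0n ?exprn_gt0//.
  rewrite -natrX ler_nat expnS expn1 (leq_trans (n := (r + r)%N))//.
    by rewrite -addn1 leq_add2l (leq_trans _ r2).
  by rewrite addnn -mul2n leq_mul2r r2 orbT.
have W : 0 <= 2 * rho * rho ^+ r by rewrite !mulr_ge0 ?exprn_ge0// ltW.
have W2 : 0 <= 2 * rho ^+ r * ln (r%:R : R) by rewrite !mulr_ge0 ?exprn_ge0 ?ln_nat_ge0// ltW.
have := ler_wpM2l W hl; have := ler_wpM2r W2 hd; lra.
Qed.

End blocks.

(** The tail L - M at n_r is the increment over the block plus the tail at
    n_(r+1). The latter is at most twice the scale of block r + 1, which is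
    a small fraction of the scale of block r because rho is small. *)
Lemma lil_lower_ae (sg eps : R) : sg ^+ 2 = 1 -> 0 < eps -> eps <= 1 ->
  {ae P, forall w, forall n0, exists2 n, (n0 <= n)%N &
    (1 - eps) * psi V n <= sg * (M (hist n w) - L w)}.
Proof.
move=> sg2 eps0 eps1; pose eta := eps / 4.
have eta0 : 0 < eta by rewrite /eta; lra.
have eta14 : eta <= 1 / 4 by rewrite /eta; lra.
have epsE : eps = 4 * eta by rewrite /eta; field.
(* so small that 5 rho <= eta^2 / 32, the variance at which the smoothing
   error is r^-2 *)
pose rho := eta ^+ 2 / 160.
have rho0 : 0 < rho by rewrite divr_gt0// exprn_gt0.
have rho18 : rho <= 1 / 8.
  by rewrite /rho; nra.
have rho01 : 0 < rho < 1 by rewrite rho0; lra.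
have [nn [nnV Vnn nn_le nn_infty cover]] := block_ex model rho01.
have msg2 : (- sg) ^+ 2 = 1 by rewrite sqrrN.
have eta1 : eta <= 1 / 2 by lra.
have h1 := block_start_ae proc model mL cvgP_L rho01 nnV nn_infty sg2 (ltr01 : 0 < 1 :> R).
have h2 := block_increment_io rho01 nnV Vnn nn_le nn_infty msg2 eta0 eta1 (lexx _).
have [r1 hr1] := psi_le_scale model rho01 eta0.
have [r2 hr2] := block_variance_ge Vnn nn_infty rho0 (proj2 (andP rho01)).
apply: filterS2 h1 h2 => w [r3 h3] h2 n0.
have [r4 hr4] := nn_infty n0.
have [r] := h2 (maxn (maxn (maxn r1 r2) (maxn r3 r4)) 2).
rewrite !geq_max => /andP[/andP[/andP[rr1 rr2] /andP[rr3 rr4]] rr] hB.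
exists (nn r); first exact: hr4.
have g3 := h3 r.+1 (leqW rr3).
have x0 : 0 <= lil_scale rho r by exact: sqrtr_ge0.
have xS : lil_scale rho r.+1 <= eta / 2 * lil_scale rho r.
  apply: lil_scale_succ => //; first by rewrite divr_ge0// ltW.
  by rewrite /rho; have := sqr_ge0 eta; lra.
have hpsi : psi V (nn r) <= (1 + eta) * lil_scale rho r.
  by apply: hr1 => //; rewrite nnV andbT exprS; exact: hr2.
have eps1' : 0 <= 1 - eps by lra.
have := ler_wpM2l eps1' hpsi => hp; apply: (le_trans hp).
have h5 : (1 - eps) * ((1 + eta) * lil_scale rho r) <= (1 - 2 * eta) * lil_scale rho r.
  by rewrite mulrA ler_wpM2r// epsE; have := sqr_ge0 eta; lra.
apply: (le_trans h5); lra.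
Qed.

Lemma psi_gt0 : exists n0, forall n, (n0 <= n)%N -> 0 < psi V n.
Proof.
have [n0 h] := walk_V_lt model (expR_gt0 (- 1 : R)).
exists n0 => n /h hV; rewrite sqrtr_gt0 mulr_gt0 ?mulr_gt0//.
have : ln (V n) < -1 by rewrite -[X in _ < X]expRK ltr_ln ?posrE ?expR_gt0.
move=> hl; rewrite ln_gt0// -normrN gtr0_norm; lra.
Qed.

Lemma process_lil (sg : R) : sg ^+ 2 = 1 ->
  {ae P, forall w, limn_esup (fun n =>
    (sg * ((M (hist n w) - L w) / psi V n))%:E) = 1%E}.
Proof.
move=> sg2; have [n1 hn1] := psi_gt0.
have e1 (k : nat) : 0 < (k.+1%:R^-1 : R) by rewrite invr_gt0 ltr0n.
have e2 (k : nat) : (k.+1%:R^-1 : R) <= 1 by rewrite invf_le1 ?ltr0n// ler1n.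
have hU : {ae P, forall w (k : nat), exists n0, forall n, (n0 <= n)%N ->
    sg * (M (hist n w) - L w) <= (1 + k.+1%:R^-1) * psi V n}.
  by apply: ae_foralln => k; exact: (lil_upper_ae proc model mL cvgP_L).
have hL : {ae P, forall w (k : nat), forall n0, exists2 n, (n0 <= n)%N &
    (1 - k.+1%:R^-1) * psi V n <= sg * (M (hist n w) - L w)}.
  by apply: ae_foralln => k; exact: lil_lower_ae.
apply: filterS2 hU hL => w hU hL; apply: limn_esup_eq1.
  move=> k; have [n0 h] := hU k; exists (maxn n0 n1) => n.
  by rewrite geq_max => /andP[/h hn /hn1 p0]; rewrite mulrA ler_pdivrMr.
move=> k n0; have [n] := hL k (maxn n0 n1).
rewrite geq_max => /andP[nn0 /hn1 p0] hn; exists n => //.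
by rewrite mulrA ler_pdivlMr.
Qed.

End lil_lower.

(** * Norming sequence and remaining variance *)

Section limits.
Context {R : realType}.
Implicit Types (u : nat -> R) (y : R).

Lemma limn_inf_gt u y : bounded_fun u -> y < limn_inf u ->
  exists n0, forall n, (n0 <= n)%N -> y < u n.
Proof.
move=> bu; rewrite limn_infE// => hy.
have [|x [n0 _ <-] yx] := @sup_gt R (range (infs u)) y _ hy.
  by exists (infs u 0%N), 0%N.
exists n0 => n nn; apply: (lt_le_trans yx); apply: ge_inf.
  by apply: has_lbound_sdrop; exact: bounded_fun_has_lbound.
by exists n.
Qed.

Lemma limn_sup_lt u y : bounded_fun u -> limn_sup u < y ->
  exists n0, forall n, (n0 <= n)%N -> u n < y.
Proof.
move=> bu; rewrite limn_supE// => hy.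
have [|x [n0 _ <-] yx] := @inf_lt R (range (sups u)) y _ hy.
  by exists (sups u 0%N), 0%N.
exists n0 => n nn; apply: le_lt_trans yx; apply: ub_le_sup.
  by apply: has_ubound_sdrop; exact: bounded_fun_has_ubound.
by exists n.
Qed.

End limits.

Section raabe.
Context {R : realType}.
Variables (kappa a mu : nat -> R) (eps d0 d1 : R) (N0 : nat).
Hypothesis a0 : a 0%N = 1.
Hypothesis aS : forall n, a n.+1 = a n * (1 + kappa n / n%:R).
Hypothesis kappa01 : forall n, 0 <= kappa n <= 1.
Hypothesis mu1 : forall n, mu n ^+ 2 <= 1.
Hypotheses (eps0 : 0 < eps) (d00 : 0 < d0) (d10 : 0 < d1) (N00 : (0 < N0)%N).
Hypothesis kappa_ge : forall n, (N0 <= n)%N -> 1 / 2 + eps <= kappa n.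
Hypothesis kappa_le : forall n, (N0 <= n)%N -> kappa n <= 1 - d0.
Hypothesis mu_le : forall n, (N0 <= n)%N -> mu n ^+ 2 <= 1 - d1.

Let U n := (a n ^+ 2)^-1.
Let A n := \sum_(0 <= k < n) (1 - mu k ^+ 2) * U k.+1.
Let V n := limn A - A n.

(** The factor with n = 0 is 1, since division by 0 gives 0; the recursion
    for a therefore holds from n = 0 on. *)
Lemma norming_gt0 n : 0 < a n.
Proof.
elim: n => [|n IH]; first by rewrite a0.
rewrite aS mulr_gt0// ltr_wpDr// divr_ge0//.
by case/andP: (kappa01 n).
Qed.

Lemma norming_le n k : (n <= k)%N -> a n <= a k.
Proof.
move: n k; apply/nondecreasing_seqP => n.
rewrite aS ler_peMr ?(ltW (norming_gt0 n))// lerDl divr_ge0//.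
by case/andP: (kappa01 n).
Qed.

Let U_gt0 n : 0 < U n. Proof. by rewrite invr_gt0 exprn_gt0// norming_gt0. Qed.

Let U_le n k : (n <= k)%N -> U k <= U n.
Proof.
move=> nk; rewrite lef_pV2 ?posrE ?exprn_gt0 ?norming_gt0//.
by rewrite ler_pXn2r ?nnegrE ?(ltW (norming_gt0 _))// norming_le.
Qed.

(** Each factor 1 + kappa / n is at most (n + 1) / n. *)
Lemma norming_ratio_le n k : (0 < n <= k)%N -> a k / k%:R <= a n / n%:R.
Proof.
move=> /andP[n0 /subnKC <-]; elim: (k - n)%N => [|j IH]; first by rewrite addn0.
apply: le_trans IH; rewrite addnS aS; set i := (n + j)%N.
have i0 : (0 : R) < i%:R by rewrite ltr0n addn_gt0 n0.
have i1 : (0 : R) < i.+1%:R by rewrite ltr0n.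
rewrite ler_pdivrMr// mulrAC -mulrA ler_pM2l ?norming_gt0//.
have -> : i.+1%:R / i%:R = 1 + 1 / i%:R :> R.
  by rewrite -natr1; field; rewrite gt_eqF.
by rewrite lerD2l ler_pM2r ?invr_gt0//; case/andP: (kappa01 i).
Qed.

Lemma norming_1 : a 1%N = 1.
Proof. by rewrite aS a0 invr0 mulr0 addr0 mulr1. Qed.

Lemma norming_le_id n : (0 < n)%N -> a n <= n%:R.
Proof.
move=> n0; have := @norming_ratio_le 1 n n0; rewrite norming_1 divr1.
by rewrite ler_pdivrMr ?ltr0n// mul1r.
Qed.

(** Expanding the square, n (1 + kappa / n)^2 is at least n + 2 kappa, and 2
    kappa exceeds 1 by at least 2 eps. *)
Lemma norming_raabe_step n : (N0 <= n)%N ->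
  2 * eps * U n.+1 <= n%:R * U n - n.+1%:R * U n.+1.
Proof.
move=> Nn; have n0 : (0 : R) < n%:R by rewrite ltr0n (leq_trans N00).
have k0 := kappa_ge Nn.
have kp : 0 < 1 + kappa n / n%:R by rewrite ltr_pwDl// divr_ge0//; have := eps0; lra.
have -> : U n = U n.+1 * (1 + kappa n / n%:R) ^+ 2.
  by rewrite /U aS exprMn [(a n ^+ 2 * _)^-1]invfM divfK// gt_eqF// exprn_gt0.
have h : n.+1%:R + 2 * eps <= n%:R * (1 + kappa n / n%:R) ^+ 2.
  have -> : n%:R * (1 + kappa n / n%:R) ^+ 2 = n%:R + 2 * kappa n + kappa n ^+ 2 / n%:R.
    by field; rewrite gt_eqF.
  have : 0 <= kappa n ^+ 2 / n%:R by rewrite divr_ge0 ?sqr_ge0.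
  by rewrite -natr1; lra.
have := ler_wpM2l (ltW (U_gt0 n.+1)) h; lra.
Qed.

Lemma sum_U_le n : \sum_(N0 <= k < n) U k.+1 <= N0%:R * U N0 / (2 * eps).
Proof.
have e2 : 0 < 2 * eps by rewrite mulr_gt0.
have [nN|Nn] := leqP n N0.
  by rewrite big_geq// divr_ge0 ?mulr_ge0 ?(ltW (U_gt0 _))// ltW.
rewrite ler_pdivlMr// mulrC mulr_sumr.
apply: (@le_trans _ _ (\sum_(N0 <= k < n) ((- (k.+1%:R * U k.+1)) - (- (k%:R * U k))))).
  rewrite !big_nat; apply: ler_sum => k /andP[Nk _].
  by rewrite opprK addrC; exact: norming_raabe_step.
rewrite telescope_sumr; last exact: ltnW.
by rewrite opprK gerDr oppr_le0 mulr_ge0// ltW.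
Qed.

Let term_ge0 k : 0 <= (1 - mu k ^+ 2) * U k.+1.
Proof. by rewrite mulr_ge0 ?subr_ge0// ltW. Qed.

Let A_le n k : (n <= k)%N -> A n <= A k.
Proof.
move: n k; apply/nondecreasing_seqP => n.
by rewrite /A big_nat_recr//= lerDl.
Qed.

Lemma variance_sum_cvg : cvgn A.
Proof.
apply: (@nondecreasing_is_cvgn _ A) => //.
exists (A N0 + N0%:R * U N0 / (2 * eps)) => _ [n _ <-].
have e2 : 0 < 2 * eps by rewrite mulr_gt0.
have B0 : 0 <= N0%:R * U N0 / (2 * eps).
  by rewrite divr_ge0 ?mulr_ge0 ?(ltW (U_gt0 _))// ltW.
have [nN|Nn] := leqP n N0; first by rewrite (le_trans (A_le nN))// lerDl.
rewrite /A (big_cat_nat (n := N0))//=; last exact: ltnW.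
rewrite lerD2l; apply: le_trans (sum_U_le n).
rewrite !big_nat; apply: ler_sum => k _.
by rewrite ler_piMl ?(ltW (U_gt0 _))// gerBl sqr_ge0.
Qed.

Lemma remainder_diff n : V n - V n.+1 = (1 - mu n ^+ 2) * U n.+1.
Proof. by rewrite /V /A big_nat_recr//=; ring. Qed.

Lemma remainder_cvg0 : V n @[n --> \oo] --> (0 : R).
Proof.
by rewrite -(subrr (limn A)); apply: cvgB; [exact: cvg_cst|exact: variance_sum_cvg].
Qed.

Lemma remainder_ge0 n : 0 <= V n.
Proof.
by rewrite subr_ge0; apply: (@nondecreasing_cvgn_le _ A) => //; exact: variance_sum_cvg.
Qed.

Lemma remainder_diff_ge n : (N0 <= n)%N -> d1 * U n.+1 <= V n - V n.+1.
Proof.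
move=> Nn; rewrite remainder_diff ler_pM2r//; have := mu_le Nn; lra.
Qed.

Lemma remainder_le n k : (n <= k)%N -> V k <= V n.
Proof. by move=> nk; rewrite lerD2l lerN2 A_le. Qed.

Lemma remainder_gt0 n : 0 < V n.
Proof.
apply: (@lt_le_trans _ _ (V (maxn n N0))); last by apply: remainder_le; rewrite leq_maxl.
have := remainder_diff_ge (leq_maxr n N0); have := remainder_ge0 (maxn n N0).+1.
have : 0 < d1 * U (maxn n N0).+1 by rewrite mulr_gt0.
lra.
Qed.

(** Between n and 2 n the sequence a at most doubles, so n terms of size at
    least d1 a_n^-2 / 4 are still to come. *)
Lemma remainder_lower n : (N0 <= n)%N -> d1 / 4 * (n%:R * U n) <= V n.
Proof.
move=> Nn; have n0 : (0 < n)%N by rewrite (leq_trans N00).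
have nR : (0 : R) < n%:R by rewrite ltr0n.
have U2 : U n / 4 <= U (n + n)%N.
  have := @norming_ratio_le n (n + n)%N; rewrite n0 leq_addr => /(_ isT).
  rewrite ler_pdivrMr ?ltr0n ?addn_gt0 ?n0// natrD -mulrA.
  have -> : n%:R^-1 * (n%:R + n%:R) = 2 :> R by field; rewrite gt_eqF.
  move=> h; rewrite /U -invfM lef_pV2 ?posrE ?mulr_gt0 ?exprn_gt0 ?norming_gt0//.
  have : a (n + n)%N ^+ 2 <= (a n * 2) ^+ 2.
    by rewrite ler_pXn2r ?nnegrE ?mulr_ge0 ?(ltW (norming_gt0 _)).
  by rewrite exprMn (_ : 2 ^+ 2 = 4 :> R)// -natrX.
have key j : d1 * (j%:R * U (n + n)%N) <= V n - V (n + j)%N \/ (n < j)%N.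
  elim: j => [|j [IH|?]]; [by left; rewrite addn0 subrr mul0r mulr0| |by right; rewrite ltnW].
  have [jn|jn] := leqP n j; first by right.
  left; have Nj : (N0 <= n + j)%N by rewrite (leq_trans Nn)// leq_addr.
  have := remainder_diff_ge Nj; rewrite addnS.
  have : d1 * U (n + n)%N <= d1 * U (n + j).+1.
    by rewrite ler_pM2l// U_le// -addnS leq_add2l.
  by rewrite -natr1; lra.
have [h|] := key n; last by rewrite ltnn.
have := remainder_ge0 (n + n)%N.
have : d1 * (n%:R * (U n / 4)) <= d1 * (n%:R * U (n + n)%N) by rewrite !ler_pM2l.
lra.
Qed.

(** Because a_n <= n, powers of 1 / n are bounded by powers of the remaining
    variance; this is what makes the latter the natural scale of all error
    terms. *)
Lemma inv_le_remainder n : (N0 <= n)%N -> n%:R^-1 <= 4 / d1 * V n.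
Proof.
move=> Nn; have n0 : (0 < n)%N by rewrite (leq_trans N00).
have nR : (0 : R) < n%:R by rewrite ltr0n.
have h : (n%:R ^+ 2)^-1 <= U n.
  rewrite lef_pV2 ?posrE ?exprn_gt0 ?norming_gt0//.
  by rewrite ler_pXn2r ?nnegrE ?(ltW (norming_gt0 _))// norming_le_id.
have B0 : 0 < 4 / d1 by rewrite divr_gt0.
have hV := remainder_lower Nn.
apply: (@le_trans _ _ (4 / d1 * (d1 / 4 * (n%:R * U n)))); last by rewrite ler_pM2l.
have -> : 4 / d1 * (d1 / 4 * (n%:R * U n)) = n%:R * U n by field; rewrite gt_eqF.
have -> : n%:R^-1 = n%:R * (n%:R ^+ 2)^-1 :> R by field; rewrite gt_eqF.
by rewrite ler_pM2l.
Qed.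

(** As kappa <= 1 - d0, each step multiplies a_n / n by at most 1 - d0 / (n
    + 1), and the product of these factors is of order n^-d0. *)
Lemma norming_ratio_decay : exists2 K : R, 0 < K & forall n, (N0 <= n)%N ->
  a n / n%:R <= K * expR (- (d0 * ln (n%:R : R))).
Proof.
(* the shift from n to n + 1 in the power matches the denominator in the bound
   on one step *)
pose G n := a n / n%:R * expR (d0 * ln (n.+1%:R : R)).
have G_le n : (N0 <= n)%N -> G n <= G N0.
  move=> /subnKC <-; elim: (n - N0)%N => [|j IH]; first by rewrite addn0.
  apply: le_trans IH; rewrite addnS; set i := (N0 + j)%N.
  have Ni : (N0 <= i)%N by rewrite leq_addr.
  have i0 : (0 : R) < i%:R by rewrite ltr0n (leq_trans N00).
  have i1 : (0 : R) < i.+1%:R by rewrite ltr0n.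
  have i2 : (0 : R) < i.+2%:R by rewrite ltr0n.
  have h1 : a i.+1 / i.+1%:R <= a i / i%:R * expR (- (d0 / i.+1%:R)).
    have -> : a i.+1 / i.+1%:R = a i / i%:R * ((i%:R + kappa i) / i.+1%:R).
      by rewrite aS; field; rewrite !gt_eqF.
    rewrite ler_pM2l ?divr_gt0 ?norming_gt0//; apply: le_trans (expR_ge1Dx _).
    rewrite ler_pdivrMr// mulrDl mulNr divfK ?gt_eqF// mul1r -natr1.
    have := kappa_le Ni; lra.
  have h2 : ln (i.+2%:R : R) - ln i.+1%:R <= i.+1%:R^-1.
    have := ln_le_sub1 (divr_gt0 i2 i1); rewrite ln_div ?posrE// -[i.+2%:R]natr1.
    have -> : (i.+1%:R + 1) / i.+1%:R - 1 = i.+1%:R^-1 :> R by field; rewrite gt_eqF.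
    by [].
  apply: (le_trans (ler_wpM2r (expR_ge0 _) h1)).
  rewrite /G -[X in X <= _]mulrA -[expR (- _) * expR _]expRD.
  rewrite ler_pM2l ?divr_gt0 ?norming_gt0// ler_expR.
  by move: (ler_wpM2l (ltW d00) h2); set z := i.+1%:R^-1; lra.
have NR : (0 : R) < N0%:R by rewrite ltr0n.
exists (G N0); first by rewrite mulr_gt0 ?expR_gt0// divr_gt0 ?norming_gt0.
move=> n Nn; have nR : (0 : R) < n%:R by rewrite ltr0n (leq_trans N00).
apply: (@le_trans _ _ (G N0 * expR (- (d0 * ln (n.+1%:R : R))))).
  by rewrite expRN -ler_pdivrMr ?invr_gt0 ?expR_gt0// invrK; exact: G_le.
rewrite ler_pM2l; last by rewrite mulr_gt0 ?expR_gt0// divr_gt0 ?norming_gt0.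
by rewrite ler_expR lerN2 ler_pM2l// ler_ln ?posrE ?ltr0Sn// ler_nat.
Qed.

(** The three bounds required of a martingale on the tree of histories with
    weights 1 / a_(n+1). *)
Lemma norming_rates : exists C del N,
  [/\ 1 <= C, 0 < del, (N0 <= N)%N & V N <= 1] /\
  [/\ forall n, (N <= n)%N -> U n.+1 <= C * (V n - V n.+1),
      forall n k, (N <= n <= k)%N -> U k.+1 <= C * V n * rate V del n ^+ 2 &
      forall n k, (N <= n <= k)%N -> a k / k%:R <= C * rate V del n].
Proof.
have [K K0 hK] := norming_ratio_decay.
(* the weight of one step relative to V_n is of order 1 / n <= B V_n, which
   bounds the square of the rate only if del <= 1/2 *)
pose del := Num.min d0 (1 / 2).
have del0 : 0 < del by rewrite /del lt_min d00/=; lra.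
pose B := 4 / d1; have B0 : 0 < B by rewrite divr_gt0.
pose KE := K * expR (d0 * ln B).
have KE0 : 0 < KE by rewrite mulr_gt0 ?expR_gt0.
pose C := 1 + d1^-1 + B ^+ 2 + KE.
have di0 : 0 < d1^-1 by rewrite invr_gt0.
have B20 : 0 < B ^+ 2 by rewrite exprn_gt0.
have [N1 hN1] : exists N1, forall n, (N1 <= n)%N -> V n <= 1.
  have /cvgrPdist_lt/(_ _ (@ltr01 R)) [n0 _ h] := remainder_cvg0.
  exists n0 => n /h /=; rewrite sub0r normrN ger0_norm ?remainder_ge0//; exact: ltW.
exists C, del, (maxn N0 N1); split; split.
- by rewrite /C; lra.
- by [].
- exact: leq_maxl.
- by apply: hN1; exact: leq_maxr.
- move=> n; rewrite geq_max => /andP[Nn _].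
  have := remainder_diff_ge Nn; have := U_gt0 n.+1 => U0 h.
  have d : 0 <= V n - V n.+1 by apply: le_trans h; rewrite mulr_ge0 ?ltW.
  apply: (@le_trans _ _ (d1^-1 * (V n - V n.+1))).
    by rewrite ler_pdivlMl.
  by rewrite ler_wpM2r// /C; lra.
- move=> n k; rewrite geq_max => /andP[/andP[Nn N1n] nk].
  have nR : (0 : R) < n%:R by rewrite ltr0n (leq_trans N00).
  have V0 := remainder_gt0 n.
  have W : V n <= rate V del n ^+ 2.
    rewrite /rate expr2 -expRD -[X in X <= _]lnK ?posrE// ler_expR.
    have : ln (V n) <= 0 by rewrite ln_le0// hN1.
    have : del <= 1 / 2 by rewrite /del ge_min lexx orbT.
    nra.
  have hV := remainder_lower Nn.
  have n1 : n%:R^-1 <= B * V n by exact: inv_le_remainder.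
  have Un : U n <= B * V n * n%:R^-1.
    have E : B * (d1 / 4 * (n%:R * U n)) = U n * n%:R.
      by rewrite /B; field; rewrite gt_eqF.
    by rewrite ler_pdivlMr// -E ler_pM2l.
  apply: (le_trans (U_le (leqW nk))); apply: (le_trans Un).
  apply: (@le_trans _ _ (B * V n * (B * rate V del n ^+ 2))).
    rewrite ler_pM2l ?mulr_gt0//; apply: (le_trans n1).
    by rewrite ler_pM2l.
  have Vw : 0 <= V n * rate V del n ^+ 2 by rewrite mulr_ge0 ?sqr_ge0// ltW.
  have BC : B ^+ 2 <= C by rewrite /C; lra.
  have := ler_wpM2r Vw BC; lra.
- move=> n k; rewrite geq_max => /andP[/andP[Nn N1n] nk].
  have n0 : (0 < n)%N by rewrite (leq_trans N00).
  have nR : (0 : R) < n%:R by rewrite ltr0n.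
  have V0 := remainder_gt0 n.
  apply: (@le_trans _ _ (a n / n%:R)); first by apply: norming_ratio_le; rewrite n0.
  apply: (le_trans (hK n Nn)).
  have hV := remainder_lower Nn.
  have n1 : n%:R^-1 <= B * V n by exact: inv_le_remainder.
  have lnV0 : ln (V n) <= 0 by rewrite ln_le0// hN1.
  have : - ln (n%:R : R) <= ln B + ln (V n).
    rewrite -lnM ?posrE// -lnV ?posrE//.
    by rewrite ler_ln ?posrE ?invr_gt0 ?mulr_gt0.
  move=> /(ler_wpM2l (ltW d00)) hl.
  have hd : d0 * ln (V n) <= del * ln (V n).
    by apply: ler_wnM2r => //; rewrite /del ge_min lexx.
  apply: (@le_trans _ _ (KE * rate V del n)).
    rewrite /KE -mulrA ler_pM2l// /rate -expRD ler_expR.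
    lra.
  by rewrite ler_wpM2r ?expR_ge0// /C; lra.
Qed.

End raabe.

(** * The law of the history of the walk *)

Section signs.
Context d (T : measurableType d) (R : realType) (P : probability T R).

Lemma sigma_algebra_setU (G : set (set T)) A B :
  sigma_algebra setT G -> G A -> G B -> G (A `|` B).
Proof.
move=> [G0 _ GU] GA GB; rewrite -bigcup2E; apply: GU => -[|[|n]] //=.
Qed.

Lemma sigma_algebra_setC (G : set (set T)) A :
  sigma_algebra setT G -> G A -> G (~` A).
Proof. by move=> [_ GC _] GA; rewrite -setTD; exact: GC. Qed.

Lemma sigma_algebra_setI (G : set (set T)) A B :
  sigma_algebra setT G -> G A -> G B -> G (A `&` B).
Proof.
move=> sG GA GB; rewrite -[A `&` B]setCK setCI; apply: sigma_algebra_setC => //.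
by apply: sigma_algebra_setU => //; exact: sigma_algebra_setC.
Qed.

(** The integral of a sign determines the probabilities of its two values;
    this turns the conditional means of the walk into transition
    probabilities. *)
Lemma integral_sign (X : T -> R) (A : set T) : measurable_fun setT X ->
  (forall w, X w = -1 \/ X w = 1) -> measurable A ->
  (\int[P]_(w in A) (X w)%:E =
   (fine (P (A `&` [set w | X w = 1])) - fine (P (A `&` ~` [set w | X w = 1])))%:E)%E.
Proof.
move=> mX X1 mA; set E := [set w | X w = 1].
have mE : measurable E.
  by have := mX measurableT [set 1] (measurable_set1 _); rewrite setTI.
have mAE : measurable (A `&` E) by exact: measurableI.
have mAC : measurable (A `&` ~` E) by apply: measurableI => //; exact: measurableC.
have AE : A = (A `&` E) `|` (A `&` ~` E) by rewrite -setIUr setUv setIT.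
rewrite {1}AE integral_setU//; first last.
- rewrite disj_set2E; apply/eqP/seteqP; split => w //=.
  by move=> [[_ h] [_]]; exact.
- apply: (measurable_funS measurableT (@subsetT _ _)).
  exact/measurable_realfun.measurable_EFinP.
rewrite (eq_integral (cst 1%E)); last first.
  by move=> w; rewrite inE => -[_ /= ->].
rewrite integral_cst// mul1e (eq_integral (cst (-1)%:E)); last first.
  move=> w; rewrite inE => -[_ /= h]; by case: (X1 w) => [->|].
rewrite integral_cst// EFinB !fineK ?fin_num_measure// EFinN mulN1e//.
Qed.

End signs.

Section law.
Context d (T : measurableType d) (R : realType) (P : probability T R).
Variables (p q : R) (alpha beta : nat -> R) (S : nat -> {RV P >-> R}).
Hypothesis derw : is_derw P p q alpha beta S.
Implicit Types (s u : seq bool) (w : T) (A : pred (seq bool)).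

Definition memory n : R := alpha n.+1 * (2 * p - 1).

(** The first step has its own mean, which is recorded as the value at 0;
    there the memory term vanishes because it is divided by 0. *)
Definition drift n : R :=
  if n is 0 then alpha 1%N * (2 * q - 1) + (1 - alpha 1%N) * (2 * beta 1%N - 1)
  else (1 - alpha n.+1) * (2 * beta n.+1 - 1).

Definition position s : R := \sum_(b <- s) sgb b.

(** The right-hand side of the defining equations of the walk, as a function
    of the history. *)
Definition cond_mean s : R :=
  memory (size s) / (size s)%:R * position s + drift (size s).

Fixpoint history n w : seq bool :=
  if n is k.+1 then (incr S k.+1 w == 1) :: history k w else [::].

Lemma size_history n w : size (history n w) = n.
Proof. by elim: n => //= n ->. Qed.

Lemma history_incr n w : incr S n.+1 w = sgb (incr S n.+1 w == 1).
Proof.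
have [->|->] := derw_step derw w (ltn0Sn n); last by rewrite eqxx.
by rewrite /sgb ifF//; apply/eqP => /esym/eqP; rewrite -subr_eq0 opprK; rewrite gt_eqF.
Qed.

Lemma position_history n w : position (history n w) = S n w.
Proof.
elim: n => [|n IH]; first by rewrite /position big_nil (derw0 derw).
rewrite /position /= big_cons -/(position _) IH -history_incr /incr/= subrK//.
Qed.

Lemma measurable_incr n : measurable_fun setT (incr S n).
Proof. by apply: measurable_realfun.measurable_funB. Qed.

(** Every event about the first n signs is a Boolean combination of the
    events that a given step is +1. It is applied to the full sigma-algebra
    and to the one generated by the first n increments. *)
Lemma history_event (G : set (set T)) n : sigma_algebra setT G ->
  (forall k, (0 < k <= n)%N -> G [set w | incr S k w = 1]) ->
  forall A, G [set w | A (history n w)].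
Proof.
move=> sG; elim: n => [|n IH] GX A.
  have [A0|A0] := boolP (A [::]).
    rewrite (_ : [set w | _] = ~` set0); last by rewrite setC0; apply/seteqP; split.
    by apply: sigma_algebra_setC => //; case: sG.
  rewrite (_ : [set w | _] = set0); first by case: sG.
  by apply/seteqP; split => w //=; rewrite (negbTE A0).
have GX' : G [set w | incr S n.+1 w = 1] by apply: GX; rewrite leqnn.
have {}IH (B : pred (seq bool)) : G [set w | B (history n w)].
  by apply: IH => k /andP[k0 kn]; apply: GX; rewrite k0 leqW.
rewrite (_ : [set w | _] =
  ([set w | incr S n.+1 w = 1] `&` [set w | A (true :: history n w)]) `|`
  (~` [set w | incr S n.+1 w = 1] `&` [set w | A (false :: history n w)])).
  apply: sigma_algebra_setU => //; apply: sigma_algebra_setI => //.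
    exact: (IH (fun s => A (true :: s))).
  - exact: sigma_algebra_setC.
  - exact: (IH (fun s => A (false :: s))).
apply/seteqP; split => w /=.
  by have [h|/eqP h] := eqVneq (incr S n.+1 w) 1; [left|right].
by move=> [[/eqP -> //]|[/eqP/negbTE -> //]].
Qed.

Lemma measurable_step n : measurable [set w | incr S n w = 1].
Proof.
by have := @measurable_incr n measurableT [set 1] (measurable_set1 _); rewrite setTI.
Qed.

Lemma sigma_algebra_measurable_sets : sigma_algebra setT (@measurable d T).
Proof.
split; [exact: measurable0|by move=> A mA; apply: measurableD|].
by move=> F mF; exact: bigcupT_measurable.
Qed.

Lemma measurable_history n A : measurable [set w | A (history n w)].
Proof.
apply: history_event; first exact: sigma_algebra_measurable_sets.
by move=> k _; exact: measurable_step.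
Qed.

Lemma filtration_history n A : incr_filtration S n [set w | A (history n w)].
Proof.
apply: history_event; first exact: smallest_sigma_algebra.
move=> k /andP[k0 kn]; apply: sub_gen_smallest.
have kn' : (k.-1 < n)%N by rewrite prednK.
apply: (@bigsetU_sup _ k.-1 n (fun i => preimage_set_system setT (incr S i.+1) measurable)) => //.
exists [set 1]; first exact: measurable_set1.
by rewrite setTI prednK.
Qed.

(** The defining equation integrated over an atom of the natural filtration,
    on which the conditional mean is constant. *)
Lemma incr_mean_atom n u : size u = n ->
  (\int[P]_(w in [set w | history n w == u]) (incr S n.+1 w)%:E =
   (cond_mean u)%:E * P [set w | history n w == u])%E.
Proof.
move=> un; have mA : measurable [set w | history n w == u].
  exact: (measurable_history n (fun s => s == u)).
case: n un mA => [|n] un mA.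
  have -> : [set w | history 0 w == u] = setT.
    by move: un {mA} => /size0nil ->; apply/seteqP; split.
  rewrite probability_setT mule1.
  have := derw_mean1 derw; rewrite unlock => ->.
  by rewrite /cond_mean un invr0 mulr0 mul0r add0r.
have [_ _ /(_ [set w | history n.+1 w == u])] := derw_cond_mean derw (ltn0Sn n).
move=> /(_ (@filtration_history n.+1 (fun s => s == u))) ->.
rewrite (eq_integral (cst (cond_mean u)%:E)) ?integral_cst//.
move=> w; rewrite inE [X in X -> _]/mkset => /eqP hw; congr (_%:E).
by rewrite /cond_mean un -hw position_history.
Qed.

Lemma history_step n u b : size u = n ->
  fine (P [set w | history n.+1 w == b :: u]) =
  (1 + sgb b * cond_mean u) / 2 * fine (P [set w | history n w == u]).
Proof.
move=> un; set A := [set w | history n w == u].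
have mA : measurable A by exact: (measurable_history n (fun s => s == u)).
have X1 w : incr S n.+1 w = -1 \/ incr S n.+1 w = 1 by exact: (derw_step derw w (ltn0Sn n)).
set E := [set w | incr S n.+1 w = 1].
have mE : measurable E by exact: measurable_step.
have mAE : measurable (A `&` E) by exact: measurableI.
have mAC : measurable (A `&` ~` E) by apply: measurableI => //; exact: measurableC.
have := incr_mean_atom un; rewrite -/A (integral_sign P (measurable_incr _) X1 mA).
rewrite -/E -[P A]fineK ?fin_num_measure// -EFinM => -[h1].
have h2 : fine (P A) = fine (P (A `&` E)) + fine (P (A `&` ~` E)).
  rewrite -fineD ?fin_num_measure// -measureU//.
    by rewrite -setIUr setUv setIT.
  by apply/seteqP; split => w //= [[_ h] [_]]; exact.
case: b.
  rewrite (_ : [set w | _] = A `&` E); first by rewrite /sgb mul1r; lra.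
  apply/seteqP; split => w /=; rewrite /A /E /= eqseq_cons.
    by move=> /andP[/eqP h ->]; split => //; apply/eqP; rewrite h.
  by move=> [-> /eqP ->].
rewrite (_ : [set w | _] = A `&` ~` E); first by rewrite /sgb mulN1r; lra.
apply/seteqP; split => w /=; rewrite /A /E /= eqseq_cons.
  move=> /andP[/eqP h ->]; split => // /eqP; by rewrite h.
by move=> [-> /eqP/negbTE ->].
Qed.

Lemma past_history n k w : past n (history (n + k)%N w) = history n w.
Proof.
rewrite /past size_history addKn.
by elim: k => [|k IH]; rewrite ?addn0 ?drop0// addnS.
Qed.

(** The law of the continuation of a given history, by induction on the
    number of remaining steps; with the empty history it gives the law of
    the history itself. *)
Lemma history_law_from j k u A : size u = k ->
  fine (P [set w | (history k w == u) && A (history (k + j)%N w)]) =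
  fine (P [set w | history k w == u]) * Ev cond_mean j (fun s => (A s)%:R) u.
Proof.
elim: j k u => [|j IH] k u uk.
  rewrite addn0 /=; have [Au|Au] := boolP (A u).
    rewrite mulr1; congr (fine (P _)); apply/seteqP; split => w /=.
      by case/andP.
    by move=> /eqP ->; rewrite eqxx.
  rewrite mulr0 (_ : [set w | _] = set0) ?measure0//.
  apply/seteqP; split => w //= /andP[/eqP ->]; by rewrite (negbTE Au).
pose B b := [set w | (history k.+1 w == b :: u) && A (history (k.+1 + j)%N w)].
have mB b : measurable (B b).
  rewrite /B (_ : mkset _ =
    [set w | (past k.+1 (history (k.+1 + j) w) == b :: u) && A (history (k.+1 + j) w)]).
    exact: (measurable_history (k.+1 + j) (fun s => (past k.+1 s == b :: u) && A s)).
  by apply/seteqP; split => w /=; rewrite past_history.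
rewrite (_ : [set w | _] = B true `|` B false); last first.
  apply/seteqP; split => w; rewrite /B /= addnS !eqseq_cons.
    move=> /andP[-> ->]; rewrite !andbT.
    by case: (incr S k.+1 w == 1); [left|right].
  by move=> [|] /andP[/andP[_ ->]] ->.
rewrite measureU//; last first.
  apply/seteqP; split => w //=; rewrite /B /= !eqseq_cons.
  by move=> [/andP[/andP[/eqP -> _] _]].
rewrite fineD ?fin_num_measure// /B !IH; try by rewrite /= uk.
by rewrite !history_step// EvS /step /sgb; ring.
Qed.

Lemma history_process : walk_process P cond_mean history.
Proof.
split.
- exact: size_history.
- by [].
- exact: measurable_history.
move=> n A; have := history_law_from n A (erefl : size [::] = 0%N).
rewrite add0n /= (_ : [set w | true] = setT); last by apply/seteqP; split.
rewrite probability_setT mul1r => <-.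
by rewrite fineK// fin_num_measure//; exact: measurable_history.
Qed.

End law.

(** * The dynamic elephant random walk as a martingale on the tree *)

Section bounds.
Context {R : realType}.
Implicit Types (u : nat -> R).

Lemma unit_bounded u : (forall n, (0 < n)%N -> 0 <= u n <= 1) -> bounded_fun u.
Proof.
move=> u01; exists (1 + `|u 0%N|); split; first exact: num_real.
move=> B hB n _; apply: le_trans (ltW hB).
case: n => [|n]; first by rewrite lerDr.
have /andP[u0 u1] := u01 n.+1 isT.
by rewrite ger0_norm// (le_trans u1)// lerDl.
Qed.

Lemma affine_norm_le (k K x b B : R) : `|k| <= K -> `|x| <= 1 ->
  `|b| <= B -> `|k * x + b| <= K + B.
Proof.
move=> hk hx hb; apply: le_trans (ler_normD _ _) _; apply: lerD => //.
by rewrite normrM -[leRHS]mulr1 ler_pM.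
Qed.

End bounds.

Section second_moment.
Context d (T : measurableType d) (R : realType) (P : probability T R).

(** The Markov inequality for the square. *)
Lemma second_moment_tail (Y : T -> R) (delta e : R) : measurable_fun setT Y ->
  0 < delta -> ('E_P[fun w => (Y w ^+ 2)%R] <= (e * delta ^+ 2)%:E)%E ->
  (P [set w | (delta <= `|Y w|)%R] <= e%:E)%E.
Proof.
move=> mY delta0 hY.
pose X : {RV P >-> R} := HB.pack Y (isMeasurableFun.Build _ _ T R Y mY).
have d2 : 0 < delta ^+ 2 by rewrite exprn_gt0.
rewrite -(@lee_pmul2l _ (delta ^+ 2)%:E)//.
apply: (@le_trans _ _ 'E_P[(((fun x : R => x ^+ 2) \o Num.norm) \o X)%R]%E).
  apply: (@markov _ _ _ P X (fun x => x ^+ 2) delta delta0) => //.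
  - by move=> r _; exact: sqr_ge0.
  - by move=> x y; rewrite !nnegrE => x0 y0; rewrite ler_sqr.
rewrite -EFinM mulrC; apply: le_trans hY.
rewrite (_ : (_ \o _) = (fun w => (Y w ^+ 2)%R))//.
by apply/funext => w /=; rewrite real_normK// num_real.
Qed.

End second_moment.

Section walk.
Context d (T : measurableType d) (R : realType) (P : probability T R).
Variables (p q : R) (alpha beta : nat -> R) (S : nat -> {RV P >-> R}).
Hypothesis derw : is_derw P p q alpha beta S.
Hypotheses (p01 : 0 <= p <= 1) (q01 : 0 <= q <= 1).
Hypothesis alpha01 : forall n, (0 < n)%N -> 0 <= alpha n <= 1.
Hypothesis beta01 : forall n, (0 < n)%N -> 0 <= beta n <= 1.
Implicit Types (s : seq bool) (w : T).

Let kap := memory p alpha.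
Let off := drift q alpha beta.
Let m := cond_mean p q alpha beta.
Let hist := history S.
Let a := derw_a p alpha.

Definition mean n : R := fine ('E_P[S n])%E.

(** The mean of the step n + 1, expressed through the mean of the position
    at time n. *)
Definition mean_step n : R := kap n / n%:R * mean n + off n.

Lemma position_le s : `|position R s : R| <= (size s)%:R.
Proof.
elim: s => [|b s IH]; first by rewrite /position big_nil normr0.
rewrite /position big_cons -/(position R s) /= -nat1r.
apply: le_trans (ler_normD _ _) _; apply: lerD => //.
by rewrite /sgb; case: b; rewrite ?normrN normr1.
Qed.

Lemma walk_le n w : `|S n w| <= n%:R.
Proof.
by rewrite -(position_history derw) -[in leRHS](size_history S n w) position_le.
Qed.

Lemma walk_integrable n : P.-integrable setT (EFin \o S n).
Proof.
apply: measurable_bounded_integrable => //.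
  by rewrite [X in (X < _)%E]probability_setT ltry.
exists n%:R; split; first exact: num_real.
by move=> B /ltW hB w _; apply: le_trans hB; exact: walk_le.
Qed.

Lemma mean_le n : `|mean n| <= n%:R.
Proof.
rewrite /mean expectation.unlock.
have mS := walk_integrable n.
apply: le_trans (le_normr_Rintegral measurableT mS) _.
have -> : n%:R = \int[P]_(w in setT) (n%:R : R).
  by rewrite (Rintegral_cst P measurableT n%:R) [X in fine X]probability_setT mulr1.
apply: (le_Rintegral measurableT).
- exact: integrable_norm.
- by apply: finite_measure_integrable_cst.
- by move=> w _; exact: walk_le.
Qed.

Lemma mean0 : mean 0 = 0.
Proof.
have := mean_le 0; rewrite normr_le0 => /eqP //.
Qed.

Lemma mean_incr n : fine ('E_P[incr S n.+1])%E = mean_step n.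
Proof.
rewrite /mean_step; case: n => [|n].
  by rewrite (derw_mean1 derw) mean0 mulr0 add0r.
have [_ _ /(_ setT)] := derw_cond_mean derw (ltn0Sn n).
rewrite expectation.unlock => ->; last first.
  have := @filtration_history _ _ _ P S n.+1 predT.
  by congr (incr_filtration _ _ _); apply/seteqP; split.
have c1 (r : R) : P.-integrable setT (EFin \o cst r).
  exact: finite_measure_integrable_cst.
have mS := walk_integrable n.+1.
rewrite -/(Rintegral P setT _) RintegralD//; [|exact: (integrableZl measurableT _ mS)|exact: c1].
rewrite RintegralZl// Rintegral_cst// [X in fine X]probability_setT mulr1.
by rewrite /mean expectation.unlock.
Qed.

Lemma mean_succ n : mean n.+1 = mean n + mean_step n.
Proof.
rewrite -mean_incr /mean !expectation.unlock -!/(Rintegral P setT _) /incr/=.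
have m1 := walk_integrable n; have m2 := walk_integrable n.+1.
by rewrite RintegralB// addrC subrK.
Qed.

Lemma norming0 : a 0%N = 1.
Proof. by rewrite /a /derw_a big_geq. Qed.

Lemma normingS n : a n.+1 = a n * (1 + kap n / n%:R).
Proof.
rewrite /a /derw_a; case: n => [|n]; first by rewrite !big_geq// invr0 mulr0 addr0 mulr1.
by rewrite big_nat_recr//= /kap /memory [(2 * p - 1) * _]mulrC.
Qed.

Lemma derw_A2E n :
  derw_A2 P p alpha S n = \sum_(0 <= k < n) (1 - mean_step k ^+ 2) * (a k.+1 ^+ 2)^-1.
Proof.
rewrite /derw_A2 big_add1 /=; apply: eq_bigr => k _.
by rewrite mean_incr.
Qed.

Definition martingale s : R := (position R s - mean (size s)) / a (size s).

Lemma martingale_history n w : martingale (hist n w) = (S n w - mean n) / a n.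
Proof. by rewrite /martingale size_history (position_history derw). Qed.

Lemma memory_norm n : `|kap n| <= alpha n.+1.
Proof.
have /andP[a0 a1] := alpha01 (ltn0Sn n).
rewrite /kap /memory normrM ger0_norm// -[leRHS]mulr1 ler_wpM2l//.
by rewrite ler_norml; move: p01; lra.
Qed.

Lemma sign_mean_norm (x : R) : 0 <= x <= 1 -> `|2 * x - 1| <= 1.
Proof. by move=> x01; rewrite ler_norml; lra. Qed.

Lemma ratio_norm n (x : R) : `|x| <= n.+1%:R -> `|x / n.+1%:R| <= 1.
Proof.
by move=> hx; rewrite normrM normfV [`|n.+1%:R|]ger0_norm// ler_pdivrMr ?ltr0n// mul1r.
Qed.

Lemma affine_le1 n (x : R) : `|x| <= n%:R ->
  `|kap n / n%:R * x + off n| <= 1.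
Proof.
have /andP[a0 a1] := alpha01 (ltn0Sn n).
have hb := sign_mean_norm (beta01 (ltn0Sn n)).
case: n a0 a1 hb => [|n] a0 a1 hb hx.
  rewrite invr0 mulr0 mul0r add0r /off /drift.
  rewrite [leRHS](_ : 1 = alpha 1%N + (1 - alpha 1%N) * 1); last by ring.
  apply: affine_norm_le; [by rewrite ger0_norm|exact: sign_mean_norm|].
  by rewrite normrM ger0_norm ?subr_ge0// ler_wpM2l// subr_ge0.
rewrite [leRHS](_ : 1 = alpha n.+2 + (1 - alpha n.+2) * 1); last by ring.
rewrite -mulrA [_^-1 * _]mulrC; apply: affine_norm_le.
- exact: memory_norm.
- exact: ratio_norm.
- by rewrite /off /drift normrM ger0_norm ?subr_ge0// ler_wpM2l// subr_ge0.
Qed.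

Lemma cond_mean_le s : `|m s| <= 1.
Proof. exact/affine_le1/position_le. Qed.

Lemma mean_step_le n : `|mean_step n| <= 1.
Proof. exact/affine_le1/mean_le. Qed.

(** The mean of a step is a mixture of a memory term, at most |kappa|, and a
    sign of mean 2 beta - 1 drawn without memory; its square is at most its
    absolute value. *)
Lemma mean_step_sqr_le n (e : R) : (0 < n)%N ->
  `|2 * beta n.+1 - 1| <= e -> mean_step n ^+ 2 <= `|kap n| + (1 - alpha n.+1) * e.
Proof.
case: n => // n _ hb; have /andP[_ a1] := alpha01 (ltn0Sn n.+1).
apply: (@le_trans _ _ `|mean_step n.+1|).
  by rewrite -real_normK ?num_real// expr2 ler_piMr// mean_step_le.
rewrite /mean_step -mulrA [_^-1 * _]mulrC; apply: affine_norm_le => //.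
- exact/ratio_norm/mean_le.
- by rewrite /off /drift normrM ger0_norm ?subr_ge0// ler_wpM2l// subr_ge0.
Qed.

Lemma memory01 : 1 / 2 <= p -> forall n, 0 <= kap n <= 1.
Proof.
move=> p2 n; have /andP[a0 a1] := alpha01 (ltn0Sn n); rewrite /kap /memory.
have p21 : 0 <= 2 * p - 1 <= 1 by move: p01; lra.
by case/andP: p21 => h1 h2; rewrite mulr_ge0//= mulr_ile1.
Qed.

(** What the asymptotic analysis requires of the parameters: kappa_n lies
    eventually above 1/2 and below 1, and the means of the steps stay away
    from 1 and -1. *)
Definition regime (eps d0 d1 : R) N0 :=
  [/\ 0 < eps, 0 < d0, 0 < d1 & (0 < N0)%N] /\
  (forall n, (N0 <= n)%N ->
    [/\ 1 / 2 + eps <= kap n, kap n <= 1 - d0 & mean_step n ^+ 2 <= 1 - d1]).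

(** For p < 1 the memory term alone is bounded away from 1: kappa <= 2 p -
    1, and |mean| <= 1 - 2 alpha (1 - p). *)
Lemma regime_lt1 : 3 / 4 < p < 1 -> (4 * p - 2)^-1 < limn_inf alpha ->
  exists eps d0 d1 N0, regime eps d0 d1 N0.
Proof.
move=> /andP[p34 p1] ha; set l := limn_inf alpha in ha *.
have p4 : 0 < 4 * p - 2 by lra.
(* any number strictly between the threshold and the limit inferior *)
pose x := ((4 * p - 2)^-1 + l) / 2.
have x1 : (4 * p - 2)^-1 < x by rewrite /x; lra.
have x0 : 0 < x by apply: lt_trans x1; rewrite invr_gt0.
have x2 : 1 / 2 < x * (2 * p - 1).
  by move: x1; rewrite -[_^-1]mul1r ltr_pdivrMr//; lra.
have hx : x < l by rewrite /x; lra.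
have [n0 hn0] := limn_inf_gt (unit_bounded alpha01) hx.
exists (x * (2 * p - 1) - 1 / 2), (2 * (1 - p)), (2 * x * (1 - p)), n0.+1.
split.
  split => //; first by rewrite subr_gt0.
  - by rewrite mulr_gt0// subr_gt0.
  - by rewrite mulr_gt0 ?subr_gt0// mulr_gt0.
move=> n n0n; have n00 : (0 < n)%N by apply: leq_ltn_trans n0n.
have xa : x < alpha n.+1 by apply: hn0; rewrite leqW// ltnW.
have /andP[a0 a1] := alpha01 (ltn0Sn n).
have := mean_step_sqr_le n00 (sign_mean_norm (beta01 (ltn0Sn n))).
have p2 : 1 / 2 <= p by lra.
have /andP[k0 _] := memory01 p2 n; rewrite ger0_norm//.
rewrite /kap /memory => hm; split.
- rewrite addrC subrK ler_wpM2r//; last exact: ltW.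
  by lra.
- have -> : 1 - 2 * (1 - p) = 1 * (2 * p - 1) by ring.
  by rewrite ler_wpM2r//; lra.
apply: le_trans hm _; have -> : alpha n.+1 * (2 * p - 1) + (1 - alpha n.+1) * 1 =
  1 - 2 * alpha n.+1 * (1 - p) by ring.
by rewrite lerD2l lerN2 ler_wpM2r ?subr_ge0 ?(ltW p1)// ler_wpM2l// ltW.
Qed.

(** For p = 1 the memory term is alpha itself, so alpha must stay away from
    1 and the signs drawn without memory must be nondegenerate. The latter
    holds because the ratio that bounds the limit superior of beta is at
    most 1. *)
Lemma regime_eq1 : p = 1 -> (4 * p - 2)^-1 < limn_inf alpha ->
  limn_inf alpha <= limn_sup alpha < 1 -> 0 < limn_inf beta ->
  limn_inf beta <= limn_sup beta < (1 - limn_sup alpha) / (1 - limn_inf alpha) ->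
  exists eps d0 d1 N0, regime eps d0 d1 N0.
Proof.
move=> p1; set l := limn_inf alpha; set l' := limn_sup alpha.
set b := limn_inf beta; set b' := limn_sup beta.
have -> : (4 * p - 2)^-1 = 1 / 2 by rewrite p1 (_ : 4 * 1 - 2 = 2) ?mul1r//; lra.
move=> ha /andP[ll' l'1] b0 /andP[bb' hb'].
have b'1 : b' < 1.
  apply: lt_le_trans hb' _; rewrite ler_pdivrMr; lra.
pose x := (1 / 2 + l) / 2; pose x' := (1 + l') / 2.
pose y := b / 2; pose y' := (1 + b') / 2.
pose e := 2 * Num.min y (1 - y').
have hx : x < l by rewrite /x; lra.
have hx' : l' < x' by rewrite /x'; lra.
have hy : y < b by rewrite /y; lra.
have hy' : b' < y' by rewrite /y'; lra.
have e0 : 0 < e by rewrite /e mulr_gt0// lt_min /y /y'; apply/andP; split; lra.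
have [n0 hn0] := limn_inf_gt (unit_bounded alpha01) (hx : x < l).
have [n1 hn1] := limn_sup_lt (unit_bounded alpha01) (hx' : l' < x').
have [n2 hn2] := limn_inf_gt (unit_bounded beta01) (hy : y < b).
have [n3 hn3] := limn_sup_lt (unit_bounded beta01) (hy' : b' < y').
exists (x - 1 / 2), (1 - x'), ((1 - x') * e), (maxn (maxn n0 n1) (maxn n2 n3)).+1.
have x'1 : 0 < 1 - x' by rewrite /x'; lra.
split.
  split => //; first by rewrite /x; lra.
  by rewrite mulr_gt0.
move=> n; rewrite gtn_max !gtn_max => /andP[/andP[h0 h1] /andP[h2 h3]].
have {}h0 := hn0 n.+1 (leqW (ltnW h0)); have {}h1 := hn1 n.+1 (leqW (ltnW h1)).
have n00 : (0 < n)%N by apply: leq_ltn_trans h2.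
have {}h2 := hn2 n.+1 (leqW (ltnW h2)); have {}h3 := hn3 n.+1 (leqW (ltnW h3)).
have kapE : kap n = alpha n.+1 by rewrite /kap /memory p1; ring.
have hb : `|2 * beta n.+1 - 1| <= 1 - e.
  have e1 : e <= 2 * y by rewrite /e ler_pM2l// ge_min lexx.
  have e2 : e <= 2 * (1 - y') by rewrite /e ler_pM2l// ge_min lexx orbT.
  by rewrite ler_norml; lra.
have /andP[a0 a1] := alpha01 (ltn0Sn n).
have := mean_step_sqr_le n00 hb; rewrite kapE ger0_norm// => hm.
split; [lra|lra|].
apply: le_trans hm _; have -> : alpha n.+1 + (1 - alpha n.+1) * (1 - e) =
  1 - (1 - alpha n.+1) * e by ring.
by rewrite lerD2l lerN2 ler_wpM2r ?(ltW e0)//; lra.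
Qed.

Variables (eps d0 d1 : R) (N0 : nat).
Hypothesis kappa01 : forall n, 0 <= kap n <= 1.
Hypotheses (eps0 : 0 < eps) (d00 : 0 < d0) (d10 : 0 < d1) (N00 : (0 < N0)%N).
Hypothesis kappa_ge : forall n, (N0 <= n)%N -> 1 / 2 + eps <= kap n.
Hypothesis kappa_le : forall n, (N0 <= n)%N -> kap n <= 1 - d0.
Hypothesis mu_le : forall n, (N0 <= n)%N -> mean_step n ^+ 2 <= 1 - d1.

Let V n := derw_A2oo P p alpha S - derw_A2 P p alpha S n.

Lemma derw_a_gt0 n : 0 < a n.
Proof. by have := norming_gt0 norming0 normingS kappa01 n. Qed.

Lemma martingaleS b s : martingale (b :: s) =
  martingale s + (sgb b - m s) * (a (size s).+1)^-1.
Proof.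
rewrite /martingale /= mean_succ normingS.
set n := size s; rewrite /position big_cons -/(position R s) /m /cond_mean -/n.
rewrite -/kap -/off /mean_step -/(kap n) -/(off n).
have an : a n != 0 by rewrite gt_eqF// derw_a_gt0.
have hn : 1 + kap n / n%:R != 0.
  by have := derw_a_gt0 n.+1; rewrite normingS pmulr_rgt0 ?derw_a_gt0// => /gt_eqF ->.
set z := n%:R^-1 in hn *.
by field; rewrite an hn.
Qed.

(** The difference between the conditional mean and the mean of a step is
    kappa_k (a_k / k) times the martingale. *)
Lemma derw_walk_model : exists C del N,
  walk_model m martingale mean_step (fun n => (a n.+1)^-1) V C del N.
Proof.
have mu1 n : mean_step n ^+ 2 <= 1.
  by rewrite -real_normK ?num_real// expr_le1// mean_step_le.
have VE : V = fun n => limn (fun n => \sum_(0 <= k < n) (1 - mean_step k ^+ 2) * (a k.+1 ^+ 2)^-1)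
    - \sum_(0 <= k < n) (1 - mean_step k ^+ 2) * (a k.+1 ^+ 2)^-1.
  apply/funext => n; rewrite /V derw_A2E /derw_A2oo.
  by congr (limn _ - _); apply/funext => k; exact: derw_A2E.
have [C [del [N [[C1 del0 NN VN] [hc2 hcw hmw]]]]] :=
  norming_rates norming0 normingS kappa01 mu1 eps0 d00 d10 N00 kappa_ge kappa_le mu_le.
exists C, del, N; rewrite VE; split => //.
- exact: cond_mean_le.
- exact: mean_step_le.
- by rewrite /martingale /position big_nil mean0 subrr mul0r.
- exact: martingaleS.
- exact: (remainder_gt0 norming0 normingS kappa01 mu1 eps0 d10 N00 kappa_ge mu_le).
- by move=> n; rewrite (remainder_diff a mean_step n) exprVn.
- exact: (remainder_cvg0 norming0 normingS kappa01 mu1 eps0 N00 kappa_ge).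
- by move=> n Nn; rewrite exprVn; exact: hc2.
- by move=> n k nk; rewrite exprVn; exact: hcw.
- move=> n s ns; have := hmw _ _ ns; set k := size s => hk.
rewrite (_ : m s - mean_step k = kap k * (a k / k%:R) * martingale s); last first.
  rewrite /m /cond_mean /mean_step /martingale -/k -/(kap k) -/(off k).
  have ak : a k != 0 by rewrite gt_eqF// derw_a_gt0.
  by set z := k%:R^-1; field.
rewrite normrM [leRHS]mulrAC ler_wpM2r//.
have /andP[k0 k1] := kappa01 k.
have ak0 : 0 <= a k / k%:R by rewrite divr_ge0// ltW// derw_a_gt0.
by apply: le_trans hk; rewrite (ger0_norm (mulr_ge0 k0 ak0)) ler_piMl.
Qed.

Variable L : {RV P >-> R}.
Hypothesis cvg_as : {ae P, forall w, (S n w - mean n) / a n @[n --> \oo] --> L w}.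
Hypothesis cvg_L2 :
  ('E_P[fun w => (((S n w - mean n) / a n - L w) ^+ 2)%R])%E @[n --> \oo] --> 0%E.

Lemma martingale_cvg_as :
  {ae P, forall w, martingale (hist n w) @[n --> \oo] --> L w}.
Proof.
apply: filterS cvg_as => w; rewrite (_ : (fun n => (S n w - mean n) / a n) = fun n => martingale (hist n w))//.
by apply/funext => n; rewrite martingale_history.
Qed.

Lemma martingale_cvg_probability (delta e : R) : 0 < delta -> 0 < e ->
  exists n0, forall n, (n0 <= n)%N ->
    (P [set w | (delta <= `|martingale (hist n w) - L w|)%R] <= e%:E)%E.
Proof.
move=> delta0 e0; have de : 0 < e * delta ^+ 2 by rewrite mulr_gt0 ?exprn_gt0.
have /fine_cvgP[hf /cvgrPdist_le/(_ _ de) hc] := cvg_L2.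
have [n0 _ hn0] := filterI hf hc.
exists n0 => n n0n; have [h1 h2] := hn0 n n0n.
apply: second_moment_tail => //.
  apply: measurable_realfun.measurable_funB => //.
  exact: (measurable_hist (history_process derw)).
rewrite (_ : (fun w => _) = (fun w => (((S n w - mean n) / a n - L w) ^+ 2)%R)).
  by rewrite -(fineK h1) lee_fin; move: h2; rewrite sub0r normrN => /(le_trans (ler_norm _)).
by apply/funext => w; rewrite martingale_history.
Qed.

End walk.

(** * The central limit theorem and the law of the iterated logarithm *)

Theorem theorem1p3 (d : measure_display) (T : measurableType d) (R : realType)
    (P : probability T R) (p q : R) (alpha beta : nat -> R)
    (S : nat -> {RV P >-> R}) (M : {RV P >-> R})
    (ES := fun n : nat => fine ('E_P[S n])%E)
    (a := derw_a p alpha)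
    (V := fun n : nat => derw_A2oo P p alpha S - derw_A2 P p alpha S n)
    (D := fun (n : nat) (w : T) => S n w - ES n - a n * M w) :
  0 <= p <= 1 ->
  0 <= q <= 1 ->
  (forall n, (0 < n)%N -> 0 <= alpha n <= 1) ->
  (forall n, (0 < n)%N -> 0 <= beta n <= 1) ->
  is_derw P p q alpha beta S ->
  (3 / 4 < p < 1 /\ (4 * p - 2)^-1 < limn_inf alpha)
  \/
  [/\ p = 1,
      (4 * p - 2)^-1 < limn_inf alpha,
      limn_inf alpha <= limn_sup alpha < 1,
      0 < limn_inf beta &
      limn_inf beta <= limn_sup beta
        < (1 - limn_sup alpha) / (1 - limn_inf alpha)] ->
  {ae P, forall w, (S n w - ES n) / a n @[n --> \oo] --> M w} ->
  ('E_P[fun w => (((S n w - ES n) / a n - M w) ^+ 2)%R])%E @[n --> \oo] --> 0%E ->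
  cvg_in_distribution P (fun n w => D n w / (a n * Num.sqrt (V n)))
    (normal_prob 0 1)
  /\
  ({ae P, forall w, limn_esup (fun n =>
      (D n w / (a n * Num.sqrt (2 * V n * ln `|ln (V n)|)))%:E) = 1%E}
   /\
   {ae P, forall w, limn_esup (fun n =>
      (- (D n w / (a n * Num.sqrt (2 * V n * ln `|ln (V n)|))))%:E) = 1%E}).
Proof.
move=> p01 q01 alpha01 beta01 derw cases cvg_as cvg_L2.
have p2 : 1 / 2 <= p by case: cases => [[]|[->]]; lra.
have [eps [d0 [d1 [N0 [[eps0 d00 d10 N00] rates]]]]] :
    exists eps d0 d1 N0, regime p q alpha beta S eps d0 d1 N0.
  case: cases => [[p34 ha]|[p1 ha ha' hb hb']].
    exact: regime_lt1.
  exact: regime_eq1.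
have kappa01 := memory01 p01 alpha01 p2.
have [C [del [N model]]] := derw_walk_model derw p01 q01 alpha01 beta01 kappa01
  eps0 d00 d10 N00 (fun n Nn => let: And3 h _ _ := rates n Nn in h)
  (fun n Nn => let: And3 _ h _ := rates n Nn in h)
  (fun n Nn => let: And3 _ _ h := rates n Nn in h).
have proc := history_process derw.
have a_gt0 n : 0 < a n by exact: derw_a_gt0 kappa01 n.
have mM : measurable_fun setT M by [].
have cvg_P := martingale_cvg_probability derw cvg_L2.
have cvg_M := martingale_cvg_as derw cvg_as.
have DE n w x : D n w / (a n * x) =
    (martingale p alpha S (history S n w) - M w) / x.
  rewrite (martingale_history derw) -/(mean S n) -/(a n) /D.
  by rewrite invfM mulrA mulrBl [a n * _]mulrC mulfK// gt_eqF.
split; last split.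
- move=> x _; rewrite -gcdfE.
  apply: cvg_trans (@process_clt _ _ _ _ _ _ proc _ _ _ _ _ _ _ model M mM cvg_P x).
  apply: near_eq_cvg; apply: nearW => n; congr (P _).
  by apply/seteqP; split => w /=; rewrite DE.
- apply: filterS (process_lil proc model mM cvg_P cvg_M (expr1n R 2)) => w.
  by congr (limn_esup _ = _); apply/funext => n; rewrite DE mul1r.
have sg2 : (- 1 : R) ^+ 2 = 1 by rewrite sqrrN expr1n.
apply: filterS (process_lil proc model mM cvg_P cvg_M sg2) => w.
by congr (limn_esup _ = _); apply/funext => n; rewrite DE mulN1r.
Qed.
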